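(* Let $$H=\left\langle\begin{bmatrix}1&4\\0&1\end{bmatrix},\begin{bmatrix}0&-1\\1&0\end{bmatrix},\begin{bmatrix}5&-8\\2&-3\end{bmatrix}\right\rangle\leq \mathrm{SL}_2(\mathbb{Z}),\qquad \Gamma=\left\langle\begin{bmatrix}1&4\\0&1\end{bmatrix},\left\{h\begin{bmatrix}0&-1\\1&0\end{bmatrix}h^{-1}:h\in H\right\}\right\rangle\leq H.$$ A vector $(p,q)\in\mathbb{Z}^2$ with $\gcd(p,q)=1$ defines a periodic direction in the Mucube $M$ if and only if there exists $N\in\Gamma$ such that $N\binom{1}{0}=\binom{p}{q}$.
   Context: The Mucube: let $C\subset\mathbb{R}^2$ be the closure of $\{(x,y):\lfloor x-1/2\rfloor\text{ and }\lfloor y-1/2\rfloor\text{ have opposite parity}\}$ and $M=\{(x,y,z)\in\mathbb{R}^3:(x,y)\in C,\ (x,z)\in C,\ (y,z)\in C\}$. $M$ is a surface tiled by closed unit square faces with vertices in $(\tfrac12+\mathbb{Z})^3$, six squares meeting at each vertex. With its intrinsic metric $M$ is flat away from the vertices, which are cone points of angle $3\pi$; $M_0$ denotes $M$ minus its cone points. Parallel transport around closed paths in $M_0$ is $\pm1$, so $M$ is a half-translation surface: $M_0$ has an atlas of isometric charts to $\mathbb{R}^2$ with transition maps $v\mapsto\pm v+c$, which send the edges of the squares to horizontal or vertical segments (equivalently, identify one square face with $[0,1]^2$ and extend by parallel transport). A straight-line trajectory of $M$ has direction $(p,q)$ (slope $q/p$) if it is a line of direction $\pm(p,q)$ in these charts.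 The vector $(p,q)$ defines a periodic direction if the straight-line trajectories in direction $(p,q)$ that do not meet cone points are periodic (closed). It is a fact that this depends neither on which of the natural identifications of a face with $[0,1]^2$ is used nor on the starting point. *)

(* Defs.v *)
From HB Require Import structures.
From mathcomp Require Import all_boot all_order all_algebra.
From mathcomp Require Import all_classical all_reals all_analysis.

Set Implicit Arguments.
Unset Strict Implicit.
Unset Printing Implicit Defensive.

Import Order.TTheory GRing.Theory Num.Theory.
Import numFieldNormedType.Exports.

Local Open Scope classical_set_scope.
Local Open Scope ring_scope.

Definition mx2 (a b c d : int) : 'M[int]_2 :=
  \matrix_(i < 2, j < 2)
    if i == 0 then (if j == 0 then a else b) else (if j == 0 then c else d).

Definition cV2 (p q : int) : 'cV[int]_2 :=
  \col_(i < 2) if i == 0 then p else q.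

Definition is_subgroup_SL2Z (G : set 'M[int]_2) : Prop :=
  [/\ forall A, G A -> \det A = 1,
      G 1,
      forall A B, G A -> G B -> G (A * B) &
      forall A, G A -> G A^-1].

Definition generated (S : set 'M[int]_2) : set 'M[int]_2 :=
  smallest is_subgroup_SL2Z S.

Definition gen_T : 'M[int]_2 := mx2 1 4 0 1.
Definition gen_J : 'M[int]_2 := mx2 0 (-1) 1 0.
Definition gen_P : 'M[int]_2 := mx2 5 (-8) 2 (-3).

Definition groupH : set 'M[int]_2 := generated [set gen_T; gen_J; gen_P].

Definition Gamma : set 'M[int]_2 :=
  generated ([set gen_T] `|` [set h * gen_J * h^-1 | h in groupH]).

(* The norms of the library on products are sup norms, hence the explicit
   Euclidean distances. *)
Definition dist2 (R : realType) (u v : R * R) : R :=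
  Num.sqrt ((u.1 - v.1) ^+ 2 + (u.2 - v.2) ^+ 2).

Definition dist3 (R : realType) (u v : R * R * R) : R :=
  Num.sqrt ((u.1.1 - v.1.1) ^+ 2 + (u.1.2 - v.1.2) ^+ 2 + (u.2 - v.2) ^+ 2).

Definition checkerboard (R : realType) : set (R * R) :=
  closure [set u : R * R |
    (Num.floor (u.1 - 2^-1) %% 2)%Z != (Num.floor (u.2 - 2^-1) %% 2)%Z].

Definition mucube (R : realType) : set (R * R * R) :=
  [set u | [/\ checkerboard (u.1.1, u.1.2),
               checkerboard (u.1.1, u.2) &
               checkerboard (u.1.2, u.2)]].

Definition half_integer (R : realType) (x : R) : Prop :=
  exists n : int, x = n%:~R + 2^-1.

(* All points of (1/2 + Z)^3 lie on M and are vertices of its tiling. *)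
Definition cone_point (R : realType) : set (R * R * R) :=
  [set u | [/\ half_integer u.1.1, half_integer u.1.2 & half_integer u.2]].

Definition mucube0 (R : realType) : set (R * R * R) :=
  @mucube R `\` @cone_point R.

(* Every unit segment between two points of (1/2 + Z)^3 lies in exactly two of
   the square faces of M, so these segments are all the edges of the squares. *)
Definition is_edge (R : realType) (E : set (R * R * R)) : Prop :=
  exists a b : R * R * R,
    [/\ cone_point a, cone_point b, dist3 a b = 1 &
        E = [set a + t *: (b - a) | t in `[0, 1] ] ].

Definition curve_length (R : realType) (c : R -> R * R * R) (a b : R) : \bar R :=
  ereal_sup [set (\sum_(0 <= k < size s)
                    dist3 (c (nth b (a :: s) k)) (c (nth b s k)))%:E
            | s in itv_partition a b].

Definition intrinsic_dist (R : realType) (u v : R * R * R) : \bar R :=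
  ereal_inf [set curve_length c 0 1
            | c in [set c : R -> R * R * R |
                [/\ {within `[0, 1], continuous c}, c 0 = u, c 1 = v &
                    forall t, t \in `[0, 1] -> mucube (c t)]]].

(* The values of [cmap] outside [cdom] are irrelevant. *)
Record chart (R : realType) := Chart {
  cdom : set (R * R * R);
  cmap : R * R * R -> R * R }.

(* A homeomorphism from a relatively open subset of M_0 onto an open subset of
   the plane that is a local isometry for the intrinsic metric of M. *)
Definition isometric_chart (R : realType) (c : chart R) : Prop :=
  [/\ exists2 O : set (R * R * R), open O & cdom c = O `&` @mucube0 R,
      {within cdom c, continuous (cmap c)} /\ {in cdom c &, injective (cmap c)},
      forall O : set (R * R * R), open O -> open (cmap c @` (cdom c `&` O)) &
      forall x, cdom c x -> \forall y & z \near x, cdom c y -> cdom c z ->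
        intrinsic_dist y z = (dist2 (cmap c y) (cmap c z))%:E].

Definition half_translation_compatible (R : realType) (c d : chart R) : Prop :=
  forall x, cdom c x -> cdom d x ->
    exists (s : bool) (w : R * R), \forall y \near x,
      cdom c y -> cdom d y -> cmap d y = (-1) ^+ s *: cmap c y + w.

Definition edges_axis_parallel (R : realType) (c : chart R) : Prop :=
  forall E x, is_edge E -> E x -> cdom c x ->
    (\forall y \near x, E y -> cdom c y -> (cmap c y).1 = (cmap c x).1) \/
    (\forall y \near x, E y -> cdom c y -> (cmap c y).2 = (cmap c x).2).

(* M_0 is connected, so two such atlases become compatible after composing the
   charts of one of them with a single linear isometry of the plane that
   preserves the pair of coordinate axes. *)
Definition half_translation_atlas (R : realType) (A : set (chart R)) : Prop :=
  [/\ forall c, A c -> isometric_chart c,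
      \bigcup_(c in A) cdom c = @mucube0 R,
      forall c d, A c -> A d -> half_translation_compatible c d &
      forall c, A c -> edges_axis_parallel c].

Definition straight_line_trajectory (R : realType) (A : set (chart R))
    (v : R * R) (g : R -> R * R * R) : Prop :=
  [/\ continuous g,
      forall t, mucube0 (g t) &
      forall c t0, A c -> cdom c (g t0) ->
        exists s : bool, \forall t \near t0,
          cmap c (g t) = cmap c (g t0) + (t - t0) *: ((-1) ^+ s *: v)].

Definition periodic (R : realType) (g : R -> R * R * R) : Prop :=
  exists2 T : R, 0 < T & forall t, g (t + T) = g t.

Definition periodic_direction (R : realType) (A : set (chart R)) (v : R * R) : Prop :=
  forall g, straight_line_trajectory A v g -> periodic g.

(* Main.v *)
Require Import Defs.
From HB Require Import structures.
From mathcomp Require Import all_boot all_order all_algebra.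
From mathcomp Require Import all_classical all_reals all_analysis.
From mathcomp Require Import zify ring lra.

(** Unfold the surface along a straight line of direction (p, q): the faces met by
    the line are the unit cells of the plane, and going to the right or upwards
    multiplies the frame of a face by one of two fixed isometries r, u of R^3. So
    the trajectory changes by an isometry D over one period (p, q), and it is closed
    if and only if D has finite order; otherwise a power of D is a translation.

    A change of basis of Z^2 changes (p, q) and the pair (r, u) together, keeping D.
    Pairs with the linear parts of (r, u) and a commutator of finite order form,
    up to conjugacy, a two-parameter family (x, y), with (1, 0) the original pair.
    On it [gen_J] acts trivially, [gen_T] by (x + 2y, y) and [gen_P] by (x, y + 2x).
    Every direction is the image under some h in H of (1, 0), (2, 1) or (1, 1), for
    which D has finite order when y = 0, x = 0 or x = y respectively. By ping-pong,
    an h that does not lie in Gamma sends (1, 0) to parameters with x, y nonzero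
    and |x| <> |y|; hence the periodic directions are the orbit of (1, 0) under Gamma.

    In the charts of a half-translation atlas, trajectories are straight in the
    faces because the intrinsic distance of two points of a face is Euclidean, and
    go straight across the edges because the charts are injective. *)

Set Implicit Arguments.
Unset Strict Implicit.
Unset Printing Implicit Defensive.

Import Order.TTheory GRing.Theory Num.Theory.
Import numFieldNormedType.Exports.
Local Open Scope ring_scope.

(** Around a vertex the surface turns by 3 pi instead of 2 pi, so [right] and [up] do not commute
    and frames cannot be attached to all cells of the plane at once. Labels are therefore
    constrained only across the edges that the line crosses, a notion that still follows the line
    under rotations, reflections and shears of the lattice. In the three model directions the
    holonomy is conjugate to [r], [r * (u * r)] and [u * r]: screw motions with a turn of order 4, 2
    and 3 and a pitch proportional to [y], [x] and [x - y], whence the three conditions for finite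
    order. A shear fixing a model direction multiplies the other member of the basis pair by a power
    of the screw; this power is a translation for the exponents 4 (direction (1, 0)) and 2
    (direction (2, 1)), so that linear parts survive and only (x, y) moves. This explains the 4 in
    [gen_T] and the conjugate of (1, -2; 0, 1) in [gen_P]. The resulting shears of (x, y) have
    coefficient 2, just enough for ping-pong. *)

(** * Holonomy of a line in a punctured torus *)

(** Euclid's algorithm in the form that a quarter turn and one shear generate SL_2(Z), so that
    everything about directions is proved for (1, 0) and carried along these two moves. *)
Lemma coprime_pair_ind (Q : int -> int -> Prop) :
  Q 1 0 -> (forall p q, Q p q -> Q (- q) p) ->
  (forall p q, Q p q -> Q p (q + p)) ->
  forall p q, gcdz p q = 1 -> Q p q.
Proof.
move=> Q1 QJ QL.
(* The inverse shear is the word J L J L J in the quarter turn J and the shear L. *)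
have QL' p q : Q p q -> Q p (q - p).
  move=> /QJ /QL /QJ /QL /QJ.
  by congr (Q _ _); ring.
have QLm (m : int) p q : Q p q -> Q p (q + m * p).
  move=> Qpq; elim/int_ind: m => [|n IH|n IH]; first by rewrite mul0r addr0.
    by rewrite intS addrC mulrDl mul1r -addrA addrC; rewrite [X in Q p (X + _)]addrC; apply: QL.
  have -> : q + - n.+1%:Z * p = q + - n%:Z * p - p by rewrite intS; ring.
  exact: QL'.
move=> p q; have [n] := ubnP `|p|%N; elim: n p q => // n IH p q ltn pq1.
have [p0|p0] := eqVneq p 0.
  move: pq1; rewrite p0 gcd0z => q1.
  have : q = 1 \/ q = -1 by lia.
  by case=> ->; [exact: (QJ _ _ Q1)|exact: (QJ _ _ (QJ _ _ (QJ _ _ Q1)))].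
rewrite (divz_eq q p) addrC; apply: QLm.
rewrite -[p in Q p _]opprK; apply: QJ; apply: IH.
  by have := ltz_mod q p0; have := modz_ge0 q p0; lia.
by rewrite gcdzN gcdzC gcdz_modr.
Qed.

Section Holonomy.
Local Open Scope group_scope.
Variable G : groupType.
Implicit Types (K : G -> Prop) (r u c x D : G).

Definition subgroup K :=
  [/\ K 1, forall x y, K x -> K y -> K (x * y) & forall x, K x -> K x^-1].

(* Which lattice points lie below the line [p y - q x = k + 1/2]. *)
Definition side (p q k i j : int) : bool := (p * j - q * i <= k)%R.

(* [S i j] is the frame over the unit cell with lower left corner [(i, j)]; it
   is only constrained across the edges that the line crosses, and [D] is the
   resulting holonomy of one period [(p, q)] of the line. *)
Record labelling K r u (p q k : int) (S : int -> int -> G) D : Prop := Labelling {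
  lab_in : forall i j, K (S i j);
  lab_r : forall i j : int,
    side p q k (i + 1)%R j != side p q k (i + 1)%R (j + 1)%R ->
    S (i + 1)%R j = S i j * r;
  lab_u : forall i j : int,
    side p q k i (j + 1)%R != side p q k (i + 1)%R (j + 1)%R ->
    S i (j + 1)%R = S i j * u;
  lab_period : forall i j, S (i + p)%R (j + q)%R = D * S i j }.

(** Leaving the level [k] and the labelling [S] free makes this a relation that is stable under
    conjugation of [D] by elements of a subgroup [K]; having finite order, or a power that is a
    translation, is invariant under the conjugations that occur. *)
Definition holonomy K r u (p q : int) D :=
  exists k S, labelling K r u p q k S D.

Lemma labelling_swap K r u p q k S D : labelling K r u p q k S D ->
  labelling K u r^-1 q (- p)%R k (fun i j => S (- j - 1)%R i) D.
Proof.
case=> SK Sr Su SD; split=> [i j|i j|i j|i j] //.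
- move=> ne.
  by rewrite -Su //; move: ne; rewrite /side; lia.
- move=> ne; apply: (@mulIg _ r); rewrite mulgVK.
  have -> : S (- j - 1)%R i = S (- (j + 1) - 1 + 1)%R i by congr S; ring.
  by rewrite Sr //; move: ne; rewrite /side; lia.
- by rewrite -SD; congr S; ring.
Qed.

(** The reflection exchanges the two sides of the line: the level k + 1/2 becomes -(k + 1/2) = (-k -
    1) + 1/2. Cells are named by their lower left corners, hence the row -j - 1. *)
Lemma labelling_reflect K r u p q k S D : labelling K r u p q k S D ->
  labelling K r u^-1 p (- q)%R (- k - 1)%R (fun i j => S i (- j - 1)%R) D.
Proof.
case=> SK Sr Su SD; split=> [i j|i j|i j|i j] //.
- by move=> ne; rewrite -Sr //; move: ne; rewrite /side; lia.
- move=> ne; apply: (@mulIg _ u); rewrite mulgVK.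
  have -> : S i (- j - 1)%R = S i (- (j + 1) - 1 + 1)%R by congr S; ring.
  by rewrite Su //; move: ne; rewrite /side; lia.
- by rewrite -SD; congr S; ring.
Qed.

Lemma labelling_conj K r u p q k S D c : subgroup K -> K c ->
  labelling K r u p q k S D ->
  labelling K (c * r * c^-1) (c * u * c^-1) p q k (fun i j => S i j * c^-1) D.
Proof.
move=> [K1 KM KV] Kc [SK Sr Su SD]; split=> [i j|i j|i j|i j].
- by apply: KM => //; apply: KV.
- by move=> /Sr ->; rewrite !mulgA mulgVK.
- by move=> /Su ->; rewrite !mulgA mulgVK.
- by rewrite SD mulgA.
Qed.

Lemma labelling_left K r u p q k S D c : subgroup K -> K c ->
  labelling K r u p q k S D ->
  labelling K r u p q k (fun i j => c * S i j) (c * D * c^-1).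
Proof.
move=> [K1 KM KV] Kc [SK Sr Su SD]; split=> [i j|i j|i j|i j].
- exact: KM.
- by move=> /Sr ->; rewrite !mulgA.
- by move=> /Su ->; rewrite !mulgA.
- by rewrite SD !mulgA mulgVK.
Qed.

Lemma labelling_shift K r u p q k S D (a b : int) :
  labelling K r u p q k S D ->
  labelling K r u p q (k - (p * b - q * a))%R
    (fun i j => S (i + a)%R (j + b)%R) D.
Proof.
case=> SK Sr Su SD; split=> [i j|i j|i j|i j] //.
- have -> : (i + 1 + a = i + a + 1)%R by ring.
  by move=> ne; rewrite Sr //; move: ne; rewrite /side; lia.
- have -> : (j + 1 + b = j + b + 1)%R by ring.
  by move=> ne; rewrite Su //; move: ne; rewrite /side; lia.
- by rewrite -SD; congr S; ring.
Qed.

(* The sheared cell is the union of the upper triangle of the cell [(i, j)] and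
   of the lower triangle of [(i, j + 1)]; it takes the label of the triangle
   that the line meets, and the two choices agree if the line meets both. *)
Lemma labelling_shear K r u p q k S D : subgroup K -> K u ->
  labelling K r u p (q + p)%R k S D ->
  labelling K (u * r) u p q k
    (fun i j' => let j := (j' + i)%R in
      if (side p (q + p)%R k i j == side p (q + p)%R k i (j + 1)%R) &&
         (side p (q + p)%R k i (j + 1)%R ==
          side p (q + p)%R k (i + 1)%R (j + 1)%R)
      then S i (j + 1)%R * u^-1 else S i j) D.
Proof.
move=> [K1 KM KV] Ku [SK Sr Su SD]; split=> [i j|i j|i j|i j].
- by rewrite /=; case: ifP => _ //; apply: KM => //; apply: KV.
- move=> ne /=.
  have -> : (j + (i + 1) = j + i + 1)%R by ring.
  have ne1 : side p (q + p)%R k (i + 1)%R (j + i + 1)%R !=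
             side p (q + p)%R k (i + 1)%R (j + i + 1 + 1)%R.
    by move: ne; rewrite /side; lia.
  rewrite (negPf ne1) /= Sr // mulgA; congr (_ * r).
  case: ifP => h; first by rewrite mulgVK.
  by rewrite Su //; move: h ne1; rewrite /side; lia.
- move=> ne /=.
  have -> : (j + 1 + i = j + i + 1)%R by ring.
  have ne1 : side p (q + p)%R k i (j + i + 1)%R !=
             side p (q + p)%R k (i + 1)%R (j + i + 1 + 1)%R.
    by move: ne; rewrite /side; lia.
  rewrite ifF; last by move: ne1; rewrite /side; lia.
  case: ifP => h; first by rewrite mulgVK.
  by rewrite Su //; move: h ne1; rewrite /side; lia.
- rewrite /=.
  have e a b : side p (q + p)%R k (i + p + a)%R (j + q + (i + p) + b)%R =
     side p (q + p)%R k (i + a)%R (j + i + b)%R.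
    by congr (_ <= _)%R; ring.
  have := e 0%R 0%R; have := e 0%R 1%R; have := e 1%R 1%R.
  rewrite !addr0 => -> -> ->.
  have -> : (j + q + (i + p) = j + i + (q + p))%R by ring.
  have -> : (j + i + (q + p) + 1 = j + i + 1 + (q + p))%R by ring.
  by rewrite !SD; case: ifP => _ //; rewrite mulgA.
Qed.

Lemma holonomy_conj K r u p q D c : subgroup K -> K c ->
  holonomy K (c * r * c^-1) (c * u * c^-1) p q D <-> holonomy K r u p q D.
Proof.
move=> sK Kc; split=> [[k [S lS]]|[k [S lS]]].
- have Kc' : K c^-1 by case: sK => _ _; apply.
  have := labelling_conj sK Kc' lS.
  rewrite invgK !mulgA !mulVg !mul1g !mulgVK => h.
  by exists k; eexists; apply: h.
- by exists k; eexists; apply: (labelling_conj sK Kc lS).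
Qed.

(** The quarter turn has order four on the data (r, u, p, q), so three more turns give the
    converse. *)
Lemma holonomy_J K r u p q D :
  holonomy K r u (- q)%R p D <-> holonomy K u r^-1 p q D.
Proof.
have sw r' u' p' q' : holonomy K r' u' p' q' D ->
    holonomy K u' r'^-1 q' (- p')%R D.
  by case=> k [S /labelling_swap lS]; exists k; eexists; apply: lS.
split=> [/sw|/sw /sw /sw]; rewrite ?opprK ?invgK; apply.
Qed.

(** A reflection conjugates the shear to its inverse; the converse is thus the direct implication
    for [u^-1] between two reflections. *)
Lemma holonomy_L K r u p q D : subgroup K -> K u ->
  holonomy K r u p (q + p)%R D <-> holonomy K (u * r) u p q D.
Proof.
move=> sK Ku.
have re r' u' p' q' : holonomy K r' u' p' q' D ->
    holonomy K r' u'^-1 p' (- q')%R D.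
  by case=> k [S /labelling_reflect lS]; exists (- k - 1)%R; eexists; apply: lS.
have sh r' u' p' q' : K u' -> holonomy K r' u' p' (q' + p')%R D ->
    holonomy K (u' * r') u' p' q' D.
  by move=> Ku' [k [S /(labelling_shear sK Ku') lS]]; exists k; eexists; apply: lS.
split=> [/sh|/re h]; first exact.
have {}h : holonomy K (u^-1 * (u * r)) u^-1 p (- (q + p))%R D.
  apply: sh; first by case: sK => _ _; apply.
  by have -> : (- (q + p) + p = - q)%R by ring.
by have /re := h; rewrite mulKg invgK opprK.
Qed.

(** A horizontal line of level k + 1/2 runs through the cells of row [k], where one period is a
    single step to the right. *)
Lemma holonomy_e1 K r u D : holonomy K r u 1 0 D ->
  exists2 x, K x & D = x * r * x^-1.
Proof.
case=> k [S [SK Sr Su SD]]; exists (S 0%R k) => //.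
have := SD 0%R k; rewrite addr0 Sr; last by rewrite /side; lia.
by move=> ->; rewrite mulgK.
Qed.

Definition zexpg x (n : int) := match n with Posz n => x ^+ n | Negz n => x ^- n.+1 end.

Lemma zexpgS x n : zexpg x (n + 1)%R = zexpg x n * x.
Proof.
case: n => [n|[|n]]; first by rewrite -PoszD addn1 /= expgSr.
  by rewrite /= mulVg.
have -> : (Negz n.+1 + 1 = Negz n)%R by lia.
by rewrite /= [in RHS]expgS invgM mulgVK.
Qed.

Lemma zexpgSl x n : zexpg x (n + 1)%R = x * zexpg x n.
Proof.
rewrite zexpgS; apply: commute_sym; case: n => n /=.
  exact: commuteX.
exact/commuteV/commuteX.
Qed.

Lemma subgroup_zexpg K x n : subgroup K -> K x -> K (zexpg x n).
Proof.
move=> [K1 KM KV] Kx.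
have KX m : K (x ^+ m) by elim: m => [|m IH]; rewrite ?expg0 // expgS; apply: KM.
by case: n => n //=; apply: KV.
Qed.

Lemma holonomy_ex K r u (p q : int) : subgroup K -> K r -> K u ->
  gcdz p q = 1%R -> exists D, holonomy K r u p q D.
Proof.
move=> sK Kr Ku pq1; move: r u Kr Ku; move: p q pq1.
have [K1 KM KV] := sK.
apply: (coprime_pair_ind (Q := fun p q => forall r u, K r -> K u ->
  exists D, holonomy K r u p q D)) => [r u Kr Ku|p q IH r u Kr Ku|p q IH r u Kr Ku].
- exists r, 0%R, (fun i _ => zexpg r i); split=> [i j|i j|i j|i j].
  + exact: subgroup_zexpg.
  + by rewrite zexpgS.
  + by rewrite /side; lia.
  + by rewrite zexpgSl.
- by have [D /holonomy_J hD] := IH u r^-1 Ku (KV _ Kr); exists D.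
- by have [D /(holonomy_L _ _ _ _ sK Ku) hD] := IH (u * r) u (KM _ _ Ku Kr) Ku; exists D.
Qed.

(** Both normalisations are free: translating the lattice by a multiple of a Bezout vector brings
    the level to any prescribed [k], and left multiplication brings any one label to [x], at the
    cost of conjugating [D]. *)
Lemma labelling_ex K r u (p q k : int) x i0 j0 :
  subgroup K -> K r -> K u -> K x -> gcdz p q = 1%R ->
  exists2 D, holonomy K r u p q D & exists2 S, labelling K r u p q k S D & S i0 j0 = x.
Proof.
move=> sK Kr Ku Kx pq1; have [K1 KM KV] := sK.
have [D [k' [S lS]]] := holonomy_ex sK Kr Ku pq1.
have [a [b]] := Bezoutz p q; rewrite pq1 => ab.
have /(labelling_shift ((k' - k) * - b) ((k' - k) * a)) := lS.
set S' := fun i j => S _ _; set k2 := (_ - _)%R.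
have -> : k2 = k.
  rewrite /k2.
  have -> : (p * ((k' - k) * a) - q * ((k' - k) * - b) = (k' - k) * (a * p + b * q))%R by ring.
  by rewrite ab; ring.
move=> lS'; set c := x * (S' i0 j0)^-1.
have Kc : K c by apply: KM => //; apply: KV; exact: (lab_in lS').
have := labelling_left sK Kc lS' => lS2.
exists (c * D * c^-1); first by exists k; eexists; exact: lS2.
by eexists; first exact: lS2; rewrite /= /c mulgVK.
Qed.

End Holonomy.

(** * Integer matrices and bijections *)

Lemma mx2_mul a b c d a' b' c' d' :
  mx2 a b c d * mx2 a' b' c' d' =
  mx2 (a * a' + b * c') (a * b' + b * d') (c * a' + d * c') (c * b' + d * d').
Proof.
apply/matrixP => i j; rewrite -[_ * _]/(_ *m _) !mxE !big_ord_recl big_ord0 addr0 !mxE.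
by case: i j => [[|[|//]] ?] [[|[|//]] ?].
Qed.

Lemma mx2_cV2 a b c d p q :
  mx2 a b c d *m cV2 p q = cV2 (a * p + b * q) (c * p + d * q).
Proof.
apply/colP => i; rewrite !mxE !big_ord_recl big_ord0 addr0 !mxE.
by case: i => [[|[|//]] ?].
Qed.

Lemma mx2_id : mx2 1 0 0 1 = 1.
Proof.
by apply/matrixP => i j; rewrite !mxE; case: i j => [[|[|//]] ?] [[|[|//]] ?].
Qed.

Lemma cV2_eta (v : 'cV[int]_2) : v = cV2 (v 0 0) (v 1 0).
Proof.
apply/colP => i; rewrite !mxE; case: i => [[|[|//]] ?] /=; congr (v _ _); exact: val_inj.
Qed.

Lemma det_mx2 a b c d : \det (mx2 a b c d) = a * d - b * c.
Proof.
rewrite (expand_det_row _ ord0) !big_ord_recl big_ord0 addr0 /cofactor !det_mx11 !mxE /=.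
by rewrite expr0 expr1 mul1r mulN1r mulrN.
Qed.

Lemma SL2Z_mulV (A : 'M[int]_2) : \det A = 1 -> A * A^-1 = 1.
Proof. by move=> dA; rewrite mulrV // unitmxE dA unitr1. Qed.

Lemma SL2Z_Vmul (A : 'M[int]_2) : \det A = 1 -> A^-1 * A = 1.
Proof. by move=> dA; rewrite mulVr // unitmxE dA unitr1. Qed.

Lemma mx2_inv a b c d : a * d - b * c = 1 -> (mx2 a b c d)^-1 = mx2 d (- b) (- c) a.
Proof.
move=> d1; have := SL2Z_mulV (etrans (det_mx2 a b c d) d1).
move=> /(congr1 (fun X => mx2 d (- b) (- c) a * X)).
rewrite mulrA mulr1 mx2_mul.
have -> : d * a + - b * c = 1 by rewrite -d1; ring.
have -> : d * b + - b * d = 0 by ring.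
have -> : - c * a + a * c = 0 by ring.
have -> : - c * b + a * d = 1 by rewrite -d1; ring.
by rewrite mx2_id mul1r.
Qed.

Lemma generated_sub (S X : set 'M[int]_2) : (S `<=` X)%classic ->
  is_subgroup_SL2Z X -> (generated S `<=` X)%classic.
Proof. by move=> SX sX A hA; exact: (hA X (conj sX SX)). Qed.

(** The determinant hypothesis shows that SL_2(Z) itself takes part in the intersection defining
    [generated], which could otherwise be an intersection over no subgroup at all. *)
Lemma generated_subgroup (S : set 'M[int]_2) : (forall A, S A -> \det A = 1) ->
  is_subgroup_SL2Z (generated S).
Proof.
move=> Sdet; split.
- move=> A hA; apply: (hA [set A | \det A = 1]%classic); split=> //; split=> //=.
  + by rewrite det1.
  + by move=> B C dB dC; rewrite -[B * C]/(B *m C) det_mulmx dB dC mul1r.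
  + by move=> B dB; rewrite -[B^-1]/(invmx B) det_inv dB invr1.
- by move=> X [[]].
- move=> A B hA hB X hX; case: (hX) => [[_ _ M _] _].
  by apply: M; [exact: hA|exact: hB].
- by move=> A hA X hX; case: (hX) => [[_ _ _ V] _]; apply: V; exact: hA.
Qed.

Lemma sub_generated (S : set 'M[int]_2) : (S `<=` generated S)%classic.
Proof. by move=> A SA X [_ SX]; exact: SX. Qed.

Section Bijections.
Variable T : Type.

(** The inverse is carried as data so that inverses of explicit isometries reduce to explicit
    formulas by conversion. *)
Record bijection := Bijection {
  bijection_fun :> T -> T;
  bijection_inv : T -> T;
  bijK : cancel bijection_fun bijection_inv;
  bijVK : cancel bijection_inv bijection_fun }.

Lemma bij_ext (f g : bijection) : f =1 g -> f = g.
Proof.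
case: f g => f f' fK f'K [g g' gK g'K] /= /funext fg; move: fK f'K; rewrite fg => fK f'K.
have e : f' = g' by apply/funext => x; rewrite -{1}(g'K x) fK.
by move: fK f'K; rewrite e => fK f'K; congr Bijection; exact: Prop_irrelevance.
Qed.

HB.instance Definition _ := gen_eqMixin bijection.
HB.instance Definition _ := gen_choiceMixin bijection.

Definition bij_one := @Bijection id id (fun=> erefl) (fun=> erefl).
Definition bij_opp (f : bijection) := Bijection (@bijVK f) (@bijK f).
Definition bij_mul (f g : bijection) :=
  Bijection (can_comp (@bijK f) (@bijK g)) (can_comp (@bijVK g) (@bijVK f)).

Fact bij_mulA : associative bij_mul. Proof. by move=> f g h; exact: bij_ext. Qed.
Fact bij_mul1 : left_id bij_one bij_mul. Proof. by move=> f; exact: bij_ext. Qed.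
Fact bij_1mul : right_id bij_one bij_mul. Proof. by move=> f; exact: bij_ext. Qed.
Fact bij_mulV : left_inverse bij_one bij_opp bij_mul.
Proof. by move=> f; apply: bij_ext => x /=; rewrite bijK. Qed.
Fact bij_Vmul : right_inverse bij_one bij_opp bij_mul.
Proof. by move=> f; apply: bij_ext => x /=; rewrite bijVK. Qed.

HB.instance Definition _ :=
  isGroup.Build bijection bij_mulA bij_mul1 bij_1mul bij_mulV bij_Vmul.

Local Open Scope group_scope.
Lemma bijM (f g : bijection) x : (f * g) x = f (g x). Proof. by []. Qed.
Lemma bij1 x : (1 : bijection) x = x. Proof. by []. Qed.
Lemma bijKg (f : bijection) x : f^-1 (f x) = x. Proof. exact: bijK. Qed.
Lemma bijVKg (f : bijection) x : f (f^-1 x) = x. Proof. exact: bijVK. Qed.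

End Bijections.
Arguments Bijection {T bijection_fun bijection_inv}.

(** * Affine bijections and the two possible behaviours of a holonomy *)

Section Affine.
Variable V : zmodType.
Implicit Types f g : bijection V.
Local Open Scope group_scope.

(** Preserving x + y - z is affinity over the integers. It is enough for an affine conjugate of the
    translation by c to be the translation by g c - g 0. *)
Definition affine f := forall x y z : V, f (x + y - z)%R = (f x + f y - f z)%R.

Lemma affine_subgroup : subgroup affine.
Proof.
split=> [//|f g hf hg x y z|f hf x y z].
  by rewrite !bijM hg hf.
by rewrite -[RHS](bijKg f) hf !bijVKg.
Qed.

Definition finite_order f := exists2 n, (0 < n)%N & f ^+ n = 1.

Definition translation_power f :=
  exists n, exists2 c : V, c != 0%R & forall x, (f ^+ n) x = (x + c)%R.

Lemma finite_order_conj f g : finite_order f -> finite_order (g * f * g^-1).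
Proof.
case=> n n0 fn; exists n => //.
by rewrite -{1}[g]invgK -mulgA -[_ * (f * _)]/(f ^ g^-1) -conjXg fn conj1g.
Qed.

Lemma translation_power_conj f g : affine g -> translation_power f ->
  translation_power (g * f * g^-1).
Proof.
move=> ag [n [c c0 fn]]; exists n, (g c - g 0)%R.
  apply: contra c0; rewrite subr_eq0 => /eqP e.
  by rewrite -(bijKg g c) e bijKg.
move=> x; rewrite -{1}[g]invgK -mulgA -[_ * (f * _)]/(f ^ g^-1) -conjXg.
rewrite conjgE invgK !bijM fn -[(_ + c)%R]subr0 ag bijVKg addrA //.
Qed.

End Affine.

(** * The two-parameter family of pairs of isometries *)

Section Family.
Variable R : realFieldType.
Local Notation R3 := (R * R * R)%type.
Implicit Types x y : R.

(* With [x = 1] and [y = 0], [right] and [up] carry the frame of a face of the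
   surface to the frames of the neighbouring faces; up to conjugacy, the other
   values describe all the pairs with the same linear parts and with a commutator
   of finite order. *)
Definition right_fun x y (v : R3) : R3 := (x - y - v.2, v.1.2 + y, v.1.1).
Definition right_inv x y (v : R3) : R3 := (v.2, v.1.2 - y, x - y - v.1.1).
Definition up_fun x y (v : R3) : R3 := (v.1.1 - y, x - y + v.2, - v.1.2).
Definition up_inv x y (v : R3) : R3 := (v.1.1 + y, - v.2, v.1.2 - (x - y)).

Fact right_funK x y : cancel (right_fun x y) (right_inv x y).
Proof. by move=> [[s t] w]; rewrite /right_fun /right_inv /=; congr (_, _, _) => /=; ring. Qed.
Fact right_invK x y : cancel (right_inv x y) (right_fun x y).
Proof. by move=> [[s t] w]; rewrite /right_fun /right_inv /=; congr (_, _, _) => /=; ring. Qed.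
Fact up_funK x y : cancel (up_fun x y) (up_inv x y).
Proof. by move=> [[s t] w]; rewrite /up_fun /up_inv /=; congr (_, _, _) => /=; ring. Qed.
Fact up_invK x y : cancel (up_inv x y) (up_fun x y).
Proof. by move=> [[s t] w]; rewrite /up_fun /up_inv /=; congr (_, _, _) => /=; ring. Qed.

Definition right x y : bijection R3 := Bijection (right_funK x y) (right_invK x y).
Definition up x y : bijection R3 := Bijection (up_funK x y) (up_invK x y).

Definition transl_fun (c v : R3) : R3 := v + c.
Fact transl_funK c : cancel (transl_fun c) (transl_fun (- c)).
Proof. by move=> v; rewrite /transl_fun addrK. Qed.
Fact transl_invK c : cancel (transl_fun (- c)) (transl_fun c).
Proof. by move=> v; rewrite /transl_fun subrK. Qed.
Definition transl c : bijection R3 := Bijection (transl_funK c) (transl_invK c).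

(** For [x = 1] and [y = 0] this extends a quarter turn of the base face to space. Conjugation by
    its inverse takes the pair ([right], [up]) to ([up], [right^-1]), which is exactly the effect of
    [gen_J] on pairs. *)
Definition quarter_fun x y (v : R3) : R3 := (v.1.2, x - y - v.1.1, - v.2).
Definition quarter_inv x y (v : R3) : R3 := (x - y - v.1.2, v.1.1, - v.2).
Fact quarter_funK x y : cancel (quarter_fun x y) (quarter_inv x y).
Proof. by move=> [[s t] w]; rewrite /quarter_fun /quarter_inv /=; congr (_, _, _) => /=; ring. Qed.
Fact quarter_invK x y : cancel (quarter_inv x y) (quarter_fun x y).
Proof. by move=> [[s t] w]; rewrite /quarter_fun /quarter_inv /=; congr (_, _, _) => /=; ring. Qed.
Definition quarter x y : bijection R3 := Bijection (quarter_funK x y) (quarter_invK x y).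

Lemma add3E (a b c a' b' c' : R) : (a, b, c) + (a', b', c') = (a + a', b + b', c + c') :> R3.
Proof. by []. Qed.
Lemma opp3E (a b c : R) : - (a, b, c) = (- a, - b, - c) :> R3.
Proof. by []. Qed.

Lemma rightE x y s t w : right x y (s, t, w) = (x - y - w, t + y, s).
Proof. by []. Qed.
Lemma upE x y s t w : up x y (s, t, w) = (s - y, x - y + w, - t).
Proof. by []. Qed.
Lemma quarterE x y s t w : quarter x y (s, t, w) = (t, x - y - s, - w).
Proof. by []. Qed.
Lemma translE a b c s t w : transl (a, b, c) (s, t, w) = (s + a, t + b, w + c).
Proof. by []. Qed.
Lemma rightVE x y s t w : (right x y)^-1%g (s, t, w) = (w, t - y, x - y - s).
Proof. by []. Qed.
Lemma upVE x y s t w : (up x y)^-1%g (s, t, w) = (s + y, - w, t - (x - y)).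
Proof. by []. Qed.
Lemma quarterVE x y s t w : (quarter x y)^-1%g (s, t, w) = (x - y - t, s, - w).
Proof. by []. Qed.
Lemma translVE a b c s t w : (transl (a, b, c))^-1%g (s, t, w) = (s - a, t - b, w - c).
Proof. by []. Qed.

Definition bijE := (bijM, add3E, opp3E, rightE, upE, quarterE, translE,
  rightVE, upVE, quarterVE, translVE).

Lemma affine_right x y : affine (right x y).
Proof. by move=> [[? ?] ?] [[? ?] ?] [[? ?] ?]; rewrite !bijE; congr (_, _, _) => /=; ring. Qed.
Lemma affine_up x y : affine (up x y).
Proof. by move=> [[? ?] ?] [[? ?] ?] [[? ?] ?]; rewrite !bijE; congr (_, _, _) => /=; ring. Qed.
Lemma affine_quarter x y : affine (quarter x y).
Proof. by move=> [[? ?] ?] [[? ?] ?] [[? ?] ?]; rewrite !bijE; congr (_, _, _) => /=; ring. Qed.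
Lemma affine_transl c : affine (transl c).
Proof.
by case: c => [[? ?] ?] [[? ?] ?] [[? ?] ?] [[? ?] ?]; rewrite !bijE; congr (_, _, _) => /=; ring.
Qed.

Definition hol x y p q D := holonomy (@affine R3) (right x y) (up x y) p q D.

Local Open Scope group_scope.
Local Notation sA := (@affine_subgroup R3).
Local Notation Hol := (holonomy (@affine R3)).

Lemma holonomy_JV r u p q D : Hol r u q (- p)%R D <-> Hol u^-1 r p q D.
Proof. by have := holonomy_J (@affine R3) u^-1 r q (- p)%R D; rewrite opprK invgK => ->. Qed.

Lemma holonomy_LV r u p q D : affine u -> Hol r u p (q - p)%R D <-> Hol (u^-1 * r) u p q D.
Proof.
move=> au; rewrite -{2}[q](subrK p) (holonomy_L _ _ _ _ sA au).
by rewrite mulVKg.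
Qed.

Lemma affineM (f g : bijection R3) : affine f -> affine g -> affine (f * g).
Proof. by case: sA => _ + _; apply. Qed.
Lemma affineV (f : bijection R3) : affine f -> affine f^-1.
Proof. by case: sA => _ _; apply. Qed.

Lemma hol_J x y p q D : hol x y (- q)%R p D <-> hol x y p q D.
Proof.
rewrite /hol holonomy_J -(holonomy_conj (right x y) (up x y) p q D sA (affineV (affine_quarter x y))) invgK.
set c := quarter x y.
set r2 := c^-1 * _ * _; set u2 := c^-1 * _ * _.
have <- : up x y = r2.
  by apply: bij_ext => -[[s t] w]; rewrite !bijE; congr (_, _, _) => /=; ring.
have <- // : (right x y)^-1 = u2.
by apply: bij_ext => -[[s t] w]; rewrite !bijE; congr (_, _, _) => /=; ring.
Qed.

(** The direction change replaces [up] by [right^4 * up]. Since [right^4] is the translation by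
    [4 * y] along the second axis, the linear parts are unchanged, and a translation by (y, -y, y)
    brings the pair back into the family. *)
Lemma hol_T x y p q D : hol x y (p + 4 * q)%R q D <-> hol (x + 2 * y)%R y p q D.
Proof.
have aV := affineV (affine_right x y).
rewrite /hol -[X in Hol _ _ X _ _](opprK) holonomy_J.
have -> : (- (p + 4 * q) = - p - q - q - q - q)%R by ring.
rewrite 4?(holonomy_LV _ _ _ _ aV) holonomy_JV invgK.
set c := transl (y, - y, y)%R; set u' := _ * _.
have er : c * right x y * c^-1 = right (x + 2 * y) y.
  by apply: bij_ext => -[[s t] w]; rewrite !bijE; congr (_, _, _) => /=; ring.
have eu : c * u' * c^-1 = up (x + 2 * y) y.
  by apply: bij_ext => -[[s t] w]; rewrite !bijE; congr (_, _, _) => /=; ring.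
by rewrite -(holonomy_conj _ _ p q D sA (affine_transl (y, - y, y)%R)) er eu.
Qed.

Lemma holonomy_21 r u p q D : affine r -> affine u ->
  Hol r u (2 * p + q)%R (p + q)%R D <-> Hol (r * (u * r)) (r * u) p q D.
Proof.
move=> ar au.
have -> : (2 * p + q = - (- p - (p + q)))%R by ring.
rewrite holonomy_J holonomy_LV ?invgK; last exact: affineV.
rewrite holonomy_JV invgK addrC (holonomy_L _ _ _ _ sA) ?mulgA //.
exact: affineM.
Qed.

(* [gen_P] is the conjugate of [(1, -2; 0, 1)] by [(2, 1; 1, 1)], and [(c, d)] is
   the image of the pair under the change of basis [(2, 1; 1, 1)]. *)
Lemma hol_P x y p q D :
  hol x y (5 * p - 8 * q)%R (2 * p - 3 * q)%R D <-> hol x (y + 2 * x)%R p q D.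
Proof.
have ar := affine_right x y; have au := affine_up x y.
have -> : (5 * p - 8 * q = 2 * (3 * p - 5 * q) + (- p + 2 * q))%R by ring.
have -> : (2 * p - 3 * q = (3 * p - 5 * q) + (- p + 2 * q))%R by ring.
rewrite /hol holonomy_21 //.
(* The linear part of [c] is a half turn and [c^2] is the translation by (2x, 2x, 0). Hence the
   element [e = c^-2 * d] below has the same linear part as [d], and the final pair again has the
   linear parts of the family. *)
set c := right x y * (up x y * right x y); set d := right x y * up x y.
have ac : affine c by do !apply: affineM.
have ad : affine d by do !apply: affineM.
have acV := affineV ac.
have -> : (3 * p - 5 * q = - (q - p + (- p + 2 * q) + (- p + 2 * q)))%R by ring.
rewrite holonomy_J 2!(holonomy_L _ _ _ _ sA acV).
have -> : (q - p = - (p - q))%R by ring.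
have ae : affine (c^-1 * (c^-1 * d)) by do !apply: affineM.
rewrite holonomy_JV invgK.
have -> : (- p + 2 * q = q - (p - q))%R by ring.
rewrite (holonomy_LV _ _ _ _ ae).
set e := c^-1 * (c^-1 * d); set f := e^-1 * c.
have af : affine f^-1 by apply/affineV/affineM => //; exact: affineV.
have -> : (p - q = - (- p + q))%R by ring.
rewrite holonomy_J (holonomy_L _ _ _ _ sA af) holonomy_JV invgK.
have cE s t w : c (s, t, w) = (t + x, s + x, x - 2 * y - w)%R.
  by rewrite /c !bijE; congr (_, _, _) => /=; ring.
have cVE s t w : c^-1 (s, t, w) = (t - x, s - x, x - 2 * y - w)%R.
  by apply: (can_inj (bijKg c)); rewrite bijVKg cE; congr (_, _, _); ring.
have dE s t w : d (s, t, w) = (x - y + t, x + w, s - y)%R.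
  by rewrite /d !bijE; congr (_, _, _) => /=; ring.
clearbody c d.
have eE s t w : e (s, t, w) = (t - x - y, w - x, s - y)%R.
  by rewrite /e 2!bijM dE 2!cVE; congr (_, _, _); ring.
have eVE s t w : e^-1 (s, t, w) = (w + y, s + x + y, t + x)%R.
  by apply: (can_inj (bijKg e)); rewrite bijVKg eE; congr (_, _, _); ring.
have fE s t w : f (s, t, w) = (x - y - w, t + 2 * x + y, s + 2 * x)%R.
  by rewrite /f bijM cE eVE; congr (_, _, _); ring.
have fVE s t w : f^-1 (s, t, w) = (w - 2 * x, t - 2 * x - y, x - y - s)%R.
  by apply: (can_inj (bijKg f)); rewrite bijVKg fE; congr (_, _, _); ring.
clearbody e f.
set b := transl (0, 0, - 2 * x)%R.
have er : b * f * b^-1 = right x (y + 2 * x).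
  apply: bij_ext => -[[s t] w]; rewrite 2!bijM translVE fE.
  by rewrite translE rightE; congr (_, _, _) => /=; ring.
have eu : b * (f^-1 * e) * b^-1 = up x (y + 2 * x).
  apply: bij_ext => -[[s t] w]; rewrite 3!bijM translVE eE fVE.
  by rewrite translE upE; congr (_, _, _) => /=; ring.
by rewrite -(holonomy_conj _ _ p q D sA (affine_transl (0, 0, - 2 * x)%R)) er eu.
Qed.

(** [right x y] is a screw motion by a quarter turn about a line parallel to the second axis; four
    steps advance by [4 * y]. *)
Lemma translation_power_e1 x y u D : y != 0%R -> Hol (right x y) u 1 0 D ->
  translation_power D.
Proof.
move=> y0 /holonomy_e1[c ac ->]; apply: translation_power_conj => //.
exists 4%N, (0, 4 * y, 0)%R; first by apply: contra y0 => /eqP[] /eqP; rewrite mulf_eq0 pnatr_eq0.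
by move=> [[s t] w]; rewrite !expgS expg0 !bijE bij1 /=; congr (_, _, _) => /=; ring.
Qed.

Lemma finite_order_e1 x u D : Hol (right x 0%R) u 1 0 D -> finite_order D.
Proof.
move=> /holonomy_e1[c ac ->]; apply: finite_order_conj.
exists 4%N => //; apply: bij_ext => -[[s t] w].
by rewrite !expgS expg0 !bijE !bij1 /=; congr (_, _, _) => /=; ring.
Qed.

(** In the direction (2, 1) the holonomy is conjugate to [right * (up * right)], a screw by a half
    turn whose square advances by (2x, 2x, 0). *)
Lemma translation_power_21 x y D : x != 0%R -> hol x y 2 1 D ->
  translation_power D.
Proof.
move=> x0; have := holonomy_21 1 0 D (affine_right x y) (affine_up x y).
rewrite mulr1 !addr0 => h /h{h} /holonomy_e1[c ac ->]; apply: translation_power_conj => //.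
exists 2%N, (2 * x, 2 * x, 0)%R.
  by apply: contra x0 => /eqP[] /eqP; rewrite mulf_eq0 pnatr_eq0.
by move=> [[s t] w]; rewrite !expgS expg0 !bijE bij1 /=; congr (_, _, _) => /=; ring.
Qed.

(** In the direction (1, 1) the holonomy is conjugate to [up * right], a screw by a third of a turn
    whose cube advances along (1, 1, -1), proportionally to [x - y]. *)
Lemma translation_power_11 x y D : x != y -> hol x y 1 1 D ->
  translation_power D.
Proof.
move=> xy; have := holonomy_L (right x y) 1 0 D sA (affine_up x y).
rewrite add0r => h /h{h} /holonomy_e1[c ac ->]; apply: translation_power_conj => //.
exists 3%N, (2 * (x - y), 2 * (x - y), - 2 * (x - y))%R.
  by apply: contra xy => /eqP[] /eqP; rewrite mulf_eq0 pnatr_eq0 subr_eq0.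
by move=> [[s t] w]; rewrite !expgS expg0 !bijE bij1 /=; congr (_, _, _) => /=; ring.
Qed.

End Family.

(** * The groups acting on the parameters *)

Section Action.
Variable R : realFieldType.
Implicit Types (z v : 'cV[int]_2) (D : bijection (R * R * R)) (h M : 'M[int]_2).

Definition holv z v D :=
  hol (z 0 0)%:~R (z 1 0)%:~R (v 0 0) (v 1 0) D.

Lemma holv_cV2 x y p q D : holv (cV2 x y) (cV2 p q) D = hol x%:~R y%:~R p q D.
Proof. by rewrite /holv !mxE. Qed.

(** A change of direction is traded for a change of parameters. The exchange is contravariant: in a
    product, the left factor acts on the parameters first, so [actsM] reverses the order. *)
Definition acts h M := forall z v D, holv z (h *m v) D <-> holv (M *m z) v D.

Lemma acts1 : acts 1 1.
Proof. by move=> z v D; rewrite !mul1mx. Qed.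

Lemma actsM h1 h2 M1 M2 : acts h1 M1 -> acts h2 M2 -> acts (h1 * h2) (M2 * M1).
Proof. by move=> a1 a2 z v D; rewrite -[h1 * h2]/(h1 *m h2) -[M2 * M1]/(M2 *m M1) -!mulmxA a1 a2. Qed.

Lemma actsV h M : \det h = 1 -> \det M = 1 -> acts h M -> acts h^-1 M^-1.
Proof.
move=> dh dM a z v D.
have {1}-> : z = M *m (M^-1 *m z) by rewrite mulmxA -[M *m M^-1]/(M * M^-1) SL2Z_mulV // mul1mx.
by rewrite -a mulmxA -[h *m h^-1]/(h * h^-1) SL2Z_mulV // mul1mx.
Qed.

Definition Tpow (k : int) := mx2 1 (4 * k) 0 1.
(** [gen_P] is parabolic with fixed vector (2, 1): it is 1 + N with N^2 = 0, so its k-th power is 1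
    + k N. *)
Definition Ppow (k : int) := mx2 (1 + 4 * k) (- 8 * k) (2 * k) (1 - 4 * k).

Lemma TpowD k l : Tpow (k + l) = Tpow k * Tpow l.
Proof. by rewrite /Tpow mx2_mul; congr mx2; ring. Qed.

Lemma PpowD k l : Ppow (k + l) = Ppow k * Ppow l.
Proof. by rewrite /Ppow mx2_mul; congr mx2; ring. Qed.

Lemma Tpow0 : Tpow 0 = 1. Proof. by rewrite /Tpow mulr0 mx2_id. Qed.
Lemma Ppow0 : Ppow 0 = 1. Proof. by rewrite /Ppow !mulr0 ?addr0 ?subr0 mx2_id. Qed.

Lemma det_Tpow k : \det (Tpow k) = 1. Proof. by rewrite det_mx2; ring. Qed.
Lemma det_Ppow k : \det (Ppow k) = 1. Proof. by rewrite det_mx2; ring. Qed.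

Lemma TpowV k : (Tpow k)^-1 = Tpow (- k).
Proof. by rewrite /Tpow mx2_inv; [congr mx2; ring | ring]. Qed.

Lemma PpowV k : (Ppow k)^-1 = Ppow (- k).
Proof. by rewrite /Ppow mx2_inv; [congr mx2; ring | ring]. Qed.

Lemma TpowE : Tpow 1 = gen_T. Proof. by []. Qed.
Lemma PpowE : Ppow 1 = gen_P. Proof. by []. Qed.

Lemma subgroup_pow (X : set 'M[int]_2) (f : int -> 'M[int]_2) k :
  is_subgroup_SL2Z X -> f 0 = 1 -> (forall k l, f (k + l) = f k * f l) ->
  (forall k, (f k)^-1 = f (- k)) -> X (f 1) -> X (f k).
Proof.
move=> [_ X1 XM XV] f0 fD fV Xf.
have Xn (n : nat) : X (f n%:Z).
  by elim: n => [|n IH]; [rewrite f0|rewrite intS fD; apply: XM].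
by elim/int_ind: k => [|n _|n _]; rewrite ?f0 -?fV //; apply: XV.
Qed.

Lemma acts_J : acts gen_J 1.
Proof.
move=> z v D; rewrite mul1mx [v]cV2_eta [z]cV2_eta /gen_J mx2_cV2 !holv_cV2.
by rewrite !mul0r add0r addr0 mulN1r mul1r hol_J.
Qed.

Lemma acts_T : acts gen_T (mx2 1 2 0 1).
Proof.
move=> z v D; rewrite [v]cV2_eta [z]cV2_eta /gen_T !mx2_cV2 !holv_cV2.
rewrite !mul0r !add0r !mul1r hol_T.
by rewrite rmorphD rmorphM.
Qed.

Lemma acts_P : acts gen_P (mx2 1 0 2 1).
Proof.
move=> z v D; rewrite [v]cV2_eta [z]cV2_eta /gen_P !mx2_cV2 !holv_cV2.
rewrite !mul0r !addr0 !mul1r !mulNr hol_P.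
by rewrite rmorphD rmorphM addrC.
Qed.

Lemma acts_Tpow k : acts (Tpow k) (mx2 1 (2 * k) 0 1).
Proof.
have a1 : acts (Tpow 1) (mx2 1 (2 * 1) 0 1) by exact: acts_T.
have aV : acts (Tpow (- 1)) (mx2 1 (2 * - 1) 0 1).
  have := actsV (det_Tpow 1) _ a1; rewrite det_mx2 => /(_ erefl).
  by rewrite TpowV mx2_inv.
elim/int_ind: k => [|n IH|n IH].
- by rewrite Tpow0 mulr0 mx2_id; exact: acts1.
- rewrite intS TpowD; have := actsM a1 IH; rewrite mx2_mul.
  by congr acts; congr mx2; ring.
- rewrite intS opprD TpowD; have := actsM aV IH; rewrite mx2_mul.
  by congr acts; congr mx2; ring.
Qed.

Lemma acts_Ppow k : acts (Ppow k) (mx2 1 0 (2 * k) 1).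
Proof.
have a1 : acts (Ppow 1) (mx2 1 0 (2 * 1) 1) by exact: acts_P.
have aV : acts (Ppow (- 1)) (mx2 1 0 (2 * - 1) 1).
  have := actsV (det_Ppow 1) _ a1; rewrite det_mx2 => /(_ erefl).
  by rewrite PpowV mx2_inv.
elim/int_ind: k => [|n IH|n IH].
- by rewrite Ppow0 mulr0 mx2_id; exact: acts1.
- rewrite intS PpowD; have := actsM a1 IH; rewrite mx2_mul.
  by congr acts; congr mx2; ring.
- rewrite intS opprD PpowD; have := actsM aV IH; rewrite mx2_mul.
  by congr acts; congr mx2; ring.
Qed.

Local Open Scope classical_set_scope.

Lemma groupH_sub : is_subgroup_SL2Z groupH.
Proof.
by apply: generated_subgroup => A [[->|->]|->]; rewrite det_mx2.
Qed.

Lemma groupH_T : groupH gen_T. Proof. by apply: sub_generated; left; left. Qed.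
Lemma groupH_J : groupH gen_J. Proof. by apply: sub_generated; left; right. Qed.
Lemma groupH_P : groupH gen_P. Proof. by apply: sub_generated; right. Qed.

Definition conjJ := [set h * gen_J * h^-1 | h in groupH].

Lemma det_conjJ A : conjJ A -> \det A = 1.
Proof.
case: groupH_sub => Hdet _ _ HV [h Hh <-].
rewrite -[h * _ * _]/((h *m gen_J) *m h^-1) !det_mulmx (Hdet _ Hh) (Hdet _ (HV _ Hh)).
by rewrite det_mx2.
Qed.

Lemma Gamma_sub : is_subgroup_SL2Z Gamma.
Proof.
by apply: generated_subgroup => A [->|/det_conjJ //]; rewrite det_mx2.
Qed.

(** This is the normal closure of [gen_J] in [groupH]. It acts trivially on all parameters, whereas
    [Gamma] is only known to fix the pair (1, 0). *)
Definition normalJ := generated conjJ.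

Lemma normalJ_sub : is_subgroup_SL2Z normalJ.
Proof. exact: generated_subgroup det_conjJ. Qed.

Lemma normalJ_Gamma : normalJ `<=` Gamma.
Proof.
apply: generated_sub Gamma_sub => A cA; apply: sub_generated; by right.
Qed.

Lemma groupH_acts h : groupH h -> exists2 M, \det M = 1 & acts h M.
Proof.
move=> Hh; suff [] : \det h = 1 /\ exists2 M, \det M = 1 & acts h M by [].
have := generated_sub (X := [set h | \det h = 1 /\ exists2 M, \det M = 1 & acts h M]) _ _ Hh.
apply.
- move=> A [[->|->]|->]; (split; first by rewrite det_mx2).
  + by exists (mx2 1 2 0 1); [rewrite det_mx2|exact: acts_T].
  + by exists 1; [rewrite det1|exact: acts_J].
  + by exists (mx2 1 0 2 1); [rewrite det_mx2|exact: acts_P].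
- split=> /=.
  + by move=> A [].
  + by split; [rewrite det1|exists 1; [rewrite det1|exact: acts1]].
  + move=> A B [dA [M dM aM]] [dB [N dN aN]]; split.
      by rewrite -[A * B]/(A *m B) det_mulmx dA dB mulr1.
    exists (N * M); first by rewrite -[N * M]/(N *m M) det_mulmx dM dN mulr1.
    exact: actsM.
  + move=> A [dA [M dM aM]]; split.
      by rewrite -[A^-1]/(invmx A) det_inv dA invr1.
    exists M^-1; first by rewrite -[M^-1]/(invmx M) det_inv dM invr1.
    exact: actsV.
Qed.

Lemma conjJ_acts A : conjJ A -> acts A 1.
Proof.
case=> h Hh <-; have [M dM aM] := groupH_acts Hh.
have [Hdet _ _ _] := groupH_sub.
have := actsM (actsM aM acts_J) (actsV (Hdet _ Hh) dM aM).
by rewrite mul1r SL2Z_Vmul.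
Qed.

Lemma normalJ_acts A : normalJ A -> acts A 1.
Proof.
move=> nA; suff [] : \det A = 1 /\ acts A 1 by [].
have := generated_sub (X := [set h | \det h = 1 /\ acts h 1]) _ _ nA.
apply.
- by move=> B cB; split; [exact: det_conjJ|exact: conjJ_acts].
- split=> /=.
  + by move=> B [].
  + by split; [rewrite det1|exact: acts1].
  + move=> B C [dB aB] [dC aC]; split.
      by rewrite -[B * C]/(B *m C) det_mulmx dB dC mulr1.
    by rewrite -[1]mulr1; exact: actsM.
  + move=> B [dB aB]; split.
      by rewrite -[B^-1]/(invmx B) det_inv dB invr1.
    by rewrite -invr1; apply: actsV; rewrite ?det1.
Qed.

(** [gen_T] sends the parameters (x, y) to (x + 2y, y), so it fixes (1, 0), and the conjugates of
    [gen_J] fix all parameters. *)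
Lemma Gamma_acts N : Gamma N -> forall v D,
  holv (cV2 1 0) (N *m v) D <-> holv (cV2 1 0) v D.
Proof.
move=> GN; suff [] : \det N = 1 /\ (forall v D,
  holv (cV2 1 0) (N *m v) D <-> holv (cV2 1 0) v D) by [].
have := generated_sub (X := [set N | \det N = 1 /\ (forall v D,
  holv (cV2 1 0) (N *m v) D <-> holv (cV2 1 0) v D)]) _ _ GN.
apply.
- move=> A [->|cA]; split=> [|v D].
  + by rewrite det_mx2.
  + by rewrite acts_T mx2_cV2 !mulr0 !mulr1 !addr0.
  + exact: det_conjJ.
  + by rewrite (conjJ_acts cA) mul1mx.
- split=> /=.
  + by move=> B [].
  + by split=> [|v D]; [rewrite det1|rewrite mul1mx].
  + move=> B C [dB aB] [dC aC]; split=> [|v D].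
      by rewrite -[B * C]/(B *m C) det_mulmx dB dC mulr1.
    by rewrite -[B * C]/(B *m C) -mulmxA aB aC.
  + move=> B [dB aB]; split=> [|v D].
      by rewrite -[B^-1]/(invmx B) det_inv dB invr1.
    by rewrite -aB mulmxA -[B *m B^-1]/(B * B^-1) SL2Z_mulV // mul1mx.
Qed.

Lemma normalJ_conj c A : groupH c -> normalJ A -> normalJ (c * A * c^-1).
Proof.
move=> Hc nA; have [Hdet H1 HM HV] := groupH_sub.
have [Ndet N1 NM NV] := normalJ_sub.
have dc := Hdet _ Hc; have uc : c \is a GRing.unit by rewrite unitmxE dc unitr1.
have dconj X : \det X = 1 -> \det (c * X * c^-1) = 1.
  move=> dX; rewrite -[c * X * c^-1]/(c *m X *m c^-1) !det_mulmx dc dX !mul1r.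
  exact: Hdet (HV _ Hc).
suff [] : \det A = 1 /\ normalJ (c * A * c^-1) by [].
have := generated_sub (X := [set A | \det A = 1 /\ normalJ (c * A * c^-1)]) _ _ nA.
apply.
- move=> B cB; split; first exact: det_conjJ.
  apply: sub_generated; case: cB => h Hh <-; exists (c * h); first exact: HM.
  have uh : h \is a GRing.unit by rewrite unitmxE Hdet ?unitr1.
  by rewrite invrM // !mulrA.
- split=> /=.
  + by move=> B [].
  + by rewrite det1 mulr1 divrr.
  + move=> B C [dB aB] [dC aC]; split.
      by rewrite -[B * C]/(B *m C) det_mulmx dB dC mulr1.
    by have := NM _ _ aB aC; rewrite !mulrA mulrVK.
  + move=> B [dB aB]; have uB : B \is a GRing.unit by rewrite unitmxE dB unitr1.
    split; first by rewrite -[B^-1]/(invmx B) det_inv dB invr1.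
    have ucB : c * B \is a GRing.unit by rewrite unitrMl.
    have := NV _ aB; rewrite invrM ?unitrV // (invrM uc uB) invrK.
    by rewrite mulrA.
Qed.
End Action.

(** * Normal forms and cusps *)

Section NormalForm.
Local Open Scope classical_set_scope.
Implicit Types (h n : 'M[int]_2).

(* Modulo the normal closure of [gen_J], an element of [groupH] outside [Gamma] is
   an alternating word in powers of [gen_P] and [gen_T]; the last two arguments
   are its action on [(1, 0)], which grows as in the ping-pong lemma. *)
Inductive reduced : bool -> 'M[int]_2 -> int -> int -> Prop :=
| reduced1 g m : Gamma g -> m != 0 -> reduced true (g * Ppow m) 1 (2 * m)
| reducedT h x y k : reduced true h x y -> k != 0 ->
    reduced false (h * Tpow k) (x + 2 * k * y) y
| reducedP h x y m : reduced false h x y -> m != 0 ->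
    reduced true (h * Ppow m) x (y + 2 * m * x).

(** If |x| < |y| and k is nonzero, then |x + 2ky| >= 2|y| - |x| > |y|; the other step is symmetric.
    The bounds keep both parameters nonzero and of different absolute values, which excludes all
    three cases of finite order. *)
Lemma reduced_growth b h x y : reduced b h x y ->
  if b then 0 < `|x| < `|y| else 0 < `|y| < `|x|.
Proof.
elim=> {b h x y} [g m _ m0|h x y k _ IH k0|h x y k _ IH k0]; first by lia.
- have [/andP[x0 xy] k1] : 0 < `|x| < `|y| /\ 1 <= `|k| by split=> //; lia.
  have : 2 * `|y| <= `|2 * k * y| by rewrite !normrM; nia.
  by lia.
- have [/andP[x0 xy] k1] : 0 < `|y| < `|x| /\ 1 <= `|k| by split=> //; lia.
  have : 2 * `|x| <= `|2 * k * x| by rewrite !normrM; nia.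
  by lia.
Qed.

Lemma reduced_acts (R : realFieldType) b h x y : reduced b h x y ->
  forall v (D : bijection (R * R * R)),
  holv (cV2 1 0) (h *m v) D <-> holv (cV2 x y) v D.
Proof.
elim=> {b h x y} [g m Gg m0|h x y k _ IH k0|h x y k _ IH k0] v D.
- rewrite -[g * _]/(g *m Ppow m) -mulmxA (Gamma_acts Gg) acts_Ppow mx2_cV2.
  by rewrite !mulr1 mulr0 !addr0.
- rewrite -[h * _]/(h *m Tpow k) -mulmxA IH acts_Tpow mx2_cV2.
  by rewrite !mul1r mul0r add0r.
- rewrite -[h * _]/(h *m Ppow k) -mulmxA IH acts_Ppow mx2_cV2.
  by rewrite !mul1r mul0r addr0 [_ + y]addrC.
Qed.

Definition has_nf h := Gamma h \/ exists b h' x y n,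
  [/\ reduced b h' x y, normalJ n & h = h' * n].

Lemma has_nf_J h n : normalJ n -> has_nf h -> has_nf (h * n).
Proof.
move=> nJ; have [_ _ GM _] := Gamma_sub; have [_ _ NM _] := normalJ_sub.
case=> [Gh|[b [h' [x [y [n' [r' nn' ->]]]]]]].
  by left; apply: GM => //; exact: normalJ_Gamma.
by right; exists b, h', x, y, (n' * n); split; rewrite ?mulrA //; exact: NM.
Qed.

Lemma groupH_Tpow k : groupH (Tpow k).
Proof.
exact: (subgroup_pow _ groupH_sub Tpow0 TpowD TpowV groupH_T).
Qed.

Lemma groupH_Ppow k : groupH (Ppow k).
Proof.
exact: (subgroup_pow _ groupH_sub Ppow0 PpowD PpowV groupH_P).
Qed.

Lemma Gamma_Tpow k : Gamma (Tpow k).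
Proof.
apply: (subgroup_pow _ Gamma_sub Tpow0 TpowD TpowV).
by apply: sub_generated; left.
Qed.

(** By normality, the trailing factor of a normal form moves to the right of a new letter, which can
    then merge with the last letter of the reduced word. *)
Lemma normalJ_past c c' n : groupH c' -> c * c' = 1 -> c' * c = 1 ->
  normalJ n -> exists2 n', normalJ n' & n * c = c * n'.
Proof.
move=> Hc' cc' c'c nn; have [Hdet _ _ _] := groupH_sub.
have uc : c \is a GRing.unit.
  by apply/unitrP; exists c'.
exists (c' * n * c'^-1); first exact: normalJ_conj.
have -> : c'^-1 = c.
  by apply: (@mulrI _ c'); rewrite ?c'c ?mulrV //; apply/unitrP; exists c.
by rewrite !mulrA cc' mul1r.
Qed.

Lemma has_nf_T h k : has_nf h -> has_nf (h * Tpow k).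
Proof.
have [_ _ GM _] := Gamma_sub.
case=> [Gh|[b [h' [x [y [n [r' nn ->]]]]]]].
  by left; apply: GM => //; exact: Gamma_Tpow.
have TV : Tpow k * Tpow (- k) = 1 by rewrite -TpowD subrr Tpow0.
have VT : Tpow (- k) * Tpow k = 1 by rewrite -TpowD addNr Tpow0.
have [n' nn' e] := normalJ_past (groupH_Tpow _) TV VT nn.
rewrite -mulrA e mulrA; apply: has_nf_J => //.
case: r' => [g m Gg m0|{}h x' y' l rh l0|{}h x' y' m rh m0].
- have [->|k0] := eqVneq k 0.
    right; rewrite Tpow0 mulr1; exists true, (g * Ppow m), 1, (2 * m), 1.
    by split; rewrite ?mulr1 //; [constructor|case: normalJ_sub].
  right; exists false, (g * Ppow m * Tpow k), (1 + 2 * k * (2 * m)), (2 * m), 1.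
  split; rewrite ?mulr1 //; last by case: normalJ_sub.
  by constructor => //; constructor.
- rewrite -mulrA -TpowD; have [e0|lk0] := eqVneq (l + k) 0.
    right; rewrite e0 Tpow0 mulr1; exists true, h, x', y', 1.
    by split; rewrite ?mulr1 //; case: normalJ_sub.
  right; exists false, (h * Tpow (l + k)), (x' + 2 * (l + k) * y'), y', 1.
  by split; rewrite ?mulr1 //; [constructor|case: normalJ_sub].
- have [->|k0] := eqVneq k 0.
    right; rewrite Tpow0 mulr1; exists true, (h * Ppow m), x', (y' + 2 * m * x'), 1.
    by split; rewrite ?mulr1 //; [constructor|case: normalJ_sub].
  right; exists false, (h * Ppow m * Tpow k), (x' + 2 * k * (y' + 2 * m * x')), (y' + 2 * m * x'), 1.
  split; rewrite ?mulr1 //; last by case: normalJ_sub.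
  by constructor => //; constructor.
Qed.

Lemma has_nf_P h k : has_nf h -> has_nf (h * Ppow k).
Proof.
have [_ _ GM _] := Gamma_sub.
case=> [Gh|[b [h' [x [y [n [r' nn ->]]]]]]].
  have [->|k0] := eqVneq k 0; first by left; rewrite Ppow0 mulr1.
  right; exists true, (h * Ppow k), 1, (2 * k), 1.
  by split; rewrite ?mulr1 //; [constructor|case: normalJ_sub].
have PV : Ppow k * Ppow (- k) = 1 by rewrite -PpowD subrr Ppow0.
have VP : Ppow (- k) * Ppow k = 1 by rewrite -PpowD addNr Ppow0.
have [n' nn' e] := normalJ_past (groupH_Ppow _) PV VP nn.
rewrite -mulrA e mulrA; apply: has_nf_J => //.
case: r' => [g m Gg m0|{}h x' y' l rh l0|{}h x' y' m rh m0].
- rewrite -mulrA -PpowD; have [e0|mk0] := eqVneq (m + k) 0.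
    by left; rewrite e0 Ppow0 mulr1.
  right; exists true, (g * Ppow (m + k)), 1, (2 * (m + k)), 1.
  by split; rewrite ?mulr1 //; [constructor|case: normalJ_sub].
- have [->|k0] := eqVneq k 0.
    right; rewrite Ppow0 mulr1; exists false, (h * Tpow l), (x' + 2 * l * y'), y', 1.
    by split; rewrite ?mulr1 //; [constructor|case: normalJ_sub].
  right; exists true, (h * Tpow l * Ppow k), (x' + 2 * l * y'), (y' + 2 * k * (x' + 2 * l * y')), 1.
  split; rewrite ?mulr1 //; last by case: normalJ_sub.
  by constructor => //; constructor.
- rewrite -mulrA -PpowD; have [e0|mk0] := eqVneq (m + k) 0.
    right; rewrite e0 Ppow0 mulr1; exists false, h, x', y', 1.
    by split; rewrite ?mulr1 //; case: normalJ_sub.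
  right; exists true, (h * Ppow (m + k)), x', (y' + 2 * (m + k) * x'), 1.
  by split; rewrite ?mulr1 //; [constructor|case: normalJ_sub].
Qed.

Lemma groupH_nf h : groupH h -> has_nf h.
Proof.
move=> Hh; have [Gdet G1 _ _] := Gamma_sub; have [Hdet _ _ _] := groupH_sub.
(* An equivalence is needed instead of an implication, so that the set of admissible right factors
   is closed under inverses. *)
pose X := [set A | \det A = 1 /\ forall g : 'M[int]_2, has_nf g <-> has_nf (g * A)].
suff : X h by case=> _ /(_ 1); rewrite mul1r => <-; left.
apply: (generated_sub (X := X) _ _ Hh).
- have NJ : normalJ gen_J.
    apply: sub_generated; exists 1; rewrite ?mul1r ?invr1 ?mulr1 //.
    by case: groupH_sub.
  move=> A [[->|->]|->]; (split; first by rewrite det_mx2) => g.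
  + rewrite -TpowE; split=> [|/(@has_nf_T _ (-1))]; first exact: has_nf_T.
    by rewrite -mulrA -TpowD addrN Tpow0 mulr1.
  + have [Ndet _ _ NV] := normalJ_sub.
    split=> [|/(has_nf_J (NV _ NJ))]; first exact: has_nf_J.
    by rewrite -mulrA SL2Z_mulV ?mulr1 ?Ndet.
  + rewrite -PpowE; split=> [|/(@has_nf_P _ (-1))]; first exact: has_nf_P.
    by rewrite -mulrA -PpowD addrN Ppow0 mulr1.
- split=> /=.
  + by move=> B [].
  + by split=> [|g]; rewrite ?det1 ?mulr1.
  + move=> B C [dB aB] [dC aC]; split=> [|g].
      by rewrite -[B * C]/(B *m C) det_mulmx dB dC mulr1.
    by rewrite mulrA -aC -aB.
  + move=> B [dB aB]; split=> [|g].
      by rewrite -[B^-1]/(invmx B) det_inv dB invr1.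
    by rewrite (aB (g * B^-1)) -mulrA SL2Z_Vmul // mulr1.
Qed.

End NormalForm.

(** * The three cusps of [groupH] *)

Section Cusps.
Local Open Scope classical_set_scope.

Definition cusp p q := exists2 h, groupH h &
  [\/ cV2 p q = h *m cV2 1 0, cV2 p q = h *m cV2 2 1 | cV2 p q = h *m cV2 1 1].

Lemma cusp_groupH a b c d p q p' q' : groupH (mx2 a b c d) ->
  p' = a * p + b * q -> q' = c * p + d * q ->
  cusp p q -> cusp p' q'.
Proof.
have [_ _ HM _] := groupH_sub => Hm -> -> [h Hh e].
exists (mx2 a b c d * h); first exact: HM.
rewrite -mx2_cV2 -[mx2 a b c d * h]/(mx2 a b c d *m h).
by case: e => ->; rewrite !mulmxA; [constructor 1|constructor 2|constructor 3].
Qed.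

(* The nine pairs are the images of [(p, q)] under representatives of the cosets
   of [groupH] in [SL_2(Z)]. *)
Definition all_cusps p q :=
  [/\ cusp p q, cusp (p + q) q, cusp (p + 2 * q) q & cusp (p + 3 * q) q] /\
  [/\ cusp (2 * p + q) (p + q) & cusp (2 * p + 3 * q) (p + 2 * q)] /\
  [/\ cusp p (p + q), cusp (p + q) (p + 2 * q) & cusp (p + 2 * q) (p + 3 * q)].

(** At (1, 0) the nine pairs collapse to (1, 0), (2, 1) and (1, 1), taken four, two and three times;
    these are the widths of the three cusps. *)
Lemma all_cusps_e1 : all_cusps 1 0.
Proof.
have [_ H1 _ _] := groupH_sub.
by split; [|split]; split; exists 1; rewrite // !mul1mx;
  (by constructor 1) || (by constructor 2) || (by constructor 3).
Qed.

(** These are the corrections for permuting the cosets: a representative multiplied by the quarter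
    turn or by the shear is again a representative, up to a left factor from this list. *)
Lemma groupH_words :
  [/\ groupH (mx2 1 0 0 1), groupH (mx2 0 (- 1) 1 0), groupH (mx2 4 (- 3) 3 (- 2)),
      groupH (mx2 5 (- 8) 2 (- 3)) & groupH (mx2 4 (- 1) 1 0)] /\
  [/\ groupH (mx2 3 (- 8) 2 (- 5)), groupH (mx2 0 (- 1) 1 (- 4)),
      groupH (mx2 2 (- 3) 3 (- 4)), groupH (mx2 12 (- 7) 7 (- 4)) &
      groupH (mx2 3 2 4 3)].
Proof.
have [_ H1 HM HV] := groupH_sub.
have HP := groupH_P; have HT := groupH_T; have HJ := groupH_J.
have JV : gen_J^-1 = mx2 0 1 (- 1) 0 by rewrite mx2_inv.
have TV : gen_T^-1 = mx2 1 (- 4) 0 1 by rewrite mx2_inv.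
have PV : gen_P^-1 = mx2 (- 3) 8 (- 2) 5 by rewrite mx2_inv.
have HpTj : groupH (gen_P^-1 * gen_T * gen_J^-1).
  exact: (HM _ _ (HM _ _ (HV _ HP) HT) (HV _ HJ)).
have HjtP : groupH (gen_J^-1 * gen_T^-1 * gen_P).
  exact: (HM _ _ (HM _ _ (HV _ HJ) (HV _ HT)) HP).
split; split=> //.
- by rewrite mx2_id.
- by move: HpTj; rewrite JV PV !mx2_mul.
- by have := HM _ _ HT HJ; rewrite mx2_mul.
- by have := HM _ _ (HM _ _ (HV _ HP) HJ) HJ; rewrite PV !mx2_mul.
- by have := HM _ _ HJ (HV _ HT); rewrite TV !mx2_mul.
- by move: HjtP; rewrite JV TV !mx2_mul.
- by have := HM _ _ (HV _ HP) HpTj; rewrite JV PV !mx2_mul.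
- by have := HM _ _ (HM _ _ (HM _ _ HJ (HV _ HT)) HP) HJ; rewrite TV !mx2_mul.
Qed.

Lemma all_cusps_J p q : all_cusps p q -> all_cusps (- q) p.
Proof.
have [[h1 hJ hpTj hP hTJ] [hpJJ hJt hjtP _ _]] := groupH_words.
move=> [[e0 e1 e2 e3] [[g0 g1] [l0 l1 l2]]]; split; [|split]; split.
- by apply: (cusp_groupH hJ _ _ e0); ring.
- by apply: (cusp_groupH hpTj _ _ l2); ring.
- by apply: (cusp_groupH hP _ _ g1); ring.
- by apply: (cusp_groupH hTJ _ _ l0); ring.
- by apply: (cusp_groupH hpTj _ _ l1); ring.
- by apply: (cusp_groupH hpJJ _ _ e2); ring.
- by apply: (cusp_groupH hJt _ _ e3); ring.
- by apply: (cusp_groupH hjtP _ _ g0); ring.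
- by apply: (cusp_groupH hjtP _ _ e1); ring.
Qed.

Lemma all_cusps_L p q : all_cusps p q -> all_cusps p (q + p).
Proof.
have [[h1 _ _ _ hTJ] [hpJJ _ hjtP hppTj hJtPJ]] := groupH_words.
move=> [[e0 e1 e2 e3] [[g0 g1] [l0 l1 l2]]]; split; [|split]; split.
- by apply: (cusp_groupH h1 _ _ l0); ring.
- by apply: (cusp_groupH h1 _ _ g0); ring.
- by apply: (cusp_groupH hTJ _ _ l1); ring.
- by apply: (cusp_groupH hTJ _ _ e1); ring.
- by apply: (cusp_groupH hpJJ _ _ e3); ring.
- by apply: (cusp_groupH hppTj _ _ l2); ring.
- by apply: (cusp_groupH hjtP _ _ g1); ring.
- by apply: (cusp_groupH hjtP _ _ e2); ring.
- by apply: (cusp_groupH hJtPJ _ _ e0); ring.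
Qed.

Lemma coprime_cusp p q : gcdz p q = 1 -> cusp p q.
Proof.
move=> pq1; suff [[]] : all_cusps p q by [].
move: p q pq1; apply: coprime_pair_ind;
  [exact: all_cusps_e1|exact: all_cusps_J|exact: all_cusps_L].
Qed.

End Cusps.

(** * The dichotomy for the holonomy of a coprime direction *)

Section Dichotomy.
Variable R : realFieldType.
Implicit Types D : bijection (R * R * R).

Definition Gamma_orbit p q := exists N : 'M[int]_2, Gamma N /\ N *m cV2 1 0 = cV2 p q.

Lemma finite_order_orbit p q D :
  Gamma_orbit p q -> hol 1 0 p q D -> finite_order D.
Proof.
case=> N [GN Ne]; rewrite -(holv_cV2 1 0) -Ne (Gamma_acts GN) holv_cV2.
exact: finite_order_e1.
Qed.

(** Outside the orbit, either [h] lies in [Gamma] and the cusp is (2, 1) or (1, 1), where the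
    parameters (1, 0) already give a nonzero pitch, or [h] has a reduced part and the growth
    estimate gives a nonzero pitch at all three cusps. *)
Lemma translation_power_orbit p q D : gcdz p q = 1 ->
  ~ Gamma_orbit p q -> hol 1 0 p q D -> translation_power D.
Proof.
move=> pq1 nG; rewrite -(holv_cV2 1 0).
have [h Hh] := coprime_cusp pq1; have [Gh|] := groupH_nf Hh.
  case=> e; first by case: nG; exists h.
  - rewrite e (Gamma_acts Gh) holv_cV2; apply: translation_power_21.
    by rewrite oner_eq0.
  - rewrite e (Gamma_acts Gh) holv_cV2; apply: translation_power_11.
    by rewrite oner_eq0.
move=> [b [h' [x [y [n [rh nn ->]]]]]].
have := reduced_growth rh => gr.
case=> ->; rewrite -[h' * n]/(h' *m n) -mulmxA (reduced_acts rh) (normalJ_acts nn) mul1mx holv_cV2.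
- by apply: translation_power_e1; rewrite intr_eq0; case: b gr {rh}; lia.
- by apply: translation_power_21; rewrite intr_eq0; case: b gr {rh}; lia.
- by apply: translation_power_11; rewrite eqr_int; case: b gr {rh}; lia.
Qed.

End Dichotomy.

(** * Symmetries of the surface *)

Local Open Scope classical_set_scope.
Local Open Scope ring_scope.

Section Mucube.
Variable R : realType.
Local Notation R3 := (R * R * R)%type.
Implicit Types (a b s t w : R) (v : R3).

Definition parity a := (Num.floor a %% 2)%Z.
Definition chk a b := [|| a \is a Num.int, b \is a Num.int | parity a != parity b].
Definition chk' a b := [|| a \is a Num.int, b \is a Num.int | parity a == parity b].

Lemma floor_int_pred a d : a \is a Num.int -> 0 < d <= 1 -> Num.floor (a - d) = Num.floor a - 1.
Proof.
move=> ia /andP[d0 d1]; apply: floor_def.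
have := ia; rewrite intrEfloor => /eqP e.
by rewrite intrD intrD e rmorphN; lra.
Qed.

Lemma nonint_gt a : a \isn't a Num.int -> (Num.floor a)%:~R < a.
Proof. by move=> na; rewrite lt_neqAle floor_le -intrEfloor na. Qed.

(** Off the grid the floors are locally constant, so the closure adds nothing; on a grid line the
    cells on its two sides have opposite parities, so one of them satisfies the condition and
    accumulates at the point. *)
Lemma checkerboardE a b : checkerboard (a + 2^-1, b + 2^-1) <-> chk a b.
Proof.
have half x y : x + y - y = x :> R by rewrite addrK.
split=> [h|h B /nbhs_ballP[e /= e0 eB]].
- rewrite /chk; have [//|ia] := boolP (a \is a Num.int).
  have [//|ib] := boolP (b \is a Num.int) => /=; apply/negP => /eqP pab.
  have ha := nonint_gt ia; have hb := nonint_gt ib.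
  have ha' := floorD1_gt a; have hb' := floorD1_gt b.
  rewrite !intrD in ha' hb'.
  pose e := Num.min (Num.min (a - (Num.floor a)%:~R) ((Num.floor a)%:~R + 1 - a))
                    (Num.min (b - (Num.floor b)%:~R) ((Num.floor b)%:~R + 1 - b)).
  have e0 : 0 < e by rewrite !lt_min; apply/andP; split; apply/andP; split; lra.
  have [e1 e2 e3 e4] : [/\ e <= a - (Num.floor a)%:~R, e <= (Num.floor a)%:~R + 1 - a,
      e <= b - (Num.floor b)%:~R & e <= (Num.floor b)%:~R + 1 - b].
    have : e <= e by [].
    by rewrite {2}/e !le_min => /andP[/andP[-> ->] /andP[-> ->]].
  have [|[x y] /=] := h (ball (a + 2^-1, b + 2^-1) e).
    exact: nbhsx_ballx.
  move=> [+ [/= bx by_]].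
  move: bx by_; rewrite /ball /= !ltr_norml => /andP[b1 b2] /andP[b3 b4].
  have -> : Num.floor (x - 2^-1) = Num.floor a by apply: floor_def; rewrite intrD; lra.
  have -> : Num.floor (y - 2^-1) = Num.floor b by apply: floor_def; rewrite intrD; lra.
  by rewrite -/(parity a) pab eqxx.
- pose d := Num.min (e / 2) 1.
  have d0 : 0 < d by rewrite lt_min ltr01 divr_gt0.
  have d1 : d <= 1 by rewrite ge_min lexx orbT.
  have de : d < e.
    by apply: (@le_lt_trans _ _ (e / 2)); [rewrite ge_min lexx|lra].
  have [pp|pp] := boolP (parity a == parity b); last first.
    exists (a + 2^-1, b + 2^-1); split; first by rewrite /= !half.
    by apply: eB; exact: ballxx.
  have h1 (x : R) : ball (x + 2^-1 : R) e (x - d + 2^-1).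
    by rewrite /ball /= ltr_norml; lra.
  move: h; rewrite /chk pp orbF => /orP[ia|ib].
  + exists (a - d + 2^-1, b + 2^-1); split.
      rewrite /= !half (floor_int_pred ia) ?d0 ?d1 //.
      by move: pp; rewrite /parity; lia.
    by apply: eB; split; [exact: h1|exact: ballxx].
  + exists (a + 2^-1, b - d + 2^-1); split.
      rewrite /= !half (floor_int_pred ib) ?d0 ?d1 //.
      by move: pp; rewrite /parity; lia.
    by apply: eB; split; [exact: ballxx|exact: h1].
Qed.

(* Translates the surface so that its vertices become [Z^3] and the unit square
   [[0, 1]^2 x {0}] becomes one of its faces. *)
Definition grid_shift v : R3 := (v.1.1 + 2^-1, v.1.2 + 1 + 2^-1, v.2 + 2^-1).

(** The additional unit in the second coordinate of [grid_shift] reverses the parity condition in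
    the two pairs that contain this coordinate. *)
Definition mu v := [&& chk' v.1.1 v.1.2, chk v.1.1 v.2 & chk' v.1.2 v.2].

Lemma floorDz a (n : int) : Num.floor (a + n%:~R) = Num.floor a + n.
Proof. by rewrite floorDrz ?intr_int // intrKfloor. Qed.

Lemma floorD1 a : Num.floor (a + 1) = Num.floor a + 1.
Proof. by rewrite floorDrz ?rpred1 // floor1. Qed.

Lemma intD1 a : (a + 1 \is a Num.int) = (a \is a Num.int).
Proof. by rewrite rpredDr ?rpred1. Qed.

Lemma int1B a : (1 - a \is a Num.int) = (a \is a Num.int).
Proof. by rewrite rpredBl ?rpred1. Qed.

Lemma floorN_nonint a : a \isn't a Num.int -> Num.floor (- a) = - Num.floor a - 1.
Proof.
move=> na; apply: floor_def; have := nonint_gt na; have := floorD1_gt a.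
by rewrite !intrD !rmorphN /=; lra.
Qed.

Lemma floor1B_nonint a : a \isn't a Num.int -> Num.floor (1 - a) = - Num.floor a.
Proof.
move=> na; rewrite addrC floorDrz ?rpred1 // floorN_nonint // floor1.
by rewrite subrK.
Qed.

Lemma mucube_shift v : mucube (grid_shift v) <-> mu v.
Proof.
case: v => [[s t] w]; rewrite /mucube /grid_shift /= !(propext (checkerboardE _ _)) /mu /=.
rewrite /chk /chk' intD1 /parity floorD1.
split=> [[h1 h2 h3]|/and3P[h1 h2 h3]]; [apply/and3P|]; split=> //; lia.
Qed.

Definition int3 v := [&& v.1.1 \is a Num.int, v.1.2 \is a Num.int & v.2 \is a Num.int].

Lemma half_integerE a : half_integer (a + 2^-1) <-> a \is a Num.int.
Proof.
split=> [[n /addIr ->]|]; first exact: intr_int.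
by move=> /intrP[n ->]; exists n.
Qed.

Lemma cone_point_shift v : cone_point (grid_shift v) <-> int3 v.
Proof.
case: v => [[s t] w]; rewrite /cone_point /grid_shift /= !(propext (half_integerE _)) intD1.
by split=> [[h1 h2 h3]|/and3P//]; apply/and3P.
Qed.

Definition sq3 v := v.1.1 ^+ 2 + v.1.2 ^+ 2 + v.2 ^+ 2.

Definition sym (g : bijection R3) :=
  [/\ affine g, forall u v, sq3 (g u - g v) = sq3 (u - v),
      forall v, mu (g v) = mu v & forall v, int3 (g v) = int3 v].

Lemma sym_subgroup : subgroup sym.
Proof.
have [a1 aM aV] := @affine_subgroup R3.
split; first by split.
- move=> f g [af mf uf cf] [ag mg ug cg]; split; first exact: aM.
  + by move=> u v; rewrite !bijM mf mg.
  + by move=> v; rewrite !bijM uf ug.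
  + by move=> v; rewrite !bijM cf cg.
- move=> f [af mf uf cf]; split; first exact: aV.
  + by move=> u v; rewrite -mf !bijVKg.
  + by move=> v; rewrite -uf !bijVKg.
  + by move=> v; rewrite -cf !bijVKg.
Qed.

Ltac chk_tac s t w :=
  rewrite /mu /chk /chk' /parity /= ?int1B ?intD1 ?rpredN;
  have [is_|is_] := boolP (s \is a Num.int); have [it|it] := boolP (t \is a Num.int);
  have [iw|iw] := boolP (w \is a Num.int); rewrite ?orbT //=;
  rewrite ?floor1B_nonint ?floorD1 ?floorN_nonint //.

Lemma sym_right : sym (right 1 0).
Proof.
split; first exact: affine_right.
- move=> [[s t] w] [[s' t'] w']; rewrite !rightE /sq3 /=; ring.
- by move=> [[s t] w]; rewrite rightE subr0 addr0; chk_tac s t w; lia.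
- move=> [[s t] w]; rewrite rightE /int3 /= subr0 addr0 int1B.
  by case: (s \is a _) (t \is a _) (w \is a _) => [] [] [].
Qed.

Lemma sym_up : sym (up 1 0).
Proof.
split; first exact: affine_up.
- move=> [[s t] w] [[s' t'] w']; rewrite !upE /sq3 /=; ring.
- by move=> [[s t] w]; rewrite upE !subr0 [1 + w]addrC; chk_tac s t w; lia.
- move=> [[s t] w]; rewrite upE /int3 /= !subr0 [1 + w]addrC intD1 rpredN.
  by case: (s \is a _) (t \is a _) (w \is a _) => [] [] [].
Qed.

Definition flip_fun v : R3 := (1 - v.1.1, v.1.2, v.2).
Fact flip_funK : involutive flip_fun.
Proof. by move=> [[s t] w]; rewrite /flip_fun /=; congr (_, _, _); ring. Qed.
Definition flip : bijection R3 := Bijection flip_funK flip_funK.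

(** Exchanging the first two coordinates alone would exchange a condition [chk] with a condition
    [chk']; the sign on the third coordinate repairs this, since negation reverses the parity of a
    non-integer. *)
Definition swap_fun v : R3 := (v.1.2, v.1.1, - v.2).
Fact swap_funK : involutive swap_fun.
Proof. by move=> [[s t] w]; rewrite /swap_fun /= opprK. Qed.
Definition swap : bijection R3 := Bijection swap_funK swap_funK.

(** Translations in [sym_transl] have coordinates of equal parity; together with this reflection
    they move the base face to horizontal faces at heights of either parity. *)
Definition mirror_fun v : R3 := (v.1.1, v.1.2, 1 - v.2).
Fact mirror_funK : involutive mirror_fun.
Proof. by move=> [[s t] w]; rewrite /mirror_fun /=; congr (_, _, _); ring. Qed.
Definition mirror : bijection R3 := Bijection mirror_funK mirror_funK.

Lemma flipE s t w : flip (s, t, w) = (1 - s, t, w). Proof. by []. Qed.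
Lemma swapE s t w : swap (s, t, w) = (t, s, - w). Proof. by []. Qed.
Lemma mirrorE s t w : mirror (s, t, w) = (s, t, 1 - w). Proof. by []. Qed.

Lemma sym_flip : sym flip.
Proof.
split.
- by move=> [[? ?] ?] [[? ?] ?] [[? ?] ?]; rewrite !flipE /=; congr (_, _, _) => /=; ring.
- move=> [[s t] w] [[s' t'] w']; rewrite !flipE /sq3 /=; ring.
- by move=> [[s t] w]; rewrite flipE; chk_tac s t w; lia.
- by move=> [[s t] w]; rewrite flipE /int3 /= int1B.
Qed.

Lemma sym_swap : sym swap.
Proof.
split.
- by move=> [[? ?] ?] [[? ?] ?] [[? ?] ?]; rewrite !swapE /=; congr (_, _, _) => /=; ring.
- move=> [[s t] w] [[s' t'] w']; rewrite !swapE /sq3 /=; ring.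
- by move=> [[s t] w]; rewrite swapE; chk_tac s t w; lia.
- move=> [[s t] w]; rewrite swapE /int3 /= rpredN.
  by case: (s \is a _) (t \is a _) (w \is a _) => [] [] [].
Qed.

Lemma sym_mirror : sym mirror.
Proof.
split.
- by move=> [[? ?] ?] [[? ?] ?] [[? ?] ?]; rewrite !mirrorE /=; congr (_, _, _) => /=; ring.
- move=> [[s t] w] [[s' t'] w']; rewrite !mirrorE /sq3 /=; ring.
- by move=> [[s t] w]; rewrite mirrorE; chk_tac s t w; lia.
- by move=> [[s t] w]; rewrite mirrorE /int3 /= int1B.
Qed.

Lemma sym_transl (i j k : int) : (i = j %[mod 2])%Z -> (i = k %[mod 2])%Z ->
  sym (transl (i%:~R, j%:~R, k%:~R)).
Proof.
move=> ij ik; split; first exact: affine_transl.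
- by move=> u v; rewrite /= /transl_fun opprD addrACA subrr addr0.
- move=> [[s t] w]; rewrite translE /mu /chk /chk' /parity /= !floorDz.
  rewrite !(rpredDr _ (intr_int _ _)).
  by congr [&& [|| _, _ | _], [|| _, _ | _] & [|| _, _ | _]]; apply/idP/idP; lia.
- by move=> [[s t] w]; rewrite translE /int3 /= !(rpredDr _ (intr_int _ _)).
Qed.

Definition sq (z : R * R) := (0 <= z.1 <= 1) && (0 <= z.2 <= 1).
Definition corner (z : R * R) := (z.1 \in [:: 0; 1]) && (z.2 \in [:: 0; 1]).

(** A symmetry [g] serves as a frame: a face together with an identification with the unit square.
    Orientation-reversing symmetries are allowed, so all eight identifications of a face occur. *)
Definition psi (g : bijection R3) (z : R * R) : R3 := grid_shift (g (z.1, z.2, 0)).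

Lemma floor_unit a : 0 <= a <= 1 -> a \isn't a Num.int -> Num.floor a = 0.
Proof.
move=> /andP[a0 a1] na; apply: floor_def; rewrite a0 /= add0r lt_neqAle a1 andbT.
by apply: contra na => /eqP ->; rewrite rpred1.
Qed.

Lemma mu_square z : sq z -> mu (z.1, z.2, 0).
Proof.
case: z => s t /andP[/= hs ht]; rewrite /mu /chk /chk' /= rpred0 !orbT andbT.
have [//|is_] := boolP (s \is a Num.int); have [//|it] := boolP (t \is a Num.int).
by rewrite /parity !floor_unit.
Qed.

Lemma int_unit a : 0 <= a <= 1 -> (a \is a Num.int) = (a \in [:: 0; 1]).
Proof.
move=> a01; apply/idP/idP; last by rewrite !inE => /orP[]/eqP ->; rewrite ?rpred0 ?rpred1.
move=> /intrP[n na]; move: a01; rewrite na -[0]/(0%:~R) -[1]/(1%:~R) !ler_int !inE !eqr_int.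
by lia.
Qed.

Lemma int3_square z : sq z -> int3 (z.1, z.2, 0) = corner z.
Proof.
by case: z => s t /andP[/= hs ht]; rewrite /int3 /corner /= rpred0 andbT !int_unit.
Qed.

Lemma psi_mucube g z : sym g -> sq z -> mucube (psi g z).
Proof. by move=> [_ _ gm _] sz; apply/mucube_shift; rewrite gm; exact: mu_square. Qed.

Lemma psi_cone g z : sym g -> sq z -> cone_point (psi g z) <-> corner z.
Proof. by move=> [_ _ _ gc] sz; rewrite cone_point_shift gc int3_square. Qed.

Lemma psi_mucube0 g z : sym g -> sq z -> ~~ corner z -> mucube0 (psi g z).
Proof.
move=> sg sz cz; split; first exact: psi_mucube.
by move/(psi_cone sg sz); exact/negP.
Qed.

Definition grid_shift_inv v : R3 := (v.1.1 - 2^-1, v.1.2 - 1 - 2^-1, v.2 - 2^-1).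
Lemma grid_shiftK : cancel grid_shift grid_shift_inv.
Proof. by move=> [[s t] w]; rewrite /grid_shift /grid_shift_inv /=; congr (_, _, _); ring. Qed.
Lemma grid_shift_invK : cancel grid_shift_inv grid_shift.
Proof. by move=> [[s t] w]; rewrite /grid_shift /grid_shift_inv /=; congr (_, _, _); ring. Qed.

Lemma cover_horizontal v : mu v -> ~~ int3 v -> v.2 \is a Num.int ->
  exists g z, [/\ sym g, sq z & v = g (z.1, z.2, 0)].
Proof.
case: v => [[s t] w] /= mv iv iw.
have [i [j [ij hi hj]]] : exists i j : int, [/\ (i = j %[mod 2])%Z,
    i%:~R <= s <= i%:~R + 1 & j%:~R <= t <= j%:~R + 1].
  have [fs1 fs2] : (Num.floor s)%:~R <= s /\ s < (Num.floor s)%:~R + 1.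
    by split; [exact: floor_le|have := floorD1_gt s; rewrite intrD].
  have [ft1 ft2] : (Num.floor t)%:~R <= t /\ t < (Num.floor t)%:~R + 1.
    by split; [exact: floor_le|have := floorD1_gt t; rewrite intrD].
  have [st|st] := boolP (parity s == parity t).
    exists (Num.floor s), (Num.floor t); split; [exact/eqP|lra|lra].
  have [is_|is_] := boolP (s \is a Num.int).
    exists (Num.floor s - 1), (Num.floor t); split; rewrite ?intrD ?rmorphN /=; [|have := floorK is_; lra|lra].
    by move: st; rewrite /parity; lia.
  have [it|it] := boolP (t \is a Num.int).
    exists (Num.floor s), (Num.floor t - 1); split; rewrite ?intrD ?rmorphN /=; [|lra|have := floorK it; lra].
    by move: st; rewrite /parity; lia.
  by move: mv; rewrite /mu /chk' /= (negPf is_) (negPf it) (negPf st).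
have [k wk] := intrP iw; have [_ sM _] := sym_subgroup.
have sz : sq (s - i%:~R, t - j%:~R) by rewrite /sq /=; lra.
have [ik|ik] := eqVneq (i %% 2)%Z (k %% 2)%Z.
- exists (transl (i%:~R, j%:~R, k%:~R)), (s - i%:~R, t - j%:~R); split=> //.
    exact: sym_transl.
  by rewrite translE wk; congr (_, _, _) => /=; ring.
- exists (transl (i%:~R, j%:~R, (k - 1)%:~R) * mirror)%g, (s - i%:~R, t - j%:~R); split=> //.
    apply: sM; [apply: sym_transl => //; lia|exact: sym_mirror].
  by rewrite bijM mirrorE translE wk intrD rmorphN /=; congr (_, _, _) => /=; ring.
Qed.

Lemma mucube0_cover x : mucube0 x -> exists g z, [/\ sym g, sq z, ~~ corner z & x = psi g z].
Proof.
rewrite -(grid_shift_invK x); move: (grid_shift_inv x) => {x} v [/mucube_shift mv nc].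
have iv : ~~ int3 v by apply/negP => /cone_point_shift.
have [_ sM sV] := sym_subgroup.
suff [g [z [sg sz e]]] : exists g z, [/\ sym g, sq z & v = g (z.1, z.2, 0)].
  exists g, z; split=> //; last by rewrite /psi -e.
  by rewrite -int3_square //; case: sg => _ _ _ <-; rewrite -e.
have [iw|iw] := boolP (v.2 \is a Num.int); first exact: cover_horizontal.
have aux h : sym h -> (h^-1%g v).2 \is a Num.int ->
    exists g z, [/\ sym g, sq z & v = g (z.1, z.2, 0)].
  move=> sh hv; have [_ _ hm hi] := sV _ sh.
  have [||//|g [z [sg sz e]]] := @cover_horizontal (h^-1%g v).
  - by rewrite hm.
  - by rewrite hi.
  - by exists (h * g)%g, z; split; [exact: sM| |rewrite bijM -e bijVKg].
case: v mv nc iv iw aux => [[s t] w] mv nc iv /= iw aux.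
have [is_|is_] := boolP (s \is a Num.int).
  by apply: (aux _ sym_right); rewrite /= subr0 int1B.
have [it|it] := boolP (t \is a Num.int).
  by apply: (aux _ sym_up); rewrite /= subr0 -intD1 subrK.
(* With no integer coordinate, the first and third coordinates have the parity of the second,
   against the condition on the remaining pair: a point of the surface always has an integer
   coordinate. *)
move: mv; rewrite /mu /chk /chk' /= (negPf is_) (negPf it) (negPf iw) /=.
by move=> /and3P[/eqP -> /negP + /eqP e2]; rewrite e2 eqxx.
Qed.

End Mucube.

(** * The intrinsic metric on a face *)

Section FaceMetric.
Variable R : realType.
Local Notation R2 := (R * R)%type.
Local Notation R3 := (R * R * R)%type.
Implicit Types (g : bijection R3) (z : R2) (c : chart R).

Definition sq2 z := z.1 ^+ 2 + z.2 ^+ 2.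

Lemma sq2B z z' : sq2 (z - z') = (z.1 - z'.1) ^+ 2 + (z.2 - z'.2) ^+ 2.
Proof. by []. Qed.

Lemma dist3E (u v : R3) : dist3 u v = Num.sqrt (sq3 (u - v)).
Proof. by []. Qed.

Lemma dist2E (u v : R2) : dist2 u v = Num.sqrt (sq2 (u - v)).
Proof. by []. Qed.

Lemma psi_dist g z z' : sym g -> dist3 (psi g z) (psi g z') = dist2 z z'.
Proof.
move=> [_ gm _ _]; rewrite dist3E dist2E; congr Num.sqrt.
have := gm (z.1, z.2, 0) (z'.1, z'.2, 0); rewrite /psi.
move: (g _) (g _) => [[a b] d] [[a' b' d']]; rewrite /sq3 /sq2 /grid_shift /=.
by move=> e; rewrite subrr expr0n addr0 in e; rewrite -e; ring.
Qed.

Lemma dist3_ball (u v : R3) e : dist3 u v < e -> ball u e v.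
Proof.
move=> uv; have e0 : 0 < e by apply: le_lt_trans uv; exact: sqrtr_ge0.
have : sq3 (u - v) < e ^+ 2.
  by rewrite -[X in _ < X](@sqr_sqrtr _ (e ^+ 2)) ?sqr_ge0 // -(@sqr_sqrtr _ (sq3 _)) ?sqrtr_sqr ?ltrXn2r ?addr_ge0 ?sqr_ge0 // gtr0_norm // nnegrE ?sqrtr_ge0 ?ltW.
move: u v {uv} => [[a b] d] [[a' b'] d']; rewrite /sq3 /= => h.
split; first split; rewrite /ball /= ltr_norml; apply/andP; split;
  have := sqr_ge0 (a - a'); have := sqr_ge0 (b - b'); have := sqr_ge0 (d - d'); nra.
Qed.

Lemma dist2_lt z z' e : `|z'.1 - z.1| < e / 2 -> `|z'.2 - z.2| < e / 2 -> dist2 z z' < e.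
Proof.
move=> h1 h2; have e0 : 0 < e by have := normr_ge0 (z'.1 - z.1); lra.
rewrite dist2E -[e]gtr0_norm // -sqrtr_sqr ltr_sqrt ?exprn_gt0 //.
move: h1 h2; rewrite !ltr_norml /sq2 /= => /andP[? ?] /andP[? ?]; nra.
Qed.

Lemma psi_ball g z z' e : sym g ->
  `|z'.1 - z.1| < e / 2 -> `|z'.2 - z.2| < e / 2 -> ball (psi g z) e (psi g z').
Proof. by move=> sg h1 h2; apply: dist3_ball; rewrite psi_dist //; exact: dist2_lt. Qed.

Lemma dist3_continuous (f : R -> R3) t :
  (forall e, 0 < e -> exists2 d, 0 < d & forall t', `|t' - t| < d -> dist3 (f t) (f t') < e) ->
  {for t, continuous f}.
Proof.
move=> h; apply/cvg_ballP => e e0; have [d d0 hd] := h _ e0.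
apply/nbhs_ballP; exists d => //= t' tt'; apply: dist3_ball; apply: hd.
by rewrite distrC.
Qed.

Lemma dist2_line z (w : R2) t t' : dist2 (z + t *: w) (z + t' *: w) = `|t - t'| * Num.sqrt (sq2 w).
Proof.
rewrite dist2E -sqrtr_sqr -sqrtrM ?sqr_ge0 //; congr Num.sqrt.
by move: z w => [a b] [a' b']; rewrite /sq2 /= /GRing.scale /=; ring.
Qed.

Lemma sum_partition (C : R -> R3) d : (forall x y : R, dist3 (C x) (C y) = `|x - y| * d) ->
  forall (b : R) s a, path <%R a s ->
  \sum_(0 <= k < size s) dist3 (C (nth b (a :: s) k)) (C (nth b s k)) = (last a s - a) * d.
Proof.
move=> hC b; elim=> [|x s IH] a /=; first by rewrite big_nil subrr mul0r.
move=> /andP[ax xs]; rewrite big_nat_recl //= IH // hC distrC gtr0_norm ?subr_gt0 //.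
by ring.
Qed.

(** The straight segment stays in the convex face, and its polygonal sums telescope to the Euclidean
    distance; conversely the trivial partition bounds the length of every curve below by its
    chord. *)
Lemma intrinsic_dist_face g z z' : sym g -> sq z -> sq z' ->
  intrinsic_dist (psi g z) (psi g z') = (dist2 z z')%:E.
Proof.
move=> sg sz sz'; apply/eqP; rewrite eq_le; apply/andP; split.
- pose C t := psi g (z + t *: (z' - z)).
  have hC x y : dist3 (C x) (C y) = `|x - y| * dist2 z z'.
    by rewrite psi_dist // dist2_line dist2E -[sq2 (z - z')]/(_ + _) /sq2 /= -sqrrN opprB -[(z.2 - _) ^+ 2]sqrrN opprB.
  apply: ge_ereal_inf; exists (curve_length C 0 1).
    exists C => //; split=> //=.
    + apply: continuous_subspaceT => t; apply: dist3_continuous => e e0.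
      have d0 : 0 <= dist2 z z' by exact: sqrtr_ge0.
      exists (e / (dist2 z z' + 1)); first by rewrite divr_gt0 //; lra.
      move=> t'; rewrite ltr_pdivlMr ?hC; last lra.
      by rewrite distrC; have := normr_ge0 (t - t'); nra.
    + by rewrite /C scale0r addr0.
    + by rewrite /C scale1r addrC subrK.
    + move=> t; rewrite in_itv /= => /andP[t0 t1]; apply: psi_mucube => //.
      move: sz sz'; rewrite /sq /= /GRing.scale /= => /andP[/andP[a1 a2] /andP[a3 a4]] /andP[/andP[b1 b2] /andP[b3 b4]].
      by apply/andP; split; apply/andP; split; nra.
  apply: ge_ereal_sup => _ [s [/= ps /eqP ls] <-].
  by rewrite lee_fin (sum_partition hC) // ls subr0 mul1r.
- apply: le_ereal_inf_tmp => _ [C [_ C0 C1 _] <-].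
  apply: le_ereal_sup_tmp; exists ((dist3 (C 0) (C 1))%:E).
    exists [:: 1]; first exact: itv_partition1.
    by rewrite /= big_nat1.
  by rewrite C0 C1 psi_dist.
Qed.

Definition orthonormal_pair (u1 u2 : R2) :=
  [/\ u1.1 ^+ 2 + u1.2 ^+ 2 = 1, u2.1 ^+ 2 + u2.2 ^+ 2 = 1 & u1.1 * u2.1 + u1.2 * u2.2 = 0].

Lemma orthonormal_transpose (p q r s : R) : p ^+ 2 + q ^+ 2 = 1 ->
  r ^+ 2 + s ^+ 2 = 1 -> p * r + q * s = 0 ->
  [/\ p ^+ 2 + r ^+ 2 = 1, q ^+ 2 + s ^+ 2 = 1 & p * q + r * s = 0].
Proof.
(* [D] is the determinant, and orthogonality forces (r, s) = D (-q, p) with D^2 = 1. *)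
move=> h1 h2 h3; pose D := p * s - q * r.
have hs : s = p * D.
  have -> : p * D = s * (p ^+ 2 + q ^+ 2) - q * (p * r + q * s) by rewrite /D; ring.
  by rewrite h1 h3; ring.
have hr : r = - q * D.
  have -> : - q * D = r * (p ^+ 2 + q ^+ 2) - p * (p * r + q * s) by rewrite /D; ring.
  by rewrite h1 h3; ring.
have hD : D ^+ 2 = 1.
  have -> : D ^+ 2 = (p ^+ 2 + q ^+ 2) * (r ^+ 2 + s ^+ 2) - (p * r + q * s) ^+ 2 by rewrite /D; ring.
  by rewrite h1 h2 h3; ring.
split.
- rewrite hr; have -> : p ^+ 2 + (- q * D) ^+ 2 = p ^+ 2 + q ^+ 2 * D ^+ 2 by ring.
  by rewrite hD mulr1.
- rewrite hs; have -> : q ^+ 2 + (p * D) ^+ 2 = q ^+ 2 + p ^+ 2 * D ^+ 2 by ring.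
  by rewrite hD mulr1 addrC.
- rewrite hs hr; have -> : p * q + - q * D * (p * D) = p * q - p * q * D ^+ 2 by ring.
  by rewrite hD mulr1 subrr.
Qed.

(** By polarisation, the distances to three points forming a right angle determine the coordinates.
    No openness of [B] is asked for, so the lemma applies at boundary points of a face; the signs of
    [d1] and [d2] are free for the same reason. *)
Lemma isometry_affine (K : R2 -> R2) (B : set R2) (o : R2) (d1 d2 : R) :
  d1 != 0 -> d2 != 0 -> B o -> B (o.1 + d1, o.2) -> B (o.1, o.2 + d2) ->
  (forall a b, B a -> B b -> sq2 (K a - K b) = sq2 (a - b)) ->
  exists u1 u2, orthonormal_pair u1 u2 /\
    forall z, B z -> K z = K o + (z.1 - o.1) *: u1 + (z.2 - o.2) *: u2.
Proof.
move=> d10 d20 Bo B1 B2 iK.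
pose f := K (o.1 + d1, o.2) - K o; pose h := K (o.1, o.2 + d2) - K o.
have f2 : f.1 ^+ 2 + f.2 ^+ 2 = d1 ^+ 2.
  by rewrite -[LHS]/(sq2 f) iK // /sq2 /=; ring.
have h2 : h.1 ^+ 2 + h.2 ^+ 2 = d2 ^+ 2.
  by rewrite -[LHS]/(sq2 h) iK // /sq2 /=; ring.
have fh : f.1 * h.1 + f.2 * h.2 = 0.
  have : sq2 (f - h) = d1 ^+ 2 + d2 ^+ 2.
    by rewrite /f /h opprB addrA subrK iK // /sq2 /=; ring.
  by rewrite sq2B; lra.
pose p := f.1 / d1; pose q := f.2 / d1; pose r := h.1 / d2; pose s := h.2 / d2.
have fp : f.1 = p * d1 by rewrite /p mulfVK.
have fq : f.2 = q * d1 by rewrite /q mulfVK.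
have hr : h.1 = r * d2 by rewrite /r mulfVK.
have hs : h.2 = s * d2 by rewrite /s mulfVK.
have o1 : p ^+ 2 + q ^+ 2 = 1.
  apply: (@mulIf _ (d1 ^+ 2)); first by rewrite expf_neq0.
  by rewrite mul1r -[RHS]f2 fp fq; ring.
have o2 : r ^+ 2 + s ^+ 2 = 1.
  apply: (@mulIf _ (d2 ^+ 2)); first by rewrite expf_neq0.
  by rewrite mul1r -[RHS]h2 hr hs; ring.
have o3 : p * r + q * s = 0.
  apply: (@mulIf _ (d1 * d2)); first by rewrite mulf_neq0.
  by rewrite mul0r -[RHS]fh fp fq hr hs; ring.
have [t1 t2 t3] := orthonormal_transpose o1 o2 o3.
exists (p, q), (r, s); split=> // z Bz.
pose k := K z - K o; pose a := z.1 - o.1; pose b := z.2 - o.2.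
have k2 : k.1 ^+ 2 + k.2 ^+ 2 = a ^+ 2 + b ^+ 2.
  by rewrite -[LHS]/(sq2 k) iK.
have kf : k.1 * p + k.2 * q = a.
  have : sq2 (k - f) = (a - d1) ^+ 2 + b ^+ 2.
    by rewrite /k /f opprB addrA subrK iK // /sq2 /= /a /b; ring.
  rewrite sq2B fp fq => e; apply: (@mulIf _ d1) => //.
  by move: f2; rewrite fp fq => f2; lra.
have kh : k.1 * r + k.2 * s = b.
  have : sq2 (k - h) = a ^+ 2 + (b - d2) ^+ 2.
    by rewrite /k /h opprB addrA subrK iK // /sq2 /= /a /b; ring.
  rewrite sq2B hr hs => e; apply: (@mulIf _ d2) => //.
  by move: h2; rewrite hr hs => h2; lra.
rewrite -/a -/b -kf -kh.
have -> : K z = K o + k by rewrite /k addrC subrK.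
rewrite -addrA; congr (_ + _).
rewrite [k]surjective_pairing /=; congr (_, _).
- rewrite /=; have -> : (k.1 * p + k.2 * q) * p + (k.1 * r + k.2 * s) * r =
    k.1 * (p ^+ 2 + r ^+ 2) + k.2 * (p * q + r * s) by ring.
  by rewrite t1 t3 mulr0 mulr1 addr0.
- rewrite /=; have -> : (k.1 * p + k.2 * q) * q + (k.1 * r + k.2 * s) * s =
    k.1 * (p * q + r * s) + k.2 * (q ^+ 2 + s ^+ 2) by ring.
  by rewrite t2 t3 mulr0 mulr1 add0r.
Qed.

End FaceMetric.

(** * Charts on a face *)

Section Charts.
Variable R : realType.
Local Notation R2 := (R * R)%type.
Local Notation R3 := (R * R * R)%type.
Implicit Types (g : bijection R3) (z u : R2) (c d : chart R).

Definition close2 (e : R) z z' := `|z'.1 - z.1| < e /\ `|z'.2 - z.2| < e.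

Lemma close_refl e z : 0 < e -> close2 e z z.
Proof. by rewrite /close2 !subrr normr0. Qed.

Lemma close_trans e f z z' z'' : close2 e z z' -> close2 f z' z'' -> close2 (e + f) z z''.
Proof. by rewrite /close2 !ltr_norml => -[/andP[? ?] /andP[? ?]] [/andP[? ?] /andP[? ?]]; split; apply/andP; split; lra. Qed.

Lemma close_le e f z z' : e <= f -> close2 e z z' -> close2 f z z'.
Proof. by move=> ef [h1 h2]; split; exact: lt_le_trans ef. Qed.

(* Near [z], the chart [c] is affine on the closed face of [g], with derivative
   [(u1, u2)]. *)
Definition lin c g z u1 u2 := exists2 e, 0 < e &
  forall z', sq z' -> close2 e z z' -> cdom c (psi g z') /\
    cmap c (psi g z') = cmap c (psi g z) + (z'.1 - z.1) *: u1 + (z'.2 - z.2) *: u2.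

Lemma near_notcorner z : ~~ corner z ->
  exists2 e, 0 < e & forall z', close2 e z z' -> ~~ corner z'.
Proof.
move=> nc.
have aux (x : R) : x \notin [:: 0; 1] ->
    exists2 e, 0 < e & forall y, `|y - x| < e -> y \notin [:: 0; 1].
  rewrite !inE !negb_or => /andP[x0 x1].
  exists (Num.min `|x| `|x - 1|); first by rewrite lt_min !normr_gt0 subr_eq0 x0.
  move=> y; rewrite lt_min => /andP[y0 y1]; rewrite !inE negb_or.
  apply/andP; split; apply/eqP => e; move: y0 y1; rewrite e ?sub0r ?normrN ?ltxx //.
  by rewrite [`|1 - x|]distrC ltxx.
move: nc; rewrite /corner negb_and => /orP[/aux|/aux] [e e0 he]; exists e => // z' [h1 h2].
  by rewrite /corner negb_and (he _ h1).
by rewrite /corner negb_and (he _ h2) orbT.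
Qed.

Lemma chart_dom_near c g z : isometric_chart c -> sym g -> sq z -> ~~ corner z ->
  cdom c (psi g z) ->
  exists2 e, 0 < e & forall z', sq z' -> close2 e z z' -> cdom c (psi g z').
Proof.
move=> [[W oW domW] _ _ _] sg sz nc; rewrite domW => -[Wz _].
have /nbhs_ballP[e /= e0 eW] : nbhs (psi g z) W by exact: open_nbhs_nbhs.
have [f f0 hf] := near_notcorner nc.
exists (Num.min (e / 2) f); first by rewrite lt_min f0 divr_gt0.
move=> z' sz' cz'; split.
  have [h1 h2] : close2 (e / 2) z z' by apply: close_le cz'; rewrite ge_min lexx.
  by apply: eW; exact: psi_ball.
by apply: psi_mucube0 => //; apply: hf; apply: close_le cz'; rewrite ge_min lexx orbT.
Qed.

Lemma square_step z (e : R) : sq z -> 0 < e ->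
  exists d1 d2 : R, [/\ d1 != 0, d2 != 0, `|d1| < e, `|d2| < e &
    [/\ sq (z.1 + d1, z.2), sq (z.1, z.2 + d2) & sq (z.1 + d1, z.2 + d2)]].
Proof.
move=> /andP[s1 s2] e0.
have aux (x : R) : 0 <= x <= 1 -> exists d : R, [/\ d != 0, `|d| < e & 0 <= x + d <= 1].
  move=> /andP[x0 x1]; pose m := Num.min (e / 2) (2^-1).
  have m0 : 0 < m by rewrite lt_min; apply/andP; split; lra.
  have me : m < e by apply: (@le_lt_trans _ _ (e / 2)); [rewrite ge_min lexx|lra].
  have m2 : m <= 2^-1 by rewrite ge_min lexx orbT.
  have [h|h] := leP x (2^-1).
    by exists m; rewrite gt_eqF // gtr0_norm //; split => //; apply/andP; split; lra.
  exists (- m); rewrite oppr_eq0 gt_eqF // normrN gtr0_norm //; split => //.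
  by apply/andP; split; lra.
have [d1 [? ? ?]] := aux _ s1; have [d2 [? ? ?]] := aux _ s2.
by exists d1, d2; split=> //; split; apply/andP.
Qed.

(** On a closed face the intrinsic distance is Euclidean, so near [z] the chart is a Euclidean
    isometry of a disc or, at an edge point, of a half disc. *)
Lemma chart_lin c g z : isometric_chart c -> sym g -> sq z -> ~~ corner z ->
  cdom c (psi g z) -> exists u1 u2, orthonormal_pair u1 u2 /\ lin c g z u1 u2.
Proof.
move=> ic sg sz nc dz; have [e1 e10 he1] := chart_dom_near ic sg sz nc dz.
have [_ _ _ /(_ _ dz)] := ic.
case=> -[U V] /= [/nbhs_ballP[e2 /= e20 hU] /nbhs_ballP[e3 /= e30 hV]] UV.
pose e := Num.min e1 (Num.min (e2 / 2) (e3 / 2)).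
have e0 : 0 < e by rewrite !lt_min e10 !divr_gt0.
have [le1 le2 le3] : [/\ e <= e1, e <= e2 / 2 & e <= e3 / 2].
  have : e <= e by [].
  by rewrite {2}/e !le_min => /and3P[].
pose B := [set z' | sq z' /\ close2 e z z'].
have iB a b : B a -> B b ->
    sq2 (cmap c (psi g a) - cmap c (psi g b)) = sq2 (a - b).
  move=> [sa ca] [sb cb].
  have Ua : U (psi g a).
    by apply: hU; have [h1 h2] := close_le le2 ca; exact: psi_ball.
  have Vb : V (psi g b).
    by apply: hV; have [h1 h2] := close_le le3 cb; exact: psi_ball.
  have := UV (psi g a, psi g b) (conj Ua Vb).
  move=> /(_ (he1 _ sa (close_le le1 ca)) (he1 _ sb (close_le le1 cb))) /=.
  rewrite intrinsic_dist_face // => -[] /eqP; rewrite !dist2E eqr_sqrt ?addr_ge0 ?sqr_ge0 //.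
  by move=> /eqP ->.
have [d1 [d2 [d10 d20 hd1 hd2 [sd1 sd2 _]]]] := square_step sz e0.
have [||||u1 [u2 [on h]]] := isometry_affine (K := fun z => cmap c (psi g z)) (B := B) (o := z) d10 d20.
- by split => //; exact: close_refl.
- by split => //; split; rewrite /= ?subrr ?normr0 // addrC addKr.
- by split => //; split; rewrite /= ?subrr ?normr0 // addrC addKr.
- exact: iB.
exists u1, u2; split => //; exists e => // z' sz' cz'; split.
  exact: he1 (close_le le1 cz').
exact: h.
Qed.

Lemma lin_uniq c g z u1 u2 v1 v2 : sq z ->
  lin c g z u1 u2 -> lin c g z v1 v2 -> u1 = v1 /\ u2 = v2.
Proof.
move=> sz [e e0 he] [f f0 hf].
have m0 : 0 < Num.min e f by rewrite lt_min e0.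
have [d1 [d2 [d10 d20 hd1 hd2 [sd1 sd2 _]]]] := square_step sz m0.
move: hd1 hd2; rewrite !lt_min => /andP[d1e d1f] /andP[d2e d2f].
split.
- have [|_] := he _ sd1; first by split; rewrite /= ?subrr ?normr0 // addrC addKr.
  have [|_ ->] := hf _ sd1; first by split; rewrite /= ?subrr ?normr0 // addrC addKr.
  rewrite /= !subrr !scale0r !addr0 => /addrI.
  by rewrite [z.1 + d1]addrC addrK => /(scalerI d10).
- have [|_] := he _ sd2; first by split; rewrite /= ?subrr ?normr0 // addrC addKr.
  have [|_ ->] := hf _ sd2; first by split; rewrite /= ?subrr ?normr0 // addrC addKr.
  rewrite /= !subrr !scale0r !addr0 => /addrI.
  by rewrite [z.2 + d2]addrC addrK => /(scalerI d20).
Qed.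

Lemma add_scale2 (w u1 u2 : R2) (a a' b b' : R) :
  w + (a + a') *: u1 + (b + b') *: u2 = w + a *: u1 + b *: u2 + a' *: u1 + b' *: u2.
Proof. by rewrite !scalerDl -!addrA; congr (_ + (_ + _)); rewrite addrCA. Qed.

Lemma scale_add2 (k a b : R) (x w u1 u2 : R2) :
  k *: (x + a *: u1 + b *: u2) + w = k *: x + w + a *: (k *: u1) + b *: (k *: u2).
Proof.
rewrite !scalerDr !scalerA [k * a]mulrC [k * b]mulrC -!addrA; congr (_ + _).
by rewrite [RHS]addrC -addrA.
Qed.

Lemma lin_near c g z u1 u2 : sq z -> lin c g z u1 u2 ->
  exists2 e, 0 < e & forall z', sq z' -> close2 e z z' -> lin c g z' u1 u2.
Proof.
move=> sz [e e0 he]; exists (e / 2); first by rewrite divr_gt0.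
move=> z' sz' cz'; exists (e / 2) => [|z'' sz'' cz'']; first by rewrite divr_gt0.
have [_ h1] : cdom c (psi g z') /\ cmap c (psi g z') = cmap c (psi g z) + (z'.1 - z.1) *: u1 + (z'.2 - z.2) *: u2.
  by apply: he => //; apply: close_le cz'; lra.
have [h2 ->] : cdom c (psi g z'') /\ cmap c (psi g z'') = cmap c (psi g z) + (z''.1 - z.1) *: u1 + (z''.2 - z.2) *: u2.
  by apply: he => //; have := close_trans cz' cz''; apply: close_le; lra.
split=> //; rewrite h1.
have -> : z''.1 - z.1 = (z'.1 - z.1) + (z''.1 - z'.1) by ring.
have -> : z''.2 - z.2 = (z'.2 - z.2) + (z''.2 - z'.2) by ring.
exact: add_scale2.
Qed.

Lemma lin_compatible c d g z u1 u2 : isometric_chart d -> sym g -> sq z -> ~~ corner z ->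
  half_translation_compatible c d -> cdom c (psi g z) -> cdom d (psi g z) ->
  lin c g z u1 u2 -> exists s : bool, lin d g z ((-1) ^+ s *: u1) ((-1) ^+ s *: u2).
Proof.
move=> id_ sg sz nc cd dc dd [e e0 he].
have [s [w /nbhs_ballP[f /= f0 hf]]] := cd _ dc dd.
have [e' e'0 he'] := chart_dom_near id_ sg sz nc dd.
exists s; exists (Num.min e (Num.min e' (f / 2))).
  by rewrite !lt_min e0 e'0 divr_gt0.
move=> z' sz' cz'.
have cze : close2 e z z' by apply: close_le cz'; rewrite ge_min lexx.
have [h1 h2] := he _ sz' cze.
have h3 : cdom d (psi g z').
  by apply: he' => //; apply: close_le cz'; rewrite !ge_min lexx orbT.
have [h4 h5] : close2 (f / 2) z z'.
  by apply: close_le cz'; rewrite !ge_min lexx !orbT.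
split=> //; rewrite (hf _ (psi_ball sg h4 h5)) // (hf _ (ballxx _ f0)) // h2.
exact: scale_add2.
Qed.

Lemma psiM g h z : psi (g * h)%g z = grid_shift (g (h (z.1, z.2, 0))).
Proof. by []. Qed.

Lemma lin_flip c g z u1 u2 : sq z -> lin c g z u1 u2 ->
  lin c (g * flip R)%g (1 - z.1, z.2) (- u1) u2.
Proof.
move=> sz [e e0 he]; exists e => // z' sz' [h1 h2].
rewrite !psiM !flipE; have := he (1 - z'.1, z'.2).
rewrite /psi /= subKr; case.
- by move: sz'; rewrite /sq /= => /andP[? ->]; rewrite andbT; apply/andP; split; lra.
- split=> //=; move: h1; rewrite /= -normrN; congr (`|_| < _); ring.
- move=> dz ->; split=> //; rewrite -[z.1 in RHS]addr0; case: z {sz he h1 h2 dz} => a b /=.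
  by rewrite addr0; congr (_ + _ + _); rewrite scalerN -scaleNr; congr (_ *: _); ring.
Qed.

Lemma lin_swap c g z u1 u2 : lin c g z u1 u2 ->
  lin c (g * swap R)%g (z.2, z.1) u2 u1.
Proof.
move=> [e e0 he]; exists e => // z' sz' [h1 h2].
rewrite !psiM !swapE oppr0; have := he (z'.2, z'.1).
rewrite /psi /=; case=> //.
- by move: sz'; rewrite /sq /= andbC.
- by move=> dz ->; split=> //; rewrite addrAC.
Qed.

End Charts.

(** * Frames aligned with the charts *)

Section Standard.
Variable R : realType.
Local Notation R2 := (R * R)%type.
Local Notation R3 := (R * R * R)%type.
Implicit Types (g : bijection R3) (z u : R2) (c d : chart R) (A : set (chart R)).

(** Connectedness of an interval, by the supremum of the points up to which the truth value agrees
    with that at [a]. *)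
Lemma locally_constant (P : R -> Prop) (a b : R) : a <= b ->
  (forall t, a <= t <= b -> exists2 e, 0 < e &
     forall t', a <= t' <= b -> `|t' - t| < e -> (P t' <-> P t)) ->
  (P a <-> P b).
Proof.
move=> ab loc.
pose S := [set t | a <= t <= b /\ forall t', a <= t' <= t -> (P t' <-> P a)].
have Sa : S a.
  by split; [rewrite lexx|move=> t' t'a; have -> : t' = a by apply: le_anti; rewrite andbC].
have Sb : ubound S b by move=> t [/andP[]].
have supS : has_sup S by split; [exists a|exists b].
set s := sup S.
have as_ : a <= s by apply: sup_upper_bound.
have sb : s <= b by apply: sup_le_ub => //; exists a.
have sab : a <= s <= b by apply/andP.
have [e e0 he] := loc s sab.
have [t St ts] := sup_adherent e0 supS.
have [/andP[at_ tb] ht] := St.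
have tles : t <= s by apply: sup_upper_bound.
pose m := Num.min b (s + e / 2).
have Pt : P t <-> P a by apply: ht; rewrite at_ lexx.
have Pts : P t <-> P s.
  by apply: he; rewrite ?at_ // distrC ger0_norm ?subr_ge0 // -/s in ts *; lra.
have Sm : S m.
  have mb : m <= b by rewrite ge_min lexx.
  have ms : m <= s + e / 2 by rewrite ge_min lexx orbT.
  split; first by rewrite mb andbT le_min ab; lra.
  move=> t' /andP[at' t'm]; have [t't|tt'] := leP t' t; first by apply: ht; rewrite at'.
  have -> : P t' <-> P s.
    apply: he; first by rewrite at' (le_trans t'm).
    by move: ts; rewrite -/s => ts; rewrite ltr_norml; apply/andP; split; lra.
  by rewrite -Pts.
have ms : m <= s by apply: sup_upper_bound.
have mb : m = b.
  by move: ms; rewrite /m minElt; case: ifP => // _; lra.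
by have [_ h] := Sm; symmetry; apply: h; rewrite mb ab lexx.
Qed.

(* Up to sign, the charts at [psi g z] are the coordinates of the frame [g]. *)
Definition std_at A g z := forall c, A c -> cdom c (psi g z) ->
  exists s : bool, lin c g z ((-1) ^+ s, 0) (0, (-1) ^+ s).

Definition std A g := forall z, sq z -> ~~ corner z -> std_at A g z.

Lemma atlas_chart A x : half_translation_atlas A -> mucube0 x ->
  exists2 c, A c & cdom c x.
Proof. by move=> [_ cov _ _]; rewrite -cov => -[c Ac cx]; exists c. Qed.

Lemma atlas_isometric A c : half_translation_atlas A -> A c -> isometric_chart c.
Proof. by move=> [h _ _ _]; exact: h. Qed.

Lemma scale2E (k a b : R) : k *: (a, b) = (k * a, k * b) :> R2.
Proof. by []. Qed.

(** One chart decides, because the others differ from it by a sign and a translation. *)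
Lemma std_at_lin A c g z u1 u2 : half_translation_atlas A -> sym g -> sq z ->
  ~~ corner z -> A c -> cdom c (psi g z) -> lin c g z u1 u2 ->
  std_at A g z <-> exists s : bool, u1 = ((-1) ^+ s, 0) /\ u2 = (0, (-1) ^+ s).
Proof.
move=> atl sg sz nc Ac dc l; split=> [st|[s [e1 e2]] d Ad dd].
  have [s l'] := st _ Ac dc; exists s; exact: lin_uniq l l'.
have [_ _ comp _] := atl.
have [s' l'] := lin_compatible (atlas_isometric atl Ad) sg sz nc (comp _ _ Ac Ad) dc dd l.
exists (s' (+) s); move: l'; rewrite e1 e2 !scale2E !mulr0.
by rewrite -signr_addb.
Qed.

(** Corners are extreme points, so the closed square stays convex without them. *)
Lemma corner_convex z0 z1 t : sq z0 -> sq z1 -> ~~ corner z0 -> ~~ corner z1 ->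
  0 <= t <= 1 -> sq (z0 + t *: (z1 - z0)) && ~~ corner (z0 + t *: (z1 - z0)).
Proof.
move: z0 z1 => [x0 y0] [x1 y1] /andP[/= /andP[a1 a2] /andP[a3 a4]] /andP[/= /andP[b1 b2] /andP[b3 b4]].
move=> n0 n1 /andP[t0 t1].
have [t_0|tn0] := eqVneq t 0.
  by rewrite t_0 scale0r addr0 n0 /sq /= a1 a2 a3 a4.
have [t_1|tn1] := eqVneq t 1.
  by rewrite t_1 scale1r addrC subrK n1 /sq /= b1 b2 b3 b4.
have {tn0}t0 : 0 < t by rewrite lt_neqAle eq_sym tn0.
have {tn1}t1 : t < 1 by rewrite lt_neqAle tn1.
apply/andP; split.
  by rewrite /sq /= /GRing.scale /=; apply/andP; split; apply/andP; split; nra.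
apply: contra n0; rewrite /corner /= /GRing.scale /=.
have aux x y : 0 <= x <= 1 -> 0 <= y <= 1 -> x + t * (y - x) \in [:: 0; 1] -> x \in [:: 0; 1].
  move=> /andP[? ?] /andP[? ?]; rewrite !inE => /orP[/eqP e|/eqP e]; apply/orP; [left|right].
    by apply/eqP; nra.
  by apply/eqP; nra.
by move=> /andP[h1 h2]; apply/andP; split; [apply: aux h1|apply: aux h2]; apply/andP.
Qed.

(** Along a segment between two non-corner points the charts may change, but near each point a
    single chart has a constant derivative, so alignment is locally constant. *)
Lemma std_of_lin A c g z0 (s : bool) : half_translation_atlas A -> sym g -> A c ->
  sq z0 -> ~~ corner z0 -> cdom c (psi g z0) ->
  lin c g z0 ((-1) ^+ s, 0) (0, (-1) ^+ s) -> std A g.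
Proof.
move=> atl sg Ac sz0 nc0 dc l z1 sz1 nc1.
have st0 : std_at A g z0 by apply/(std_at_lin atl sg sz0 nc0 Ac dc l); exists s.
pose z t := z0 + t *: (z1 - z0).
have sz t : 0 <= t <= 1 -> sq (z t) /\ ~~ corner (z t).
  by move=> t01; apply/andP; exact: corner_convex.
suff : std_at A g (z 0) <-> std_at A g (z 1).
  by rewrite /z scale0r addr0 scale1r addrC subrK => <-.
apply: (@locally_constant (fun t => std_at A g (z t))) => // t t01.
have [szt nct] := sz _ t01.
have [d Ad dd] := atlas_chart atl (psi_mucube0 sg szt nct).
have [u1 [u2 [on lt]]] := chart_lin (atlas_isometric atl Ad) sg szt nct dd.
have [e e0 he] := lin_near szt lt.
have [f f0 hf] := chart_dom_near (atlas_isometric atl Ad) sg szt nct dd.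
have m0 : 0 < Num.min e f by rewrite lt_min e0.
exists (Num.min e f) => // t' t'01 tt'.
have [szt' nct'] := sz _ t'01.
have ct : close2 (Num.min e f) (z t) (z t').
  move: sz0 sz1 tt' => /andP[/andP[? ?] /andP[? ?]] /andP[/andP[? ?] /andP[? ?]] tt'.
  rewrite /close2 /z /= /GRing.scale /=.
  have -> : z0.1 + t' * (z1.1 - z0.1) - (z0.1 + t * (z1.1 - z0.1)) = (t' - t) * (z1.1 - z0.1) by ring.
  have -> : z0.2 + t' * (z1.2 - z0.2) - (z0.2 + t * (z1.2 - z0.2)) = (t' - t) * (z1.2 - z0.2) by ring.
  rewrite !normrM; have h1 : `|z1.1 - z0.1| <= 1 by rewrite ler_norml; lra.
  have h2 : `|z1.2 - z0.2| <= 1 by rewrite ler_norml; lra.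
  by have := normr_ge0 (t' - t); split; nra.
rewrite (std_at_lin atl sg szt nct Ad dd lt).
apply: (std_at_lin atl sg szt' nct' Ad).
  by apply: hf => //; apply: close_le ct; rewrite ge_min lexx orbT.
by apply: he => //; apply: close_le ct; rewrite ge_min lexx.
Qed.

(** The derivatives on the two sides agree along the edge, so by orthonormality the transverse ones
    agree up to sign. The wrong sign would fold the two faces onto each other, against injectivity
    of the chart. *)
Lemma edge_right c g y u1 u2 : isometric_chart c -> sym g -> 0 < y < 1 ->
  cdom c (psi g (1, y)) -> orthonormal_pair u1 u2 ->
  lin c g (1, y) u1 u2 -> lin c (g * right 1 0)%g (0, y) u1 u2.
Proof.
move=> ic sg /andP[y0 y1] dc [q1 q2 q3] l.
have psir s t : psi (g * right 1 0)%g (s, t) = grid_shift (g (1, t, s)).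
  by rewrite psiM rightE /= !subr0 addr0.
have sgr : sym (g * right 1 0)%g by have [_ sM _] := sym_subgroup R; apply: sM => //; exact: sym_right.
have e01 : psi (g * right 1 0)%g (0, y) = psi g (1, y) by rewrite psir.
have s0 : sq (0, y) by rewrite /sq /= lexx ler01 !ltW.
have s1 : sq (1, y) by rewrite /sq /= lexx ler01 !ltW.
have nc x : ~~ corner (x, y).
  by rewrite /corner /= !inE (gt_eqF y0) (lt_eqF y1) andbF.
have [v1 [v2 [[p1 p2 p3] l']]] : exists v1 v2, orthonormal_pair v1 v2 /\ lin c (g * right 1 0)%g (0, y) v1 v2.
  by apply: chart_lin => //; rewrite e01.
have [e e0 he] := l; have [f f0 hf] := l'.
pose m := Num.min (Num.min e f) (Num.min (1 - y) 1).
have m0 : 0 < m by rewrite !lt_min e0 f0 ltr01 subr_gt0 y1.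
have [me mf my m1] : [/\ m <= e, m <= f, m <= 1 - y & m <= 1].
  have : m <= m by [].
  by rewrite {2}/m !le_min => /andP[/andP[-> ->] /andP[-> ->]].
pose n := m / 2; have n0 : 0 < n by rewrite divr_gt0.
have nm : n < m by rewrite /n; lra.
have u2v2 : u2 = v2.
  have [||_] := he (1, y + n).
  - by rewrite /sq /= lexx ler01; apply/andP; split; lra.
  - by split; rewrite /= ?subrr ?normr0 // addrC addKr gtr0_norm; lra.
  have [||_] := hf (0, y + n).
  - by rewrite /sq /= lexx ler01; apply/andP; split; lra.
  - by split; rewrite /= ?subrr ?normr0 // addrC addKr gtr0_norm; lra.
  rewrite !psir -/(psi g (1, y + n)) -/(psi g (1, y)) => -> /=.
  rewrite !subrr !scale0r !addr0 [y + n]addrC addrK => /addrI.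
  by move=> /(scalerI (lt0r_neq0 n0)).
pose k := v1.1 * u1.1 + v1.2 * u1.2.
have [t1 t2 t3] := orthonormal_transpose q1 q2 q3.
have vk : v1 = (k * u1.1, k * u1.2).
  move: p3; rewrite -u2v2 => p3; rewrite [LHS]surjective_pairing /k; congr (_, _).
  - have -> : (v1.1 * u1.1 + v1.2 * u1.2) * u1.1 =
      v1.1 * (u1.1 ^+ 2 + u2.1 ^+ 2) + v1.2 * (u1.1 * u1.2 + u2.1 * u2.2) - (v1.1 * u2.1 + v1.2 * u2.2) * u2.1 by ring.
    by rewrite t1 t3 p3; ring.
  - have -> : (v1.1 * u1.1 + v1.2 * u1.2) * u1.2 =
      v1.2 * (u1.2 ^+ 2 + u2.2 ^+ 2) + v1.1 * (u1.1 * u1.2 + u2.1 * u2.2) - (v1.1 * u2.1 + v1.2 * u2.2) * u2.2 by ring.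
    by rewrite t2 t3 p3; ring.
have k2 : k ^+ 2 = 1.
  move: p1; rewrite vk /= => <-.
  have -> : (k * u1.1) ^+ 2 + (k * u1.2) ^+ 2 = k ^+ 2 * (u1.1 ^+ 2 + u1.2 ^+ 2) by ring.
  by rewrite q1 mulr1.
have : (k == 1) || (k == -1) by rewrite -sqrf_eq1 k2.
case/orP=> /eqP ek.
  by move: l'; rewrite -u2v2 vk ek !mul1r -surjective_pairing.
(* In the folded case the points at distance [n] from the edge on both faces have the same image,
   although the faces are perpendicular in space. *)
have [||d1 h1] := he (1 - n, y).
- by rewrite /sq /=; apply/andP; split; apply/andP; split; lra.
- by split; rewrite /= ?subrr ?normr0 // addrC addKr normrN gtr0_norm; lra.
have [||d2] := hf (n, y).
- by rewrite /sq /=; apply/andP; split; apply/andP; split; lra.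
- by split; rewrite /= ?subrr ?normr0 // subr0 gtr0_norm; lra.
rewrite e01 vk ek !mulN1r /= subrr subr0 scale0r addr0.
have -> : n *: (- u1.1, - u1.2) = (1 - n - 1) *: u1 :> R2.
  by rewrite [u1 in RHS]surjective_pairing !scale2E; congr (_, _); ring.
have <- : cmap c (psi g (1 - n, y)) = cmap c (psi g (1, y)) + (1 - n - 1) *: u1.
  by rewrite h1 /= subrr scale0r addr0.
have [_ [_ inj] _ _] := ic.
move=> /inj; rewrite !inE => /(_ d2 d1).
rewrite psir => /(can_inj (@grid_shiftK R)) /(can_inj (bijKg g)) [] ne _.
by lra.
Qed.

End Standard.

(** * Crossing the edges and existence of aligned frames *)

Section Edges.
Variable R : realType.
Local Notation R2 := (R * R)%type.
Local Notation R3 := (R * R * R)%type.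
Implicit Types (g : bijection R3) (z u : R2) (c d : chart R) (A : set (chart R)).
Local Notation r := (right (1 : R) 0).
Local Notation u := (up (1 : R) 0).
Local Notation flip := (flip R).
Local Notation swap := (swap R).

Let symM g h : sym g -> sym h -> sym (g * h)%g.
Proof. by have [_ sM _] := sym_subgroup R; exact: sM. Qed.

Let symV g : sym g -> sym g^-1%g.
Proof. by have [_ _ sV] := sym_subgroup R; exact: sV. Qed.

Lemma flipK : (flip * flip = 1)%g.
Proof. by apply: bij_ext => -[[x y] z]; rewrite bijM !flipE bij1; congr (_, _, _); ring. Qed.

Lemma swapK : (swap * swap = 1)%g.
Proof. by apply: bij_ext => -[[x y] z]; rewrite bijM !swapE bij1 opprK. Qed.

Lemma flip_right_flip : (r * flip * r = flip)%g.
Proof.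
by apply: bij_ext => -[[x y] z]; rewrite 2!bijM rightE flipE rightE flipE; congr (_, _, _); ring.
Qed.

Lemma swap_right_swap : (swap * r * swap = u)%g.
Proof.
by apply: bij_ext => -[[x y] z]; rewrite 2!bijM swapE rightE swapE upE; congr (_, _, _) => /=; ring.
Qed.

Lemma orthonormal_pairN u1 u2 : orthonormal_pair u1 u2 -> orthonormal_pair (- u1 : R2) u2.
Proof.
move=> [h1 h2 h3]; split => //=; first by rewrite !sqrrN.
by rewrite !mulNr -opprD h3 oppr0.
Qed.

Lemma orthonormal_pairC u1 u2 : orthonormal_pair u1 u2 -> orthonormal_pair u2 (u1 : R2).
Proof. by move=> [h1 h2 h3]; split => //; rewrite mulrC [_.2 * _]mulrC. Qed.

Lemma psi_right g (y : R) : psi (g * r)%g (0, y) = psi g (1, y).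
Proof. by rewrite psiM rightE /= !subr0 addr0. Qed.

Lemma psi_up g (x : R) : psi (g * u)%g (x, 0) = psi g (x, 1).
Proof. by rewrite psiM upE /= !subr0 addr0 oppr0. Qed.

Lemma psi_flip g z : psi (g * flip)%g z = psi g (1 - z.1, z.2).
Proof. by []. Qed.

Lemma psi_swap g z : psi (g * swap)%g z = psi g (z.2, z.1).
Proof. by rewrite psiM swapE oppr0. Qed.

(** The converse crosses the same edge backwards: [g * r * flip] has it as its right edge, and
    [r * flip * r = flip] returns to the face of [g]. *)
Lemma lin_edge_right c g (y : R) u1 u2 : isometric_chart c -> sym g -> 0 < y < 1 ->
  cdom c (psi g (1, y)) -> orthonormal_pair u1 u2 ->
  lin c g (1, y) u1 u2 <-> lin c (g * r)%g (0, y) u1 u2.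
Proof.
move=> ic sg y01 dc on; split; first exact: edge_right.
have s0 : sq (0, y : R) by rewrite /sq /= lexx ler01; case/andP: y01 => ? ?; rewrite !ltW.
move=> /(lin_flip s0) /=; rewrite subr0 => l.
have l1 : lin c (g * r * flip * r)%g (0, y) (- u1) u2.
  apply: edge_right => //; last exact: orthonormal_pairN.
    by apply: symM; [apply: symM => //; exact: sym_right|exact: sym_flip].
  by rewrite psi_flip /= subrr psi_right.
have /(lin_flip s0) := l1; rewrite /= subr0 opprK.
have -> : (g * r * flip * r * flip = g * (r * flip * r * flip))%g by rewrite !mulgA.
by rewrite flip_right_flip flipK mulg1.
Qed.

Lemma lin_edge_up c g (x : R) u1 u2 : isometric_chart c -> sym g -> 0 < x < 1 ->
  cdom c (psi g (x, 1)) -> orthonormal_pair u1 u2 ->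
  lin c g (x, 1) u1 u2 <-> lin c (g * u)%g (x, 0) u1 u2.
Proof.
move=> ic sg x01 dc on.
have ss := sym_swap R.
have e : (g * u = g * swap * r * swap)%g by rewrite -!mulgA -swap_right_swap !mulgA.
have h := @lin_edge_right c (g * swap)%g x u2 u1 ic (symM sg ss) x01 _ (orthonormal_pairC on).
rewrite psi_swap /= in h; have {}h := h dc.
split=> [/lin_swap /h /lin_swap|/lin_swap]; rewrite e //=.
by rewrite -!mulgA swapK mulg1 mulgA => /h /lin_swap; rewrite -!mulgA swapK mulg1.
Qed.

Lemma orthonormal_pair_std (s : bool) : orthonormal_pair ((-1) ^+ s : R, 0) (0, (-1) ^+ s).
Proof. by case: s; split=> /=; ring. Qed.

Lemma std_right A g : half_translation_atlas A -> sym g -> std A g <-> std A (g * r)%g.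
Proof.
move=> atl sg; have sgr := symM sg (sym_right R).
have h01 : 0 < (2^-1 : R) < 1 by lra.
have s0 : sq (0, 2^-1 : R) by rewrite /sq /=; lra.
have s1 : sq (1, 2^-1 : R) by rewrite /sq /=; lra.
have nc (x : R) : ~~ corner (x, 2^-1 : R).
  by rewrite /corner /= !inE negb_and; apply/orP; right; rewrite negb_or; apply/andP; split; lra.
have [c Ac dc] := atlas_chart atl (psi_mucube0 sg s1 (nc 1)).
have dc0 : cdom c (psi (g * r)%g (0, 2^-1)) by rewrite psi_right.
have ic := atlas_isometric atl Ac.
split=> st.
- have [s l] := st _ s1 (nc 1) c Ac dc.
  apply: (std_of_lin atl sgr Ac s0 (nc 0) dc0 (s := s)).
  by apply/lin_edge_right => //; exact: orthonormal_pair_std.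
- have [s l] := st _ s0 (nc 0) c Ac dc0.
  apply: (std_of_lin atl sg Ac s1 (nc 1) dc (s := s)).
  by apply/lin_edge_right => //; exact: orthonormal_pair_std.
Qed.

Lemma std_up A g : half_translation_atlas A -> sym g -> std A g <-> std A (g * u)%g.
Proof.
move=> atl sg; have sgu := symM sg (sym_up R).
have h01 : 0 < (2^-1 : R) < 1 by lra.
have s0 : sq (2^-1 : R, 0) by rewrite /sq /=; lra.
have s1 : sq (2^-1 : R, 1) by rewrite /sq /=; lra.
have nc (x : R) : ~~ corner (2^-1 : R, x).
  by rewrite /corner /= !inE negb_and; apply/orP; left; rewrite negb_or; apply/andP; split; lra.
have [c Ac dc] := atlas_chart atl (psi_mucube0 sg s1 (nc 1)).
have dc0 : cdom c (psi (g * u)%g (2^-1, 0)) by rewrite psi_up.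
have ic := atlas_isometric atl Ac.
split=> st.
- have [s l] := st _ s1 (nc 1) c Ac dc.
  apply: (std_of_lin atl sgu Ac s0 (nc 0) dc0 (s := s)).
  by apply/lin_edge_up => //; exact: orthonormal_pair_std.
- have [s l] := st _ s0 (nc 0) c Ac dc0.
  apply: (std_of_lin atl sg Ac s1 (nc 1) dc (s := s)).
  by apply/lin_edge_up => //; exact: orthonormal_pair_std.
Qed.

(** Stated for all frames [g], the condition defines a subgroup; it can thus be the label set [K],
    and labels built from [right] and [up] keep a frame aligned. *)
Definition std_stable A k := sym k /\ forall g, sym g -> std A g <-> std A (g * k)%g.

Lemma std_stable_subgroup A : subgroup (std_stable A).
Proof.
split.
- by split=> [|g sg]; [case: (sym_subgroup R)|rewrite mulg1].
- move=> k l [sk hk] [sl hl]; split=> [|g sg]; first exact: symM.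
  by rewrite hk // hl ?mulgA //; exact: symM.
- move=> k [sk hk]; split=> [|g sg]; first exact: symV.
  by rewrite (hk (g * k^-1)%g) ?mulgVK //; exact/symM/symV.
Qed.

Lemma std_stable_right A : half_translation_atlas A -> std_stable A r.
Proof. by move=> atl; split=> [|g sg]; [exact: sym_right|exact: std_right]. Qed.

Lemma std_stable_up A : half_translation_atlas A -> std_stable A u.
Proof. by move=> atl; split=> [|g sg]; [exact: sym_up|exact: std_up]. Qed.

Lemma edge_axis_parallel c g u1 u2 : edges_axis_parallel c -> sym g ->
  cdom c (psi g (2^-1, 0)) -> lin c g (2^-1, 0) u1 u2 -> u1.1 = 0 \/ u1.2 = 0.
Proof.
move=> ec sg dc [e e0 he].
have sqx (x : R) : 0 <= x <= 1 -> sq (x, 0) by move=> h; rewrite /sq /= h lexx ler01.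
pose a := psi g (0, 0); pose b := psi g (1, 0).
have s0 : sq (0 : R, 0 : R) by apply: sqx; rewrite lexx ler01.
have s1 : sq (1 : R, 0 : R) by apply: sqx; rewrite lexx ler01.
have mid : 0 <= (2^-1 : R) <= 1 by lra.
have d01 (x y : R) : dist3 (psi g (x, 0)) (psi g (y, 0)) = `|x - y|.
  by rewrite psi_dist // dist2E sq2B /= subrr expr0n addr0 sqrtr_sqr.
(* [g] is affine only over the integers, so real multiples are recovered from distances: a point at
   distances t and 1 - t from the ends of a unit segment lies on it. *)
have segm (t : R) : 0 <= t <= 1 -> psi g (t, 0) = a + t *: (b - a).
  move=> t01; have := d01 t 0; have := d01 t 1; have := d01 1 0; rewrite -/a -/b.
  move: (psi g (t, 0)) a b => [[x1 x2] x3] [[a1 a2] a3] [[b1 b2] b3].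
  have sqd (p q : R3) (w : R) : dist3 p q = `|w| -> sq3 (p - q) = w ^+ 2.
    by rewrite dist3E => /(congr1 (fun x => x ^+ 2)); rewrite sqr_sqrtr ?real_normK ?num_real // !addr_ge0 ?sqr_ge0.
  move=> /sqd h1 /sqd h2 /sqd h3; move: h1 h2 h3; rewrite /sq3 /= => h1 h2 h3.
  have hs : (x1 - (a1 + t * (b1 - a1))) ^+ 2 + (x2 - (a2 + t * (b2 - a2))) ^+ 2
          + (x3 - (a3 + t * (b3 - a3))) ^+ 2 = 0.
    have : (x1 - a1) * (b1 - a1) + (x2 - a2) * (b2 - a2) + (x3 - a3) * (b3 - a3) = t by lra.
    move=> hp.
    have -> : (x1 - (a1 + t * (b1 - a1))) ^+ 2 + (x2 - (a2 + t * (b2 - a2))) ^+ 2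
          + (x3 - (a3 + t * (b3 - a3))) ^+ 2 =
       ((x1 - a1) ^+ 2 + (x2 - a2) ^+ 2 + (x3 - a3) ^+ 2)
       - 2 * t * ((x1 - a1) * (b1 - a1) + (x2 - a2) * (b2 - a2) + (x3 - a3) * (b3 - a3))
       + t ^+ 2 * ((b1 - a1) ^+ 2 + (b2 - a2) ^+ 2 + (b3 - a3) ^+ 2) by ring.
    by rewrite hp h3 h1; ring.
  have [q1 q2 q3] := And3 (sqr_ge0 (x1 - (a1 + t * (b1 - a1)))) (sqr_ge0 (x2 - (a2 + t * (b2 - a2)))) (sqr_ge0 (x3 - (a3 + t * (b3 - a3)))).
  have sq0 (w : R) : w ^+ 2 <= 0 -> w = 0.
    by move=> w0; apply/eqP; rewrite -sqrf_eq0; apply/eqP/le_anti; rewrite w0 sqr_ge0.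
  have e1 : x1 = a1 + t * (b1 - a1) by apply/eqP; rewrite -subr_eq0; apply/eqP; apply: sq0; lra.
  have e2 : x2 = a2 + t * (b2 - a2) by apply/eqP; rewrite -subr_eq0; apply/eqP; apply: sq0; lra.
  have e3 : x3 = a3 + t * (b3 - a3) by apply/eqP; rewrite -subr_eq0; apply/eqP; apply: sq0; lra.
  by rewrite e1 e2 e3.
have isE : is_edge [set psi g (t, 0) | t in `[0, 1]].
  exists a, b; split.
  - by apply/(psi_cone sg s0); rewrite /corner /= !inE eqxx.
  - by apply/(psi_cone sg s1); rewrite /corner /= !inE !eqxx orbT.
  - by rewrite d01 sub0r normrN normr1.
  - by apply/seteqP; split=> x [t /= ht <-]; exists t => //=; rewrite segm //; move: ht; rewrite in_itv.
have Emid : [set psi g (t, 0) | t in `[0, 1]] (psi g (2^-1, 0)).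
  by exists 2^-1 => //=; rewrite in_itv.
have step (f : R) : 0 < f -> exists2 t : R, t != 0 & [/\ 0 <= 2^-1 + t <= 1, `|t| < f / 2 & `|t| < e].
  move=> f0; pose m := Num.min (Num.min (f / 2) e) (2^-1).
  have m0 : 0 < m by rewrite !lt_min; apply/andP; split; [apply/andP; split|]; lra.
  have [mf me m1] : [/\ m <= f / 2, m <= e & m <= 2^-1].
    have : m <= m by [].
    by rewrite {2}/m !le_min => /andP[/andP[-> ->] ->].
  exists (m / 2); first by rewrite gt_eqF ?divr_gt0.
  by rewrite gtr0_norm ?divr_gt0 //; split; lra.
have pt (f : R) : 0 < f -> exists2 t : R, t != 0 & exists y,
    [/\ ball (psi g (2^-1, 0)) f y, [set psi g (t, 0) | t in `[0, 1]] y, cdom c y &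
        cmap c y = cmap c (psi g (2^-1, 0)) + t *: u1].
  move=> f0; have [t t0 [ht tf te]] := step f f0; exists t => //.
  have [||dy hy] := he (2^-1 + t, 0).
  - exact: sqx.
  - by split; rewrite /= ?subrr ?normr0 // addrC addKr.
  exists (psi g (2^-1 + t, 0)); split => //.
  - by apply: psi_ball => //=; rewrite ?subrr ?normr0 ?divr_gt0 // addrC addKr.
  - by exists (2^-1 + t) => //=; rewrite in_itv.
  - by rewrite hy /= subrr scale0r addr0 [2^-1 + t]addrC addrK.
case: (ec _ _ isE Emid dc) => /nbhs_ballP[f /= f0 hf]; [left|right];
  have [t t0 [y [by_ Ey dy hy]]] := pt f f0; have := hf _ by_ Ey dy;
  rewrite hy /= -[RHS]addr0 => /addrI /eqP; rewrite mulf_eq0 (negPf t0) /= => /eqP.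
  by [].
by [].
Qed.

Lemma std_exists A x : half_translation_atlas A -> mucube0 x ->
  exists g z, [/\ sym g, std A g, sq z, ~~ corner z & x = psi g z].
Proof.
move=> atl /mucube0_cover[g [z [sg sz nc ->]]].
have smid : sq (2^-1 : R, 0) by rewrite /sq /=; lra.
have smid' : sq (0, 2^-1 : R) by rewrite /sq /=; lra.
have nmid (a b : R) : a = 2^-1 \/ b = 2^-1 -> ~~ corner (a, b).
  have h0 : (2^-1 : R) != 0 by rewrite invr_eq0 pnatr_eq0.
  have h1 : (2^-1 : R) != 1 by rewrite invr_eq1 pnatr_eq1.
  by rewrite /corner /= !inE negb_and !negb_or => -[] ->; rewrite h0 h1 ?orbT.
have [c Ac dc] := atlas_chart atl (psi_mucube0 sg smid (nmid _ _ (or_introl erefl))).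
have ic := atlas_isometric atl Ac.
have [u1 [u2 [on l]]] := chart_lin ic sg smid (nmid _ _ (or_introl erefl)) dc.
have [_ _ _ /(_ _ Ac) ec] := atl.
have ax := edge_axis_parallel ec sg dc l.
suff [h [z1 [sh sz1 hpsi]]] : exists h z1, [/\ sym h, sq z1 /\ psi (g * h)%g z1 = psi g z & std A (g * h)%g].
  case: sz1 => sz1 e; exists (g * h)%g, z1; split => //; first exact: symM.
  by apply/negP => /(psi_cone (symM sg sh) sz1); rewrite e => /(psi_cone sg sz); exact/negP.
have sq1 (w : R) : w ^+ 2 = 1 -> exists s : bool, w = (-1) ^+ s.
  move=> /eqP; rewrite sqrf_eq1 => /orP[/eqP ->|/eqP ->]; first by exists false.
  by exists true.
(* After at most one swap of the axes, [u1] is horizontal; a flip then aligns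
   the signs of the two axes. *)
have fin k zk zm a b : sym k -> sq zk -> psi (g * k)%g zk = psi g z -> sq zm -> ~~ corner zm ->
    zm.1 = 2^-1 \/ zm.2 = 2^-1 ->
    cdom c (psi (g * k)%g zm) -> a ^+ 2 = 1 -> b ^+ 2 = 1 ->
    lin c (g * k)%g zm (a, 0) (0, b) ->
    exists h z1, [/\ sym h, sq z1 /\ psi (g * h)%g z1 = psi g z & std A (g * h)%g].
  move=> sk szk ek szm nzm hm dk /sq1[s ea] /sq1[s' eb] lk.
  have [ss|ss] := eqVneq s s'.
    exists k, zk; split => //.
    apply: (std_of_lin atl (symM sg sk) Ac szm nzm dk (s := s)).
    by move: lk; rewrite ea eb ss.
  have sqf (w : R2) : sq w -> sq (1 - w.1, w.2).
    by rewrite /sq /= => /andP[? ->]; rewrite andbT; apply/andP; split; lra.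
  exists (k * flip)%g, (1 - zk.1, zk.2); split; first exact/symM/sym_flip.
    split; first exact: sqf.
    by rewrite mulgA psi_flip /= subKr -surjective_pairing.
  apply: (std_of_lin atl (symM sg (symM sk (sym_flip R))) Ac (sqf _ szm) _ (s := s')).
  - by apply: nmid; case: hm => ->; [left; lra|right].
  - by rewrite mulgA psi_flip /= subKr -surjective_pairing.
  - have := lin_flip szm lk; rewrite mulgA ea eb.
    have -> : - ((-1) ^+ s, 0) = ((-1) ^+ s', 0) :> R2.
      rewrite -[LHS]/(- (-1) ^+ s, - 0) oppr0; congr (_, _).
      by case: s s' ss {ea eb} => [] [] //= _; rewrite ?expr0 ?expr1 ?opprK.
    by [].
move: on => [q1 q2 q3]; case: ax => u10.
- have a1 : u1.2 ^+ 2 = 1 by move: q1; rewrite u10 expr0n add0r.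
  have b0 : u2.2 = 0.
    by move: q3; rewrite u10 mul0r add0r => /eqP; rewrite mulf_eq0 -[u1.2 == 0]sqrf_eq0 a1 oner_eq0 => /eqP.
  have b1 : u2.1 ^+ 2 = 1 by move: q2; rewrite b0 expr0n addr0.
  apply: (fin swap (z.2, z.1) (0, 2^-1) u2.1 u1.2) => //.
  + exact: sym_swap.
  + by move: sz; rewrite /sq /= andbC.
  + by rewrite psi_swap /= -surjective_pairing.
  + by apply: nmid; right.
  + by right.
  + by rewrite psi_swap.
  + have := lin_swap l; rewrite /= [u1]surjective_pairing [u2]surjective_pairing /=.
    by rewrite u10 b0.
- have a1 : u1.1 ^+ 2 = 1 by move: q1; rewrite u10 expr0n addr0.
  have b0 : u2.1 = 0.
    by move: q3; rewrite u10 mul0r addr0 => /eqP; rewrite mulf_eq0 -[u1.1 == 0]sqrf_eq0 a1 oner_eq0 => /eqP.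
  have b1 : u2.2 ^+ 2 = 1 by move: q2; rewrite b0 expr0n add0r.
  apply: (fin 1%g z (2^-1, 0) u1.1 u2.2) => //; rewrite ?mulg1 //.
  + by apply: nmid; left.
  + by left.
  + by move: l; rewrite [u1]surjective_pairing [u2]surjective_pairing /= u10 b0.
Qed.

End Edges.

(** * Folding a line onto the surface *)

Section Fold.
Variable R : realType.
Local Notation R2 := (R * R)%type.
Local Notation R3 := (R * R * R)%type.
Implicit Types (g : bijection R3) (z w : R2) (c d : chart R) (A : set (chart R)).
Implicit Types (S : int -> int -> bijection R3).

Definition cell S z := S (Num.floor z.1) (Num.floor z.2).
Definition cell_frac z : R2 := (z.1 - (Num.floor z.1)%:~R, z.2 - (Num.floor z.2)%:~R).
Definition fold S z := psi (cell S z) (cell_frac z).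
Definition lattice z := (z.1 \is a Num.int) && (z.2 \is a Num.int).

Lemma add2E (a b a' b' : R) : (a, b) + (a', b') = (a + a', b + b') :> R2.
Proof. by []. Qed.

Lemma axis_scale2 (x : R2) (t a b m : R) :
  x + (t * a) *: (m, 0) + (t * b) *: (0, m) = x + t *: (m *: (a, b)) :> R2.
Proof.
rewrite -addrA; congr (_ + _); rewrite !scale2E add2E !mulr0 addr0 add0r.
by rewrite -!mulrA ![m * _]mulrC.
Qed.

Lemma floor_near (x a : R) : x \isn't a Num.int ->
  exists2 e, 0 < e & forall t, `|t| < e -> Num.floor (x + t * a) = Num.floor x.
Proof.
move=> nx; have h1 := nonint_gt nx; have h2 := floorD1_gt x; rewrite intrD in h2.
pose m := Num.min (x - (Num.floor x)%:~R) ((Num.floor x)%:~R + 1 - x).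
have m0 : 0 < m by rewrite lt_min; apply/andP; split; lra.
have [m1 m2] : m <= x - (Num.floor x)%:~R /\ m <= (Num.floor x)%:~R + 1 - x.
  have : m <= m by [].
  by rewrite {2}/m le_min => /andP[].
have a0 : 0 < `|a| + 1 by rewrite ltr_wpDl.
exists (m / (`|a| + 1)); first by rewrite divr_gt0.
move=> t; rewrite ltr_pdivlMr // => ht.
have : `|t * a| < m.
  by rewrite normrM; have := normr_ge0 t; have := normr_ge0 a; nra.
rewrite ltr_norml => /andP[h3 h4].
by apply: floor_def; rewrite intrD; apply/andP; split; lra.
Qed.

Lemma floor_near_int (x a : R) : x \is a Num.int ->
  exists2 e, 0 < e & forall t, `|t| < e ->
    Num.floor (x + t * a) = (if 0 <= t * a then Num.floor x else Num.floor x - 1)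
    /\ `|t * a| < 1.
Proof.
move=> ix; have fx := floorK ix.
have a0 : 0 < `|a| + 1 by rewrite ltr_wpDl.
exists (1 / (`|a| + 1)); first by rewrite divr_gt0.
move=> t; rewrite ltr_pdivlMr // => ht.
have h : `|t * a| < 1.
  by rewrite normrM; have := normr_ge0 t; have := normr_ge0 a; nra.
split=> //; move: h; rewrite ltr_norml => /andP[h3 h4].
by case: leP => h; apply: floor_def; rewrite !intrD ?rmorphN fx /=; apply/andP; split; lra.
Qed.

Lemma frac_sq z : sq (cell_frac z).
Proof.
have := floor_itv z.1; have := floor_itv z.2; rewrite !intrD /sq /cell_frac /=.
by move=> /andP[? ?] /andP[? ?]; apply/andP; split; apply/andP; split; lra.
Qed.

Lemma frac_int (x : R) : (x - (Num.floor x)%:~R \in [:: 0; 1]) = (x \is a Num.int).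
Proof.
rewrite !inE subr_eq0 intrEfloor [x == _]eq_sym; case: eqP => //= _.
by apply/negbTE; rewrite lt_eqF //; have := floorD1_gt x; rewrite intrD; lra.
Qed.

Lemma frac_corner z : corner (cell_frac z) = lattice z.
Proof. by rewrite /corner /cell_frac /= !frac_int. Qed.

Section Line.
Variables (A : set (chart R)) (p q k : int) (K : bijection R3 -> Prop)
  (S : int -> int -> bijection R3) (D : bijection R3).
Hypothesis atl : half_translation_atlas A.
Hypothesis lS : labelling K (right 1 0) (up 1 0) p q k S D.
Hypothesis symS : forall i j, sym (S i j).
Hypothesis stdS : forall i j, std A (S i j).
Local Notation v := (p%:~R, q%:~R : R).

Lemma scaleV (t : R) : t *: v = (t * p%:~R, t * q%:~R) :> R2.
Proof. by []. Qed.

(** Lattice points have integer levels, so comparing them with [k] amounts to comparing them with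
    any real level [x] of floor [k], in particular with that of the actual line. *)
Lemma sideE (i j : int) (x : R) : k = Num.floor x ->
  side p q k i j = (p%:~R * j%:~R - q%:~R * i%:~R <= x).
Proof. by move=> ->; rewrite /side floor_ge_int rmorphB !rmorphM. Qed.

(** By the floor convention a point on an edge belongs to the cell to its right or above, and the
    line may come from the cell on the other side; ([g1], [z1]) is the same point seen from there.
    When no edge is crossed, it is the original frame and point. *)
Lemma fold_local w : ~~ lattice w -> k = Num.floor (p%:~R * w.2 - q%:~R * w.1) ->
  exists g1 z1, [/\ sym g1, sq z1, psi g1 z1 = fold S w,
    forall c (s : bool), A c -> cdom c (fold S w) ->
      lin c (cell S w) (cell_frac w) ((-1) ^+ s, 0) (0, (-1) ^+ s) ->
      lin c g1 z1 ((-1) ^+ s, 0) (0, (-1) ^+ s) &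
    exists2 e, 0 < e & forall t, `|t| < e ->
      (sq (cell_frac w + t *: v) /\ fold S (w + t *: v) = psi (cell S w) (cell_frac w + t *: v)) \/
      (sq (z1 + t *: v) /\ fold S (w + t *: v) = psi g1 (z1 + t *: v))].
Proof.
move=> nl kw.
have frac_same t : Num.floor (w + t *: v).1 = Num.floor w.1 ->
    Num.floor (w + t *: v).2 = Num.floor w.2 ->
    sq (cell_frac w + t *: v) /\ fold S (w + t *: v) = psi (cell S w) (cell_frac w + t *: v).
  move=> e1 e2; have -> : cell_frac w + t *: v = cell_frac (w + t *: v).
    rewrite /cell_frac e1 e2 scaleV /=; congr (_, _) => /=; ring.
  by split; [exact: frac_sq|rewrite /fold /cell e1 e2].
have [i1|n1] := boolP (w.1 \is a Num.int).
  have n2 : w.2 \isn't a Num.int by move: nl; rewrite /lattice i1.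
  have y0 := nonint_gt n2; have y1 := floorD1_gt w.2; rewrite intrD in y1.
  have fx := floorK i1.
  have [e1 e10 h1] := floor_near_int p%:~R i1; have [e2 e20 h2] := floor_near q%:~R n2.
  (* A vertical line contained in grid edges stays in the closed cell to its right, so there is no
     crossing and no constraint on labels. *)
  have [p0|pn0] := eqVneq p 0.
    exists (cell S w), (cell_frac w); split=> //; [exact: symS|exact: frac_sq|].
    exists (Num.min e1 e2); first by rewrite lt_min e10.
    move=> t; rewrite lt_min => /andP[t1 t2]; left; apply: frac_same.
      by rewrite scaleV /=; have [-> _] := h1 _ t1; rewrite p0 mulr0 lexx.
    by rewrite scaleV /= h2.
  have pR : (p%:~R : R) != 0 by rewrite intr_eq0.
  pose i := Num.floor w.1 - 1; pose j := Num.floor w.2.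
  have cellE : cell S w = (S i j * right 1 0)%g.
    rewrite /cell -/j; have -> : Num.floor w.1 = i + 1 by rewrite /i subrK.
    apply: (lab_r lS); rewrite !(sideE _ _ kw) /i subrK fx intrD -/j.
    have [pp|pp] : 0 < (p%:~R : R) \/ (p%:~R : R) < 0.
      by case: (ltgtP (p%:~R : R) 0) pR => //; [right|left].
    - have -> : p%:~R * j%:~R - q%:~R * w.1 <= p%:~R * w.2 - q%:~R * w.1 by nra.
      by apply/negP => /eqP/esym; apply/negP; rewrite -ltNge; nra.
    - have -> : p%:~R * (j%:~R + 1) - q%:~R * w.1 <= p%:~R * w.2 - q%:~R * w.1 by nra.
      by apply/negP => /eqP; apply/negP; rewrite -ltNge; nra.
  have y01 : 0 < w.2 - j%:~R < 1 by apply/andP; split; lra.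
  have fracE : cell_frac w = (0, w.2 - j%:~R) by rewrite /cell_frac fx subrr.
  have eps : psi (S i j) (1, w.2 - j%:~R) = fold S w.
    by rewrite /fold cellE fracE psi_right.
  exists (S i j), (1, w.2 - j%:~R); split=> //.
  - by rewrite /sq /= lexx ler01; case/andP: y01 => ? ?; rewrite !ltW.
  - move=> c s Ac dc; rewrite cellE fracE => l.
    apply/(lin_edge_right (atlas_isometric atl Ac) (symS i j) y01) => //; last exact: orthonormal_pair_std.
    by rewrite eps.
  exists (Num.min e1 e2); first by rewrite lt_min e10.
  move=> t; rewrite lt_min => /andP[t1 t2]; have [f1 tp] := h1 _ t1.
  have f2 := h2 _ t2.
  case: (leP 0 (t * p%:~R)) f1 => tp0 f1.
    by left; apply: frac_same; rewrite scaleV.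
  right; have -> : (1, w.2 - j%:~R) + t *: v = cell_frac (w + t *: v).
    by rewrite /cell_frac scaleV /= f1 f2 intrD rmorphN fx; congr (_, _) => /=; ring.
  by split; [exact: frac_sq|rewrite /fold /cell scaleV /= f1 f2].
have [e1 e10 h1] := floor_near p%:~R n1.
have x0 := nonint_gt n1; have x1 := floorD1_gt w.1; rewrite intrD in x1.
have [i2|n2] := boolP (w.2 \is a Num.int); last first.
  have [e2 e20 h2] := floor_near q%:~R n2.
  exists (cell S w), (cell_frac w); split=> //; [exact: symS|exact: frac_sq|].
  exists (Num.min e1 e2); first by rewrite lt_min e10.
  move=> t; rewrite lt_min => /andP[t1 t2]; left; apply: frac_same.
    by rewrite scaleV /= h1.
  by rewrite scaleV /= h2.
have fy := floorK i2.
have [e2 e20 h2] := floor_near_int q%:~R i2.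
have [q0|qn0] := eqVneq q 0.
  exists (cell S w), (cell_frac w); split=> //; [exact: symS|exact: frac_sq|].
  exists (Num.min e1 e2); first by rewrite lt_min e10.
  move=> t; rewrite lt_min => /andP[t1 t2]; left; apply: frac_same.
    by rewrite scaleV /= h1.
  by rewrite scaleV /=; have [-> _] := h2 _ t2; rewrite q0 mulr0 lexx.
have qR : (q%:~R : R) != 0 by rewrite intr_eq0.
pose i := Num.floor w.1; pose j := Num.floor w.2 - 1.
have cellE : cell S w = (S i j * up 1 0)%g.
  rewrite /cell -/i; have -> : Num.floor w.2 = j + 1 by rewrite /j subrK.
  apply: (lab_u lS); rewrite !(sideE _ _ kw) /j subrK fy intrD -/i.
  have [qq|qq] : 0 < (q%:~R : R) \/ (q%:~R : R) < 0.
    by case: (ltgtP (q%:~R : R) 0) qR => //; [right|left].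
  - have -> : p%:~R * w.2 - q%:~R * (i%:~R + 1) <= p%:~R * w.2 - q%:~R * w.1 by nra.
    by apply/negP => /eqP; apply/negP; rewrite -ltNge; nra.
  - have -> : p%:~R * w.2 - q%:~R * i%:~R <= p%:~R * w.2 - q%:~R * w.1 by nra.
    by apply/negP => /eqP/esym; apply/negP; rewrite -ltNge; nra.
have x01 : 0 < w.1 - i%:~R < 1 by apply/andP; split; lra.
have fracE : cell_frac w = (w.1 - i%:~R, 0) by rewrite /cell_frac fy subrr.
have eps : psi (S i j) (w.1 - i%:~R, 1) = fold S w.
  by rewrite /fold cellE fracE psi_up.
exists (S i j), (w.1 - i%:~R, 1); split=> //.
- by rewrite /sq /= lexx ler01; case/andP: x01 => ? ?; rewrite !ltW.
- move=> c s Ac dc; rewrite cellE fracE => l.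
  apply/(lin_edge_up (atlas_isometric atl Ac) (symS i j) x01) => //; last exact: orthonormal_pair_std.
  by rewrite eps.
exists (Num.min e1 e2); first by rewrite lt_min e10.
move=> t; rewrite lt_min => /andP[t1 t2]; have [f2 tp] := h2 _ t2.
have f1 := h1 _ t1.
case: (leP 0 (t * q%:~R)) f2 => tp0 f2.
  by left; apply: frac_same; rewrite scaleV.
right; have -> : (w.1 - i%:~R, 1) + t *: v = cell_frac (w + t *: v).
  by rewrite /cell_frac scaleV /= f1 f2 intrD rmorphN fy; congr (_, _) => /=; ring.
by split; [exact: frac_sq|rewrite /fold /cell scaleV /= f1 f2].
Qed.

Lemma close2_line z (e : R) : 0 < e ->
  exists2 f, 0 < f & forall t, `|t| < f -> close2 e z (z + t *: v).
Proof.
move=> e0; pose m : R := `|p%:~R| + `|q%:~R| + 1.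
have hp := normr_ge0 (p%:~R : R); have hq := normr_ge0 (q%:~R : R).
have m0 : 0 < m by rewrite /m; lra.
exists (e / m); first by rewrite divr_gt0.
move=> t; rewrite ltr_pdivlMr // => tm; have ht := normr_ge0 t.
rewrite /m in tm.
by split; rewrite /= addrC addKr -[_ *: _]/(_ * _) normrM; nra.
Qed.

Lemma fold_chart w c (s : bool) : ~~ lattice w ->
  k = Num.floor (p%:~R * w.2 - q%:~R * w.1) -> A c -> cdom c (fold S w) ->
  lin c (cell S w) (cell_frac w) ((-1) ^+ s, 0) (0, (-1) ^+ s) ->
  exists2 e, 0 < e & forall t, `|t| < e -> cdom c (fold S (w + t *: v)) /\
    cmap c (fold S (w + t *: v)) = cmap c (fold S w) + t *: ((-1) ^+ s *: v).
Proof.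
move=> nl kw Ac dc l.
have [g1 [z1 [sg1 sz1 e1 l1 [e e0 he]]]] := fold_local nl kw.
have {}l1 := l1 _ _ Ac dc l.
have [f1 f10 h1] := l; have [f2 f20 h2] := l1.
have [d1 d10 c1] := close2_line (cell_frac w) f10; have [d2 d20 c2] := close2_line z1 f20.
exists (Num.min e (Num.min d1 d2)); first by rewrite !lt_min e0 d10.
move=> t; rewrite !lt_min => /andP[te /andP[t1 t2]].
case: (he _ te) => -[sz ->].
- have [dz ->] := h1 _ sz (c1 _ t1); split=> //.
  rewrite -axis_scale2 /=; congr (_ + _ *: _ + _ *: _); rewrite [X in X - _]addrC addrK //.
- have [dz ->] := h2 _ sz (c2 _ t2); split=> //.
  rewrite -axis_scale2 e1 /=; congr (_ + _ *: _ + _ *: _); rewrite [X in X - _]addrC addrK //.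
Qed.

Lemma fold_mucube0 w : ~~ lattice w -> mucube0 (fold S w).
Proof. by move=> nl; apply: psi_mucube0; rewrite ?frac_corner //; [exact: symS|exact: frac_sq]. Qed.

Lemma fold_continuous w : ~~ lattice w -> k = Num.floor (p%:~R * w.2 - q%:~R * w.1) ->
  forall e, 0 < e -> exists2 d, 0 < d & forall t, `|t| < d ->
    dist3 (fold S w) (fold S (w + t *: v)) < e.
Proof.
move=> nl kw f f0.
have [g1 [z1 [sg1 sz1 e1 _ [e e0 he]]]] := fold_local nl kw.
have f20 : 0 < f / 2 by rewrite divr_gt0.
have [d1 d10 c1] := close2_line (cell_frac w) f20; have [d2 d20 c2] := close2_line z1 f20.
exists (Num.min e (Num.min d1 d2)); first by rewrite !lt_min e0 d10.
move=> t; rewrite !lt_min => /andP[te /andP[t1 t2]].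
case: (he _ te) => -[sz ->].
- by rewrite psi_dist; [have [? ?] := c1 _ t1; exact: dist2_lt|exact: symS].
- by rewrite -e1 psi_dist //; have [? ?] := c2 _ t2; exact: dist2_lt.
Qed.

(** At a lattice point the folded line may jump, so no limit is claimed: the nearby cone point is
    allowed to depend on [t]. *)
Lemma fold_near_cone w : lattice w -> forall e, 0 < e ->
  exists2 d, 0 < d & forall t, `|t| < d ->
    exists2 y, cone_point y & dist3 y (fold S (w + t *: v)) < e.
Proof.
move=> /andP[i1 i2] e e0.
have [e1 e10 h1] := floor_near_int p%:~R i1; have [e2 e20 h2] := floor_near_int q%:~R i2.
have e40 : 0 < e / 2 by rewrite divr_gt0.
have [d d0 hd] := close2_line (0, 0) e40.
exists (Num.min d (Num.min e1 e2)); first by rewrite !lt_min e10 d0.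
move=> t; rewrite !lt_min => /andP[td /andP[t1 t2]].
have [f1 _] := h1 _ t1; have [f2 _] := h2 _ t2.
pose cz : R2 := (if 0 <= t * p%:~R then 0 else 1, if 0 <= t * q%:~R then 0 else 1).
have ccz : corner cz by rewrite /corner /cz /=; do 2!case: ifP; rewrite !inE !eqxx ?orbT.
have scz : sq cz by rewrite /sq /cz /=; do 2!case: ifP; rewrite !lexx ler01.
exists (psi (cell S (w + t *: v)) cz); first by apply/psi_cone => //; exact: symS.
rewrite psi_dist; last exact: symS.
have [] := hd _ td; rewrite !add0r !subr0 scaleV /= => c1 c2.
have fE : cell_frac (w + t *: v) = (cz.1 + t * p%:~R, cz.2 + t * q%:~R).
  rewrite /cell_frac scaleV /= f1 f2 /cz /=; congr (_, _).
  - by case: ifP => _; rewrite ?intrD ?rmorphN (floorK i1) /=; ring.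
  - by case: ifP => _; rewrite ?intrD ?rmorphN (floorK i2) /=; ring.
by apply: dist2_lt; rewrite fE /= addrC addKr.
Qed.

Lemma fold_period w (n : nat) : fold S (w + n%:R *: v) =
  grid_shift ((D ^+ n)%g (cell S w ((cell_frac w).1, (cell_frac w).2, 0))).
Proof.
rewrite /fold /psi; congr grid_shift.
have fr : cell_frac (w + n%:R *: v) = cell_frac w /\ cell S (w + n%:R *: v) = (D ^+ n * cell S w)%g.
  have e1 (x : R) (m : int) : Num.floor (x + n%:R * m%:~R) = Num.floor x + m * n%:Z.
    by rewrite -[n%:R]/(n%:Z%:~R) -intrM mulrC floorDz.
  split; first by rewrite /cell_frac scaleV /= !e1 !intrD !intrM; congr (_, _) => /=; ring.
  rewrite /cell scaleV /= !e1; elim: (n) => [|m IH].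
    by rewrite expg0 mul1g !mulr0 !addr0.
  have -> : Num.floor w.1 + p * m.+1%:Z = Num.floor w.1 + p * m%:Z + p by rewrite intS; ring.
  have -> : Num.floor w.2 + q * m.+1%:Z = Num.floor w.2 + q * m%:Z + q by rewrite intS; ring.
  by rewrite (lab_period lS) IH expgS mulgA.
by case: fr => -> ->; rewrite bijM.
Qed.

End Line.
End Fold.

(** * Uniqueness of trajectories *)

Section Trajectories.
Variable R : realType.
Local Notation R2 := (R * R)%type.
Local Notation R3 := (R * R * R)%type.
Implicit Types (g : R -> R3) (z w : R2) (c d : chart R) (A : set (chart R)).
Implicit Types (S : int -> int -> bijection R3) (x y : R3).

Lemma mucube0_away x : mucube0 x -> exists2 e, 0 < e & forall y, cone_point y -> ~ ball x e y.
Proof.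
rewrite -(grid_shift_invK x); move: (grid_shift_inv x) => {x} v [_ nc].
have nv : ~~ int3 v by apply/negP => /cone_point_shift.
have aux (a : R) : a \isn't a Num.int -> exists2 e, 0 < e & forall n : R, n \is a Num.int -> e <= `|a - n|.
  move=> na; have h1 := nonint_gt na; have h2 := floorD1_gt a; rewrite intrD in h2.
  exists (Num.min (a - (Num.floor a)%:~R) ((Num.floor a)%:~R + 1 - a)).
    by rewrite lt_min; apply/andP; split; lra.
  move=> n /intrP[m ->]; have [h|h] := leP m (Num.floor a).
    have : (m%:~R : R) <= (Num.floor a)%:~R by rewrite ler_int.
    by move=> hm; rewrite ge_min gtr0_norm ?lerD2l ?lerN2 ?hm //; lra.
  have : ((Num.floor a)%:~R + 1 : R) <= m%:~R by rewrite -intrD1 ler_int; lia.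
  by move=> hm; rewrite ge_min ltr0_norm ?opprB ?lerD2r ?hm ?orbT //; lra.
have key (a b : R) e : e <= `|a - b| -> ~ `|a - b| < e by move=> h; rewrite ltNge h.
have sub2 (a b h : R) : a + h - (b + h) = a - b by ring.
move: v nv {nc} => [[a1 a2] a3]; rewrite /int3 /= !negb_and => /or3P[/aux|/aux|/aux] [e e0 he];
  exists e => // y; rewrite -(grid_shift_invK y); move: (grid_shift_inv y) => {y} [[b1 b2] b3];
  move=> /cone_point_shift /and3P[/= i1 i2 i3] [[/= + +] +]; rewrite /ball /= ?sub2 => h1 h2 h3.
- exact: key (he _ i1) h1.
- exact: key (he _ i2) h2.
- exact: key (he _ i3) h3.
Qed.

Lemma neq_away x y : x <> y -> exists2 e, 0 < e & ~ ball x e y.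
Proof.
move=> xy; exists `|x - y|; first by rewrite normr_gt0 subr_eq0; exact/eqP.
by rewrite -ball_normE /= ltxx.
Qed.

Lemma continuous_ball (g : R -> R3) t (e : R) : continuous g -> 0 < e ->
  exists2 f, 0 < f & forall t', `|t' - t| < f -> ball (g t) e (g t').
Proof.
move=> cg e0; have /cvg_ballP/(_ e e0)/nbhs_ballP[f /= f0 hf] := cg t.
by exists f => // t' tt'; apply: hf; rewrite /ball /= distrC.
Qed.

Lemma continuous_chart_dom (g : R -> R3) t c : isometric_chart c -> continuous g ->
  (forall t', mucube0 (g t')) -> cdom c (g t) ->
  exists2 f, 0 < f & forall t', `|t' - t| < f -> cdom c (g t').
Proof.
move=> [[W oW domW] _ _ _] cg mg; rewrite domW => -[Wt _].
have /nbhs_ballP[e /= e0 eW] : nbhs (g t) W by exact: open_nbhs_nbhs.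
have [f f0 hf] := continuous_ball t cg e0.
by exists f => // t' tt'; split; [apply: eW; exact: hf|exact: mg].
Qed.

Section Unique.
Variables (A : set (chart R)) (p q k : int) (K : bijection R3 -> Prop)
  (S : int -> int -> bijection R3) (D : bijection R3) (w0 : R2).
Hypothesis atl : half_translation_atlas A.
Hypothesis lS : labelling K (right 1 0) (up 1 0) p q k S D.
Hypothesis symS : forall i j, sym (S i j).
Hypothesis stdS : forall i j, std A (S i j).
Hypothesis pq0 : (p != 0) || (q != 0).
Hypothesis kw : k = Num.floor (p%:~R * w0.2 - q%:~R * w0.1).
Local Notation v := (p%:~R, q%:~R : R).
Local Notation line t := (w0 + t *: v).

Lemma line_level t : k = Num.floor (p%:~R * (line t).2 - q%:~R * (line t).1).
Proof.
rewrite kw scaleV /=; congr Num.floor; ring.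
Qed.

Lemma line_step t t' : line t' = line t + (t' - t) *: v.
Proof. by rewrite -addrA -scalerDl addrC [t + _]addrC subrK addrC. Qed.

Lemma v_neq0 : v != 0 :> R2.
Proof.
rewrite -[0 : R2]/(0, 0) xpair_eqE !intr_eq0 negb_and; exact: pq0.
Qed.

Lemma fold_chart_ex t c : A c -> ~~ lattice (line t) -> cdom c (fold S (line t)) ->
  exists s : bool, exists2 e, 0 < e & forall t', `|t' - t| < e ->
    cdom c (fold S (line t')) /\
    cmap c (fold S (line t')) = cmap c (fold S (line t)) + (t' - t) *: ((-1) ^+ s *: v).
Proof.
move=> Ac nl dc.
have nc : ~~ corner (cell_frac (line t)) by rewrite frac_corner.
have [s l] := stdS (frac_sq _) nc Ac dc.
have [e e0 he] := fold_chart atl lS symS nl (line_level t) Ac dc l.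
exists s, e => // t' tt'; rewrite (line_step t t'); exact: he.
Qed.

Lemma fold_line_continuous t (e : R) : ~~ lattice (line t) -> 0 < e ->
  exists2 d, 0 < d & forall t', `|t' - t| < d ->
    dist3 (fold S (line t)) (fold S (line t')) < e.
Proof.
move=> nl e0; have [d d0 hd] := fold_continuous atl lS symS nl (line_level t) e0.
by exists d => // t' tt'; rewrite (line_step t t'); exact: hd.
Qed.

Definition germ_eq (g : R -> R3) t := exists2 e, 0 < e &
  forall t', `|t' - t| < e -> g t' = fold S (line t').

Lemma germ_eq_open g t : germ_eq g t -> exists2 e, 0 < e &
  forall t', `|t' - t| < e -> germ_eq g t'.
Proof.
move=> [e e0 he]; exists (e / 2); first by rewrite divr_gt0.
move=> t' tt'; exists (e / 2); first by rewrite divr_gt0.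
move=> t'' h; apply: he; have -> : t'' - t = (t'' - t') + (t' - t) by ring.
by apply: le_lt_trans (ler_normD _ _) _; lra.
Qed.

Lemma germ_eq_at g t : germ_eq g t -> g t = fold S (line t).
Proof. by move=> [e e0]; apply; rewrite subrr normr0. Qed.

(** At a lattice point the fold approaches cone points, from which the trajectory keeps a distance;
    where the values differ, continuity separates them; where the values agree but the germs do not,
    a common chart shows the two moving in opposite directions. *)
Lemma germ_eq_closed g t : straight_line_trajectory A v g -> ~ germ_eq g t ->
  exists2 e, 0 < e & forall t', `|t' - t| < e -> ~ germ_eq g t'.
Proof.
move=> [cg mg tg] ng.
have [l|nl] := boolP (lattice (line t)).
  have [e e0 he] := mucube0_away (mg t).
  have e20 : 0 < e / 2 by rewrite divr_gt0.
  have [f1 f10 h1] := continuous_ball t cg e20.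
  have [f2 f20 h2] := fold_near_cone p q symS l e20.
  exists (Num.min f1 f2); first by rewrite lt_min f10.
  move=> t'; rewrite lt_min => /andP[t1 t2] /germ_eq_at gt'.
  have [y cy hy] := h2 _ t2; apply: (he _ cy).
  apply: (@ball_split _ _ (g t')); first exact: h1.
  by rewrite gt' (line_step t t'); apply/ball_sym/dist3_ball.
have [eqt|neqt] := pselect (g t = fold S (line t)); last first.
  have [e e0 he] := neq_away neqt.
  have e20 : 0 < e / 2 by rewrite divr_gt0.
  have [f1 f10 h1] := continuous_ball t cg e20.
  have [f2 f20 h2] := fold_line_continuous nl e20.
  exists (Num.min f1 f2); first by rewrite lt_min f10.
  move=> t'; rewrite lt_min => /andP[t1 t2] /germ_eq_at gt'; apply: he.
  apply: (@ball_split _ _ (g t')); first exact: h1.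
  by rewrite gt'; apply/ball_sym/dist3_ball/h2.
have [c Ac dc] := atlas_chart atl (mg t).
have [s1 /nbhs_ballP[e1 /= e10 h1]] := tg c t Ac dc.
have dcf : cdom c (fold S (line t)) by rewrite -eqt.
have [s2 [e2 e20 h2]] := fold_chart_ex Ac nl dcf.
have ic := atlas_isometric atl Ac.
have [e3 e30 h3] := continuous_chart_dom ic cg mg dc.
exists (Num.min e1 (Num.min e2 e3)); first by rewrite !lt_min e10 e20.
have [ss|ss] := eqVneq s1 s2.
  (* With equal signs both curves have the same image in the chart, and injectivity makes the germs
     agree. *)
  case: ng; exists (Num.min e1 (Num.min e2 e3)); first by rewrite !lt_min e10 e20.
  move=> t'; rewrite !lt_min => /andP[t1 /andP[t2 t3]].
  have [d2 m2] := h2 _ t2.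
  have m1 := h1 t'; rewrite /ball /= distrC in m1; have {}m1 := m1 t1.
  have [_ [_ inj] _ _] := ic; apply: inj; rewrite ?inE //; first exact: h3.
  by rewrite m1 m2 eqt ss.
move=> t'; rewrite !lt_min => /andP[t1 /andP[t2 t3]].
have [->//|tt'] := eqVneq t' t.
move=> /germ_eq_at gt'; have [d2 m2] := h2 _ t2.
have m1 := h1 t'; rewrite /ball /= distrC in m1; have {}m1 := m1 t1.
have ne : t' - t != 0 by rewrite subr_eq0.
move: m1; rewrite gt' m2 eqt => /addrI/(scalerI ne).
have -> : (-1) ^+ s1 = - (-1) ^+ s2 :> R.
  by case: s1 s2 ss {h1 h2 m2} => [] [] // _; rewrite ?expr0 ?expr1 ?opprK.
rewrite scaleNr => /eqP; rewrite -subr_eq0 opprK -mulr2n -scaler_nat scalerA scaler_eq0.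
by rewrite mulf_eq0 pnatr_eq0 signr_eq0 /= (negPf v_neq0).
Qed.

Lemma trajectory_fold g : straight_line_trajectory A v g -> germ_eq g 0 ->
  forall t, g t = fold S (line t).
Proof.
move=> tg g0 t; apply: germ_eq_at.
have loc t1 : exists2 e, 0 < e & forall t', `|t' - t1| < e -> (germ_eq g t' <-> germ_eq g t1).
  have [h|h] := pselect (germ_eq g t1).
    by have [e e0 he] := germ_eq_open h; exists e => // t' tt'; split=> // _; exact: he.
  by have [e e0 he] := germ_eq_closed tg h; exists e => // t' tt'; split=> // /(he _ tt').
have loc' (a b : R) : a <= b -> (germ_eq g a <-> germ_eq g b).
  move=> ab; apply: locally_constant => // t1 _.
  by have [e e0 he] := loc t1; exists e => // t' _; exact: he.
have [t0|t0] := leP 0 t; first by apply/(loc' _ _ t0).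
by apply/(loc' _ _ (ltW t0)).
Qed.

End Unique.
End Trajectories.

(** * Periodicity *)

Section Main.
Variable R : realType.
Local Notation R2 := (R * R)%type.
Local Notation R3 := (R * R * R)%type.
Implicit Types (z w : R2) (c d : chart R) (A : set (chart R)) (x y : R3).

Lemma lin_turn c (h : bijection R3) z u1 u2 : sq z -> lin c h z u1 u2 ->
  exists h' z', [/\ sym h -> sym h', sq z', psi h' z' = psi h z & lin c h' z' (- u1) (- u2)].
Proof.
move=> sz l; have [_ sM _] := sym_subgroup R.
have sqf (w : R2) : sq w -> sq (1 - w.1, w.2).
  by rewrite /sq /= => /andP[? ->]; rewrite andbT; apply/andP; split; lra.
have sqs (w : R2) : sq w -> sq (w.2, w.1) by rewrite /sq /= andbC.
have s1 : sq (z.2, 1 - z.1) by apply: (sqs (1 - z.1, z.2)); exact: sqf.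
exists (h * flip R * swap R * flip R * swap R)%g, (1 - z.1, 1 - z.2); split.
- move=> sh; have sf := sym_flip R; have ss := sym_swap R.
  exact: (sM _ _ (sM _ _ (sM _ _ (sM _ _ sh sf) ss) sf) ss).
- by move: sz; rewrite /sq /= => /andP[? ?]; apply/andP; split; lra.
- by rewrite psi_swap psi_flip psi_swap psi_flip /= !subKr -surjective_pairing.
- exact: (lin_swap (lin_flip s1 (lin_swap (lin_flip sz l)))).
Qed.

(** The sign [s] will be that of the trajectory, so that it moves along +v in the frame. The
    half-open square makes both floors of [z] vanish, so that its cell is the one labelled [S 0 0];
    points on the right or upper edge are passed to the next face. *)
Lemma std_frame A c x (s : bool) : half_translation_atlas A -> A c -> mucube0 x -> cdom c x ->
  exists g z, [/\ sym g, std A g, x = psi g z, lin c g z ((-1) ^+ s, 0) (0, (-1) ^+ s) &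
    ~~ corner z /\ (0 <= z.1 < 1) && (0 <= z.2 < 1)].
Proof.
move=> atl Ac mx dx; have ic := atlas_isometric atl Ac.
have [_ sM _] := sym_subgroup R.
have [g [z [sg sz nc ex l]]] : exists g z, [/\ sym g, sq z, ~~ corner z, x = psi g z &
    lin c g z ((-1) ^+ s, 0) (0, (-1) ^+ s)].
  have [g [z [sg stg sz nc ex]]] := std_exists atl mx.
  have dz : cdom c (psi g z) by rewrite -ex.
  have [s' l] := stg _ sz nc c Ac dz.
  have [ss|ss] := eqVneq s s'; first by exists g, z; rewrite ss.
  have [h [z' [sh sz' e l']]] := lin_turn sz l.
  exists h, z'; split=> //; first exact: sh.
  - by apply/negP => /(psi_cone (sh sg) sz'); rewrite e => /(psi_cone sg sz); exact/negP.
  - by rewrite e.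
  - move: l'; rewrite -[- (_, 0)]/(- _, - 0) -[- (0, _)]/(- 0, - _) oppr0.
    by case: s s' ss {l} => [] [] // _; rewrite ?expr0 ?expr1 ?opprK.
have dz : cdom c (psi g z) by rewrite -ex.
have stg := std_of_lin atl sg Ac sz nc dz l.
have on := @orthonormal_pair_std R s.
subst x; have [g' [z' [sg' sz' stg' nc' ex]]] : exists g' z', [/\ sym g', sq z' /\ z'.1 != 1,
    std A g' /\ lin c g' z' ((-1) ^+ s, 0) (0, (-1) ^+ s), ~~ corner z' & psi g z = psi g' z'].
  have [z1|z1] := eqVneq z.1 1; last by exists g, z.
  have zE : z = (1, z.2) by rewrite -z1 -surjective_pairing.
  have y01 : 0 < z.2 < 1.
    move: sz nc; rewrite /sq /corner z1 /= !inE eqxx orbT /= negb_or => /andP[_ /andP[h1 h2]] /andP[h3 h4].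
    by rewrite !lt_neqAle h1 h2 eq_sym h3 h4.
  have e1 : psi (g * right 1 0)%g (0, z.2) = psi g z by rewrite psi_right [in RHS]zE.
  exists (g * right 1 0)%g, (0, z.2); split.
  - exact/sM/sym_right.
  - by rewrite /sq /= lexx ler01 eq_sym oner_eq0; case/andP: y01 => ? ?; rewrite !ltW.
  - split; first by apply/(std_right atl sg).
    by apply/(lin_edge_right ic sg y01) => //; rewrite -zE.
  - by rewrite /corner /= !inE negb_and; case/andP: y01 => h1 h2; rewrite (gt_eqF h1) (lt_eqF h2) orbT.
  - by rewrite e1.
rewrite ex; case: sz' stg' => sz' z1 [stg' l']; have {dz}dz : cdom c (psi g' z') by rewrite -ex.
have z1lt : 0 <= z'.1 < 1 by move: sz' => /andP[/andP[-> h] _]; rewrite lt_neqAle z1.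
have [z2|z2] := eqVneq z'.2 1; last first.
  exists g', z'; split=> //; split=> //; rewrite z1lt.
  by move: sz' => /andP[_ /andP[-> h]]; rewrite lt_neqAle z2.
have zE : z' = (z'.1, 1) by rewrite -z2 -surjective_pairing.
have x01 : 0 < z'.1 < 1.
  move: nc'; rewrite /corner z2 /= !inE eqxx orbT andbT negb_or => /andP[h1 _].
  by move/andP: z1lt => [h2 ->]; rewrite andbT lt_neqAle eq_sym h1.
have e1 : psi (g' * up 1 0)%g (z'.1, 0) = psi g' z' by rewrite psi_up [in RHS]zE.
exists (g' * up 1 0)%g, (z'.1, 0); split.
- exact: (sM _ _ sg' (sym_up R)).
- by apply/(std_up atl sg').
- by rewrite e1.
- by apply/(lin_edge_up ic sg' x01) => //; rewrite -zE.
- rewrite /corner /= z1lt lexx ltr01; split=> //.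
  by rewrite !inE negb_and; case/andP: x01 => h1 h2; rewrite (gt_eqF h1) (lt_eqF h2).
Qed.

(** The labelling is built in [std_stable A] from 1 and then multiplied by [g], which need not lie
    in that subgroup: hence the trivial label set, and a holonomy conjugated by [g]. *)
Lemma std_labelling A p q k g : half_translation_atlas A -> gcdz p q = 1 ->
  sym g -> std A g ->
  exists S D0, [/\ labelling (fun=> True) (right 1 0) (up 1 0) p q k S (g * D0 * g^-1)%g,
    hol (1 : R) 0 p q D0, (forall i j, sym (S i j) /\ std A (S i j)) & S 0 0 = g].
Proof.
move=> atl pq1 sg stg; have [K1 KM KV] := std_stable_subgroup A.
have [D0 [k' [S' lS']] [S lS S0]] := labelling_ex k 0 0 (std_stable_subgroup A)
  (std_stable_right atl) (std_stable_up atl) K1 pq1.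
have [_ sM _] := sym_subgroup R.
exists (fun i j => g * S i j)%g, D0; split=> //.
- split=> [//|i j|i j|i j].
  + by move=> /(lab_r lS) ->; rewrite mulgA.
  + by move=> /(lab_u lS) ->; rewrite mulgA.
  + by rewrite (lab_period lS) !mulgA mulgVK.
- exists k', S'; case: lS' => h1 h2 h3 h4; split=> // i j.
  by case: (h1 i j) => -[].
- move=> i j; have [sS hS] := lab_in lS i j; split; first exact: sM.
  by apply/(hS _ sg).
- by rewrite S0 mulg1.
Qed.

Lemma periodic_of_finite_order A p q : half_translation_atlas A -> gcdz p q = 1 ->
  (forall D, hol (1 : R) 0 p q D -> finite_order D) ->
  periodic_direction A (p%:~R, q%:~R).
Proof.
move=> atl pq1 fin g tg; have [cg mg hg] := tg.
have [c Ac dc] := atlas_chart atl (mg 0).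
have [s /nbhs_ballP[e1 /= e10 h1]] := hg c 0 Ac dc.
have [f [z [sf stf ez l [nc z01]]]] := std_frame s atl Ac (mg 0) dc.
have fl : Num.floor z.1 = 0 /\ Num.floor z.2 = 0.
  by move/andP: z01 => [h2 h3]; split; apply: floor_def; rewrite add0r.
pose k := Num.floor (p%:~R * z.2 - q%:~R * z.1).
have [S [D0 [lS hD sS S0]]] := std_labelling k atl pq1 sf stf.
have symS i j : sym (S i j) by case: (sS i j).
have stdS i j : std A (S i j) by case: (sS i j).
have pq0 : (p != 0) || (q != 0).
  by apply: contraT; rewrite negb_or !negbK => /andP[/eqP p0 /eqP q0]; move: pq1; rewrite p0 q0.
have fz : cell_frac z = z by rewrite /cell_frac; case: fl => -> ->; rewrite !subr0 -surjective_pairing.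
have cz : cell S z = f by rewrite /cell; case: fl => -> ->.
have nl : ~~ lattice z by rewrite -frac_corner fz.
have foldz : fold S z = g 0 by rewrite /fold fz cz ez.
have dcz : cdom c (fold S z) by rewrite foldz.
have lz : lin c (cell S z) (cell_frac z) ((-1) ^+ s, 0) (0, (-1) ^+ s) by rewrite fz cz.
have germ : germ_eq p q S z g 0.
  have [e2 e20 h2] := fold_chart atl lS symS nl erefl Ac dcz lz.
  have ic := atlas_isometric atl Ac.
  have [e3 e30 h3] := continuous_chart_dom ic cg mg dc.
  exists (Num.min e1 (Num.min e2 e3)); first by rewrite !lt_min e10 e20.
  move=> t'; rewrite !lt_min subr0 => /andP[t1 /andP[t2 t3]].
  have [d2 m2] := h2 _ t2.
  have m1 := h1 t'; rewrite /ball /= sub0r normrN subr0 in m1; have {}m1 := m1 t1.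
  have [_ [_ inj] _ _] := ic; apply: inj; rewrite ?inE //; first by apply: h3; rewrite subr0.
  by rewrite m1 m2 foldz.
have gE := trajectory_fold atl lS symS stdS pq0 erefl tg germ.
have [n n0 Dn] : finite_order (f * D0 * f^-1)%g by apply: finite_order_conj; exact: fin.
(* The velocity is (p, q), so holonomy period and unit of time coincide. *)
exists n%:R; first by rewrite ltr0n.
move=> t; rewrite !gE scalerDl addrA (fold_period lS) Dn bij1.
by [].
Qed.

(** A continuous periodic function is bounded, whereas a nonzero gain [a] accumulates without bound;
    no relation between [T] and [n] is needed. *)
Lemma bounded_translation (f : R -> R) (T a : R) (n : nat) : continuous f -> 0 < T ->
  (forall t, f (t + T) = f t) -> (forall t, f (t + n%:R) = f t + a) -> a = 0.
Proof.
move=> cf T0 fT fa.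
have fTm (m : nat) t : f (t + m%:R * T) = f t.
  by elim: m t => [|m IH] t; rewrite ?mul0r ?addr0 // -natr1 mulrDl mul1r addrA fT IH.
have fam (m : nat) t : f (t + (m * n)%:R) = f t + m%:R * a.
  elim: m t => [|m IH] t; first by rewrite mul0n mul0r !addr0.
  by rewrite mulSn natrD [n%:R + _]addrC addrA fa IH -natr1; ring.
have cf' : {within `[0, T], continuous f} by exact: continuous_subspaceT.
have [c1 _ h1] := EVT_max (ltW T0) cf'; have [c2 _ h2] := EVT_min (ltW T0) cf'.
have bound t : 0 <= t -> f c2 <= f t <= f c1.
  move=> t0; pose m := Num.truncn (t / T).
  have /andP[m1 m2] : m%:R <= t / T < m.+1%:R by apply: truncn_itv; rewrite divr_ge0 // ltW.
  have -> : f t = f (t - m%:R * T) by rewrite -(fTm m (t - m%:R * T)) subrK.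
  have tT : t - m%:R * T \in `[0, T].
    rewrite in_itv /= subr_ge0 -ler_pdivlMr // m1 /= lerBlDl -[X in _ + X]mul1r -mulrDl natr1.
    by rewrite -ler_pdivrMr // ltW.
  by rewrite h1 ?h2.
apply/eqP; apply: contraT => a0.
have aa : 0 < `|a| by rewrite normr_gt0.
pose m := (Num.truncn ((f c1 - f c2) / `|a|)).+1.
have : (f c1 - f c2) / `|a| < m%:R by exact: truncnS_gt.
rewrite ltr_pdivrMr // => hm.
have := bound 0 (lexx _); have := bound (0 + (m * n)%:R); rewrite add0r ler0n => /(_ isT).
rewrite -[(m * n)%:R]add0r fam => /andP[b1 b2] /andP[b3 b4].
have : `|m%:R * a| <= f c1 - f c2 by rewrite ler_norml; apply/andP; split; lra.
by rewrite normrM ger0_norm ?ler0n // leNgt hm.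
Qed.

Lemma continuous_coordinates (g : R -> R3) : continuous g ->
  [/\ continuous (fun t => (g t).1.1), continuous (fun t => (g t).1.2) & continuous (fun t => (g t).2)].
Proof.
move=> cg; split=> t.
- by apply: (cvg_comp _ _ (cvg_comp _ _ (cg t) _)); [exact: cvg_fst|exact: cvg_fst].
- by apply: (cvg_comp _ _ (cvg_comp _ _ (cg t) _)); [exact: cvg_fst|exact: cvg_snd].
- by apply: (cvg_comp _ _ (cg t)); exact: cvg_snd.
Qed.

Lemma nonperiodic_of_translation A p q : half_translation_atlas A -> gcdz p q = 1 ->
  (forall D, hol (1 : R) 0 p q D -> translation_power D) ->
  ~ periodic_direction A (p%:~R, q%:~R).
Proof.
move=> atl pq1 tr per.
have [K1 _ _] := sym_subgroup R.
have s1 : sq (2^-1 : R, 0) by rewrite /sq /=; lra.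
have n1 : ~~ corner (2^-1 : R, 0).
  by rewrite /corner /= !inE negb_and negb_or invr_eq0 pnatr_eq0 invr_eq1 pnatr_eq1.
have [f [z [sf stf _ _ _]]] := std_exists atl (psi_mucube0 K1 s1 n1).
have [S [D0 [lS hD sS _]]] := std_labelling 0 atl pq1 sf stf.
have symS i j : sym (S i j) by case: (sS i j).
have stdS i j : std A (S i j) by case: (sS i j).
have [a [b]] := Bezoutz p q; rewrite pq1 => ab.
(* Half a Bezout vector has level 1/2. Lattice points have integer levels, so the line through [w]
   avoids them and folds to a trajectory defined for all times. *)
pose w : R2 := (- b%:~R / 2, a%:~R / 2).
have lev : p%:~R * w.2 - q%:~R * w.1 = 2^-1.
  have : (a * p + b * q)%:~R = 1 :> R by rewrite ab.
  by rewrite intrD !intrM /w /= => h; lra.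
have kw : 0 = Num.floor (p%:~R * w.2 - q%:~R * w.1).
  by rewrite lev; symmetry; apply: floor_def; rewrite add0r; lra.
pose v : R2 := (p%:~R, q%:~R).
have nl t : ~~ lattice (w + t *: v).
  apply/negP => /andP[i1 i2].
  have : p%:~R * (w + t *: v).2 - q%:~R * (w + t *: v).1 \is a Num.int.
    by rewrite rpredB // rpredM ?intr_int.
  have -> : p%:~R * (w + t *: v).2 - q%:~R * (w + t *: v).1 = 2^-1.
    by rewrite -lev /v scaleV /=; ring.
  move=> /intrP[m hm]; have : (1 : R) = (2 * m)%:~R by rewrite intrM -hm; lra.
  by rewrite -[1]/(1%:~R) => /eqP; rewrite eqr_int; lia.
pose g t := fold S (w + t *: v).
have cg : continuous g.
  move=> t; apply: dist3_continuous => e e0.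
  exact: (fold_line_continuous atl lS symS kw (nl t) e0).
have tg : straight_line_trajectory A v g.
  split=> // [t|c t Ac dc]; first exact: (fold_mucube0 symS (nl t)).
  have [s [e e0 he]] := fold_chart_ex atl lS symS stdS kw Ac (nl t) dc.
  exists s; apply/nbhs_ballP; exists e => //= t' tt'.
  by have [] := he t'; first by rewrite distrC.
have [T T0 gT] := per g tg.
have [n [c0 c0n hn]] : translation_power (f * D0 * f^-1)%g.
  by apply: translation_power_conj; [case: sf|exact: tr].
have gn t : g (t + n%:R) = g t + c0.
  rewrite /g scalerDl addrA (fold_period lS) hn /fold /psi /cell.
  move: (S _ _ _) c0 {c0n hn} => [[x1 x2] x3] [[y1 y2] y3].
  by rewrite /grid_shift !add3E; congr (_, _, _) => /=; ring.
have [cg1 cg2 cg3] := continuous_coordinates cg.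
have z1 : c0.1.1 = 0.
  by apply: (bounded_translation (T := T) (n := n) cg1 T0) => t; rewrite ?gT ?gn.
have z2 : c0.1.2 = 0.
  by apply: (bounded_translation (T := T) (n := n) cg2 T0) => t; rewrite ?gT ?gn.
have z3 : c0.2 = 0.
  by apply: (bounded_translation (T := T) (n := n) cg3 T0) => t; rewrite ?gT ?gn.
case/eqP: c0n; case: c0 z1 z2 z3 {hn gn} => [[y1 y2] y3] /= -> -> ->; done.
Qed.

End Main.

Theorem theorem1p1 (R : realType) (A : set (chart R)) (p q : int) :
  half_translation_atlas A -> gcdz p q = 1 ->
  (periodic_direction A (p%:~R, q%:~R) <->
   exists N : 'M[int]_2, Gamma N /\ N *m cV2 1 0 = cV2 p q).
Proof.
move=> atl pq1; split=> [per|orb].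
  apply: contrapT => nG; apply: (nonperiodic_of_translation atl pq1) per => D.
  exact: translation_power_orbit.
by apply: (periodic_of_finite_order atl pq1) => D; exact: finite_order_orbit.
Qed.
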